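(* Consider either the bosonic or the fermionic case. Let $f_L:\{p\in\mathbb{R}^3:p_1>0\}\to\mathbb{R}$ and $f_R:\{p\in\mathbb{R}^3:p_1<0\}\to\mathbb{R}$ be measurable, put $f_{LR}=f_L1_{p_1>0}+f_R1_{p_1<0}$, and assume: (1) $f_{LR}\ge 0$; (2) $\int_{\mathbb{R}^3} f_{LR}(1+|p|^2)\,dp<\infty$ and $\int_{\mathbb{R}^3}\frac{1}{|p_1|}f_{LR}(1+|p|^2)\,dp<\infty$; (3) for $i=2,3$, $\int_{\mathbb{R}^2}f_L\,p_i\,dp_2dp_3=0$ (for a.e. $p_1>0$) and $\int_{\mathbb{R}^2}f_R\,p_i\,dp_2dp_3=0$ (for a.e. $p_1<0$). Then there exists $\tau_0>0$ (depending on $f_L,f_R$) such that for every $\tau>\tau_0$ for which $k>0$ and $$\frac{a_u^{8/5}}{k^{3/5}}<\beta_{\mathcal B}(0)\ \text{ (boson)},\qquad \frac{a_u^{8/5}}{k^{3/5}}<\beta_{\mathcal F}(-\ln 3)\ \text{ (fermion)},$$ there exists a unique non-negative mild solution $f$ of the boundary value problem $$p_1\frac{\partial f}{\partial x}=\frac{N_f}{\tau}(\mathcal K(f)-f)\ \text{ on } [0,1]\times\mathbb{R}^3,\quad f(0,p)=f_L(p)\ (p_1>0),\quad f(1,p)=f_R(p)\ (p_1<0),$$ satisfying, for all $x\in[0,1]$, $$a_l\le N_f(x)\le a_u,\qquad c_l\le E_f(x)\le c_u,\qquad E_f(x)N_f(x)-|P_f(x)|^2\ge k.$$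
   Context: In $\pm$, the sign $+$ is for fermions ($\mathcal K=\mathcal F$) and $-$ is for bosons ($\mathcal K=\mathcal B$). Constants (depending on $f_L,f_R$ and $\tau>0$): $a_u=2\int_{\mathbb{R}^3}f_{LR}\,dp$, $a_l=\int_{\mathbb{R}^3}e^{-\frac{a_u}{\tau|p_1|}}f_{LR}\,dp$, $c_u=2\int_{\mathbb{R}^3}f_{LR}|p|^2dp$, $c_l=\int_{\mathbb{R}^3}e^{-\frac{a_u}{\tau|p_1|}}f_{LR}|p|^2dp$, and $$k=\Big(\int_{p_1>0}e^{-\frac{a_u}{\tau|p_1|}}f_L(p)|p_1|\,dp\Big)\Big(\int_{p_1<0}e^{-\frac{a_u}{\tau|p_1|}}f_R(p)|p_1|\,dp\Big).$$ The function $\beta_{\mathcal K}(c)=\frac{\int_{\mathbb{R}^3}\frac{1}{e^{|p|^2+c}\pm1}dp}{\left(\int_{\mathbb{R}^3}\frac{|p|^2}{e^{|p|^2+c}\pm1}dp\right)^{3/5}}$. $\beta_{\mathcal B}$ is strictly decreasing on $[0,\infty)$ with range $(0,\beta_{\mathcal B}(0)]$, and $\beta_{\mathcal F}$ is strictly decreasing on $(-\ln 3,\infty)$ with range $(0,\beta_{\mathcal F}(-\ln 3))$; $\beta_{\mathcal K}^{-1}$ denotes the inverse of the restriction of $\beta_{\mathcal K}$ to that interval. Moments: $N_f(x)=\int_{\mathbb{R}^3}f(x,p)dp$, $P_f(x)=\int_{\mathbb{R}^3}f(x,p)p\,dp\in\mathbb{R}^3$, $E_f(x)=\int_{\mathbb{R}^3}f(x,p)|p|^2dp$.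 Local equilibrium: $\mathcal K(f)(x,p)=\Big(e^{a(x)|p-P_f(x)/N_f(x)|^2+c(x)}\pm1\Big)^{-1}$ where $c(x)=\beta_{\mathcal K}^{-1}\Big(N_f(x)\big(E_f(x)-|P_f(x)|^2/N_f(x)\big)^{-3/5}\Big)$ and $a(x)=\Big(\int_{\mathbb{R}^3}\frac{1}{e^{|p|^2+c(x)}\pm1}dp\Big)^{2/3}N_f(x)^{-2/3}$ (defined when the argument of $\beta_{\mathcal K}^{-1}$ makes sense and lies in its domain). $L^1_2([0,1]\times\mathbb{R}^3)$ is the space of measurable $f$ on $[0,1]\times\mathbb{R}^3$ with $\sup_{x}\int_{\mathbb{R}^3}|f(x,p)|(1+|p|^2)dp<\infty$, with distance $\sup_{x}\int|f-g|(1+|p|^2)dp$. Mild solution: $f\in L^1_2([0,1]\times\mathbb{R}^3)$ is a mild solution if, for all $x\in[0,1]$ and (a.e.) $p$, $$f(x,p)=e^{-\frac{1}{\tau|p_1|}\int_0^xN_f(y)dy}f_L(p)+\frac{1}{\tau|p_1|}\int_0^xe^{-\frac{1}{\tau|p_1|}\int_y^xN_f(z)dz}N_f(y)\mathcal K(f)(y,p)\,dy\quad\text{if }p_1>0,$$ $$f(x,p)=e^{-\frac{1}{\tau|p_1|}\int_x^1N_f(y)dy}f_R(p)+\frac{1}{\tau|p_1|}\int_x^1e^{-\frac{1}{\tau|p_1|}\int_x^yN_f(z)dz}N_f(y)\mathcal K(f)(y,p)\,dy\quad\text{if }p_1<0.$$ *)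

(* Defs.v *)
From HB Require Import structures.
From mathcomp Require Import all_boot all_order all_algebra.
From mathcomp Require Import all_classical all_reals all_analysis.

Set Implicit Arguments.
Unset Strict Implicit.
Unset Printing Implicit Defensive.
Import Order.TTheory GRing.Theory Num.Theory.
Import numFieldNormedType.Exports.

Local Open Scope classical_set_scope.
Local Open Scope ring_scope.

(* A momentum is p = (p_1, (p_2, p_3)), so that the integral over (p_2, p_3)
   for fixed p_1 is an integral over the second factor. *)
Notation R2 R := (measurableTypeR R * measurableTypeR R)%type.
Notation R3 R := (measurableTypeR R * R2 R)%type.

(* The library's sigma-finiteness instance on products of two sigma-finite
   measures is not found by unification, hence this direct proof. *)
Fact product_sigma_finite d1 d2 (T1 : measurableType d1)
    (T2 : measurableType d2) (R : realType)
    (m1 : {sigma_finite_measure set T1 -> \bar R})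
    (m2 : {sigma_finite_measure set T2 -> \bar R}) :
  sigma_finite setT (m1 \x m2)%E.
Proof.
have /sigma_finiteP[F [TF ndF Foo]] := sigma_finiteT m1.
have /sigma_finiteP[G [TG ndG Goo]] := sigma_finiteT m2.
exists (fun n => F n `*` G n).
  rewrite -setXTT TF TG predeqE => -[x y]; split.
    move=> [/= [n _ Fnx] [k _ Gky]]; exists (maxn n k) => //; split.
    - by move: x Fnx; exact/subsetPset/ndF/leq_maxl.
    - by move: y Gky; exact/subsetPset/ndG/leq_maxr.
  by move=> [n _ []/= ? ?]; split; exists n.
move=> k; have [? ?] := Foo k; have [? ?] := Goo k.
split; first exact: measurableX.
by rewrite product_measure1E// lte_mul_pinfty// ge0_fin_numE.
Qed.

Section Lebesgue.
Context {R : realType}.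
Local Notation mu := (@lebesgue_measure R).

Definition lebesgue2 : set (R2 R) -> \bar R := (mu \x mu)%E.

HB.instance Definition _ := Measure.on lebesgue2.
HB.instance Definition _ := Measure_isSigmaFinite.Build _ _ _ lebesgue2
  (product_sigma_finite mu mu).

Definition lebesgue3 : set (R3 R) -> \bar R := (mu \x lebesgue2)%E.

HB.instance Definition _ := Measure.on lebesgue3.
HB.instance Definition _ := Measure_isSigmaFinite.Build _ _ _ lebesgue3
  (product_sigma_finite mu lebesgue2).

(* Euclidean; the library's norm on a product is the maximum norm. *)
Definition sqnorm (p : R3 R) : R := p.1 ^+ 2 + p.2.1 ^+ 2 + p.2.2 ^+ 2.

End Lebesgue.
Arguments lebesgue2 : clear implicits.
Arguments lebesgue3 : clear implicits.

Inductive statistics := Boson | Fermion.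

Section LocalEquilibrium.
Context {R : realType} (K : statistics).
Local Notation mu3 := (lebesgue3 R).

Definition pm1 : R := if K is Fermion then 1 else -1.

Definition qdist (t : R) : R := (expR t + pm1)^-1.

Definition beta (c : R) : R :=
  (\int[mu3]_p qdist (sqnorm p + c)) /
  (\int[mu3]_p (sqnorm p * qdist (sqnorm p + c))) `^ (3 / 5).

Definition beta_min : R := if K is Fermion then - ln 3 else 0.

Definition beta_dom : set R :=
  if K is Fermion then `]- ln 3, +oo[ else `[0, +oo[.

Definition beta_inv : R -> R := 'pinv_(fun=> 0) beta_dom beta.

Implicit Type f : R -> R3 R -> R.

Definition density f (x : R) : R := \int[mu3]_p f x p.

Definition momentum f (x : R) : R3 R :=
  (\int[mu3]_p (f x p * p.1),
   (\int[mu3]_p (f x p * p.2.1), \int[mu3]_p (f x p * p.2.2))).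

Definition energy f (x : R) : R := \int[mu3]_p (f x p * sqnorm p).

Definition bulk_velocity f (x : R) : R3 R :=
  ((momentum f x).1 / density f x,
   ((momentum f x).2.1 / density f x, (momentum f x).2.2 / density f x)).

Definition internal_energy f (x : R) : R :=
  energy f x - sqnorm (momentum f x) / density f x.

Definition beta_arg f (x : R) : R :=
  density f x * internal_energy f x `^ (- (3 / 5)).

(* The value [local_eq f x] below is meaningful only under this condition. *)
Definition local_eq_defined f (x : R) : Prop :=
  [/\ 0 < density f x, 0 < internal_energy f x &
      (beta @` beta_dom) (beta_arg f x)].

Definition eq_c f (x : R) : R := beta_inv (beta_arg f x).

Definition eq_a f (x : R) : R :=
  (\int[mu3]_p qdist (sqnorm p + eq_c f x)) `^ (2 / 3) *
  density f x `^ (- (2 / 3)).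

Definition local_eq f (x : R) (p : R3 R) : R :=
  qdist (eq_a f x * sqnorm (p - bulk_velocity f x) + eq_c f x).

End LocalEquilibrium.

Section BoundaryValueProblem.
Context {R : realType}.
Local Notation mu := (@lebesgue_measure R).
Local Notation mu2 := (lebesgue2 R).
Local Notation mu3 := (lebesgue3 R).
Implicit Types (f g : R -> R3 R -> R) (fL fR : R3 R -> R) (tau : R).

(* Functions are total; only the values for x in [0, 1] matter. *)
Definition in_L12 f : Prop :=
  measurable_fun ((`[0, 1] : set (measurableTypeR R)) `*` [set: R3 R])
    (fun z : measurableTypeR R * R3 R => f z.1 z.2) /\
  (ereal_sup [set \int[mu3]_p (`|f x p| * (1 + sqnorm p))%:E | x in `[0%R, 1%R]]
    < +oo)%E.

(* [in_L12] functions at distance 0, i.e., equal as elements of L^1_2. *)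
Definition eq_L12 f g : Prop :=
  forall x, 0 <= x <= 1 -> \forall p \ae mu3, f x p = g x p.

(* Only the values of fL on p_1 > 0 and of fR on p_1 < 0 are ever used. *)
Definition fLR fL fR (p : R3 R) : R :=
  fL p * \1_[set q : R3 R | 0 < q.1] p + fR p * \1_[set q : R3 R | q.1 < 0] p.

Definition attenuation tau f (p : R3 R) (x y : R) : R :=
  expR (- (tau * `|p.1|)^-1 * \int[mu]_(z in `[x, y]) density f z).

(* The integrands of the y-integrals are nonnegative, and these integrals are
   finite for a.e. p, because the integral of [local_eq K f y] over p is
   [density f y]. *)
Definition mild_solution (K : statistics) tau fL fR f : Prop :=
  [/\ in_L12 f,
      forall x, 0 <= x <= 1 -> local_eq_defined K f x &
      forall x, 0 <= x <= 1 -> \forall p \ae mu3,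
        (0 < p.1 ->
          f x p = attenuation tau f p 0 x * fL p
            + (tau * `|p.1|)^-1 * \int[mu]_(y in `[0, x])
                (attenuation tau f p y x * density f y * local_eq K f y p)) /\
        (p.1 < 0 ->
          f x p = attenuation tau f p x 1 * fR p
            + (tau * `|p.1|)^-1 * \int[mu]_(y in `[x, 1])
                (attenuation tau f p x y * density f y * local_eq K f y p))].

Definition const_au fL fR : R := 2 * \int[mu3]_p fLR fL fR p.

Definition const_cu fL fR : R := 2 * \int[mu3]_p (fLR fL fR p * sqnorm p).

Definition damping fL fR tau (p : R3 R) : R :=
  expR (- (const_au fL fR / (tau * `|p.1|))).

Definition const_al fL fR tau : R :=
  \int[mu3]_p (damping fL fR tau p * fLR fL fR p).

Definition const_cl fL fR tau : R :=
  \int[mu3]_p (damping fL fR tau p * fLR fL fR p * sqnorm p).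

Definition const_k fL fR tau : R :=
  (\int[mu3]_(p in [set p : R3 R | (0 < p.1)%R])
     (damping fL fR tau p * fL p * `|p.1|)) *
  (\int[mu3]_(p in [set p : R3 R | (p.1 < 0)%R])
     (damping fL fR tau p * fR p * `|p.1|)).

Definition nonneg_mild_solution_with_bounds (K : statistics) tau fL fR f :
    Prop :=
  [/\ mild_solution K tau fL fR f,
      forall x, 0 <= x <= 1 -> \forall p \ae mu3, 0 <= f x p &
      forall x, 0 <= x <= 1 ->
        [/\ const_al fL fR tau <= density f x <= const_au fL fR,
            const_cl fL fR tau <= energy f x <= const_cu fL fR &
            const_k fL fR tau <=
              energy f x * density f x - sqnorm (momentum f x)]].

End BoundaryValueProblem.

(* Main.v *)
(* The right-hand side of the mild formula depends on f only through its five
   moment functions of x (mass, momentum, energy).  Hence mild solutions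
   correspond to fixed points of the operator T that inserts moment functions m
   into the mild formula and takes the moments of the result.  For large tau,
   T maps the set of moments obeying the required bounds to itself and contracts
   the sup norm by 1/2:
   - the local equilibrium is Gaussian-bounded and Lipschitz in the moments,
     because (mass, energy) is minus the gradient of a strictly convex function
     of the equilibrium parameters;
   - since N >= n0, integrating the exponential kernel over y bounds the gain
     term by a Gaussian in p times min (1/(tau |p_1|), 4/n0), whose integral
     tends to 0 as tau grows; the loss term varies by at most
     tau^-1 times the integral of f_LR (1 + |p|^2) / |p_1|;
   - E N - |P|^2 >= k by Cauchy-Schwarz, after splitting the flow into its
     right-moving and left-moving parts.
   As a_l and k increase with tau, all bounds may be taken at a single value
   tau1 satisfying the ratio condition; if there is none, there is nothing to
   prove. *)
Require Import Defs.
From HB Require Import structures.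
From mathcomp Require Import all_boot all_order all_algebra.
From mathcomp Require Import all_classical all_reals all_analysis.
From mathcomp Require Import measurable_realfun.
From mathcomp Require Import ring lra.

Set Implicit Arguments.
Unset Strict Implicit.
Unset Printing Implicit Defensive.
Import Order.TTheory GRing.Theory Num.Theory.
Import numFieldNormedType.Exports.

Local Open Scope classical_set_scope.
Local Open Scope ring_scope.

(** The obstacle is the plane p_1 = 0. A Gaussian divided by |p_1| is not integrable over momentum
    space, so the prefactor 1/(tau |p_1|) alone does not make the moments of the gain term small.
    Integration of the exponential kernel in y cancels this prefactor and leaves the bound 4/n0 near
    the plane; smallness then comes from dominated convergence, without a rate in tau. The loss term
    keeps its factor 1/|p_1|, which is integrable against f_LR by assumption. Freezing the bounds at
    tau1 avoids a circular choice: the Gaussian constants of the local equilibrium depend on the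
    lower bounds for mass and gap, and how large tau must be depends on these constants. The
    invariant set so obtained contains all moments that meet the bounds required at tau, so
    uniqueness in it is enough; the sharper bounds at tau hold for every image under T. Preimages
    under beta are located by the monotonicity of mass and of energy taken separately, and the
    continuity of the inverse comes from the convexity argument. *)

Lemma pinv_mem (T U : Type) (dflt : U -> T) (A : set T) (f : T -> U) y :
  (f @` A) y -> A ('pinv_dflt A f y) /\ f ('pinv_dflt A f y) = y.
Proof.
move=> fAy; split; last by apply: pinvK; rewrite inE.
by rewrite /pinv_ splitV; case: oinvP.
Qed.

Lemma geometric_le0 {R : realType} (B d : R) :
  (forall n, d <= B / 2 ^+ n) -> d <= 0.
Proof.
move=> h; have half1 : `|2^-1 : R| < 1.
  by rewrite gtr0_norm ?invr_gt0// invf_lt1// ltr1n.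
apply: cvgr_to_ge (cvg_geometric B half1) _.
by apply: nearW => n /=; rewrite exprVn.
Qed.

(** * Contraction principle in the sup distance *)

Section fixed_point.
Context {R : realType} {J : Type}.
Variables (T : (J -> R) -> J -> R) (adm : (J -> R) -> Prop) (B : R).
Hypothesis admT : forall m, adm m -> adm (T m).
Hypothesis adm_bounded : forall m m', adm m -> adm m' ->
  forall j, `|m j - m' j| <= B.
Hypothesis adm_closed : forall (u : nat -> J -> R) m, (forall n, adm (u n)) ->
  (forall j, u n j @[n --> \oo] --> m j) -> adm m.
Hypothesis contr : forall m m' D, adm m -> adm m' ->
  (forall j, `|m j - m' j| <= D) -> forall j, `|T m j - T m' j| <= D / 2.

Lemma adm_iter n m : adm m -> adm (iter n T m).
Proof. by move=> am; elim: n => //= n; exact: admT. Qed.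

(** Two arbitrary starting points serve twice: two fixed points give uniqueness, and a point
    together with one of its iterates gives the Cauchy estimate. *)
Lemma contraction_dist n m m' : adm m -> adm m' ->
  forall j, `|iter n T m j - iter n T m' j| <= B / 2 ^+ n.
Proof.
move=> am am'; elim: n => [|n ih] j.
  by rewrite expr0 divr1; exact: adm_bounded.
by rewrite !iterS exprSr invfM mulrA; apply: contr => //; exact: adm_iter.
Qed.

Lemma contraction_unique m m' : adm m -> adm m' -> T m = m -> T m' = m' ->
  m = m'.
Proof.
move=> am am' Tm Tm'; apply/funext => j.
have fixE x n : T x = x -> iter n T x = x by move=> Tx; elim: n => //= n ->.
apply/eqP; rewrite -subr_eq0 -normr_le0; apply: (@geometric_le0 _ B) => n.
by have := contraction_dist n am am' j; rewrite !fixE.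
Qed.

(** Convergence is pointwise in j, along a telescoping series dominated by a geometric one, and
    [adm_closed] keeps the limit admissible. The bound on the distance from the limit to the
    iterates is nevertheless uniform in j, as [contr] demands. *)
Lemma contraction_fixed_point m0 : adm m0 -> exists2 m, adm m & T m = m.
Proof.
move=> am0; pose u n := iter n T m0.
have au n : adm (u n) by exact: adm_iter.
have udist n k j : `|u (n + k)%N j - u n j| <= B / 2 ^+ n.
  by rewrite /u iterD; apply: contraction_dist => //; exact: adm_iter.
have ucvg j : cvgn (u ^~ j).
  suff : cvgn (series (telescope (u ^~ j))).
    move=> cs; have -> : u ^~ j = (fun n => u 0%N j + series (telescope (u ^~ j)) n).
      by apply/funext => n; rewrite [LHS](eq_sum_telescope (u ^~ j)).
    by apply: is_cvgD => //; exact: is_cvg_cst.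
  apply: normed_cvg; apply: (@series_le_cvg _ _ (geometric B 2^-1)) => [n|n|n|].
  - exact: normr_ge0.
  - rewrite /geometric/= exprVn; apply: le_trans (udist n 1%N j).
    exact: normr_ge0.
  - rewrite /geometric/= exprVn; apply: le_trans (udist n 1%N j).
    by rewrite /telescope addn1.
  - apply: is_cvg_geometric_series.
    by rewrite gtr0_norm ?invr_gt0// invf_lt1// ltr1n.
pose m j := limn (u ^~ j).
have um j : u n j @[n --> \oo] --> m j by exact: ucvg.
have am : adm m by exact: adm_closed um.
have mdist n j : `|m j - u n j| <= B / 2 ^+ n.
  have h : `|u k j - u n j| @[k --> \oo] --> `|m j - u n j|.
    by apply: cvg_norm; apply: cvgB => //; exact: cvg_cst.
  apply: cvgr_to_le h _; exists n => // k /= nk.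
  by rewrite -(subnKC nk).
exists m => //; apply/funext => j.
apply/eqP; rewrite -subr_eq0 -normr_le0.
apply: (@geometric_le0 _ B) => n.
rewrite (_ : T m j - m j = (T m j - T (u n) j) - (m j - u n.+1 j)); last first.
  by rewrite /u iterS; ring.
apply: le_trans (ler_normB _ _) _.
rewrite (_ : B / 2 ^+ n = B / 2 ^+ n / 2 + B / 2 ^+ n.+1).
  by rewrite lerD//; apply: contr => // i; exact: mdist.
by rewrite exprSr invfM mulrA -splitr.
Qed.

End fixed_point.

(** * Integration *)

Section integration.
Context d (T : measurableType d) (R : realType).
Variable mu : {measure set T -> \bar R}.

Lemma integrable_dominated (f g : T -> R) : measurable_fun setT f ->
  mu.-integrable setT (EFin \o g) -> (forall x, `|f x| <= g x) ->
  mu.-integrable setT (EFin \o f).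
Proof.
move=> mf ig fg; apply: le_integrable ig => //; first exact/measurable_EFinP.
by move=> x _ /=; rewrite lee_fin (le_trans (fg x))// ler_norm.
Qed.

Lemma ae_eq_Rintegral (f g : T -> R) :
  measurable_fun setT f -> measurable_fun setT g ->
  {ae mu, forall x, f x = g x} -> \int[mu]_x f x = \int[mu]_x g x.
Proof.
move=> mf mg fg; congr fine; apply: ae_eq_integral => //;
  [exact/measurable_EFinP|exact/measurable_EFinP|].
by apply: filterS fg => x /= ->.
Qed.

Lemma ae_eq_integrable (f g : T -> R) :
  measurable_fun setT f -> measurable_fun setT g ->
  {ae mu, forall x, f x = g x} -> mu.-integrable setT (EFin \o f) ->
  mu.-integrable setT (EFin \o g).
Proof.
move=> mf mg fg /integrableP[_ fi]; apply/integrableP; split.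
  exact/measurable_EFinP.
apply: le_lt_trans fi; rewrite le_eqVlt; apply/orP; left; apply/eqP.
apply: ae_eq_integral => //.
- by apply: measurableT_comp => //; exact/measurable_EFinP.
- by apply: measurableT_comp => //; exact/measurable_EFinP.
by apply: filterS fg => x /= ->.
Qed.

(** The maximum of f and g agrees with g almost everywhere, which turns the hypothesis into an
    inequality at every point. It serves for integrands with a wrong value at one momentum, such as
    the boson distribution at its singularity. *)
Lemma ae_ge0_le_Rintegral (f g : T -> R) :
  mu.-integrable setT (EFin \o f) -> mu.-integrable setT (EFin \o g) ->
  {ae mu, forall x, f x <= g x} -> \int[mu]_x f x <= \int[mu]_x g x.
Proof.
move=> fi gi fg.
have mf : measurable_fun setT f by exact/measurable_EFinP/(measurable_int mu).
have mg : measurable_fun setT g by exact/measurable_EFinP/(measurable_int mu).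
have mM : measurable_fun setT (fun x => Num.max (f x) (g x)).
  exact: measurable_maxr.
have Mg : {ae mu, forall x, g x = Num.max (f x) (g x)}.
  by apply: filterS fg => x fg; rewrite max_r.
rewrite (ae_eq_Rintegral mg mM Mg); apply: le_Rintegral => //.
  exact: ae_eq_integrable gi.
by move=> x _; rewrite le_max lexx.
Qed.

Lemma integrable_ge0 (f : T -> R) : measurable_fun setT f ->
  (forall x, 0 <= f x) -> (\int[mu]_x (f x)%:E < +oo)%E ->
  mu.-integrable setT (EFin \o f).
Proof.
move=> mf f0 fi; apply/integrableP; split; first exact/measurable_EFinP.
by under eq_integral do rewrite /= ger0_norm//.
Qed.

Lemma EFin_Rintegral (f : T -> R) : mu.-integrable setT (EFin \o f) ->
  (\int[mu]_x f x)%:E = (\int[mu]_x (f x)%:E)%E.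
Proof. by move=> fi; rewrite fineK//; exact: integrable_fin_num. Qed.

(** Were the integral 0, f would vanish off a null set, and this null set would contain A. *)
Lemma Rintegral_gt0 (A : set T) (f : T -> R) : mu.-integrable setT (EFin \o f) ->
  (forall x, 0 <= f x) -> measurable A -> (0 < mu A)%E ->
  (forall x, A x -> 0 < f x) -> 0 < \int[mu]_x f x.
Proof.
move=> fi f0 mA A0 fA; rewrite lt_neqAle Rintegral_ge0// andbT.
apply/negP => /eqP i0.
have mf : measurable_fun setT (EFin \o f) by exact: (measurable_int mu).
have := EFin_Rintegral fi; rewrite -i0 => /esym e0.
have /(ae_eq_integral_abs mu measurableT mf) [N [mN N0 sN]] :
    (\int[mu]_x `|(EFin \o f) x|)%E = 0%E.
  by rewrite -[RHS]e0; apply: eq_integral => x _ /=; rewrite ger0_norm.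
suff : (mu A <= mu N)%E by rewrite N0 leNgt A0.
apply: le_measure; rewrite ?inE// => x /fA fx; apply: sN => /= /(_ I) [].
by move/eqP; rewrite gt_eqF.
Qed.

End integration.

(** Positive and negative parts reduce the claim to Tonelli's theorem. Sections that are not
    integrable do no harm, because [fine] is measurable on all extended reals. *)
Lemma measurable_fun_Rintegral d1 d2 (T1 : measurableType d1)
    (T2 : measurableType d2) (R : realType)
    (m2 : {sigma_finite_measure set T2 -> \bar R}) (f : T1 * T2 -> R) :
  measurable_fun setT f ->
  measurable_fun setT (fun x => \int[m2]_y f (x, y)).
Proof.
move=> mf; have mEf : measurable_fun setT (EFin \o f) by exact/measurable_EFinP.
rewrite /Rintegral.
rewrite (_ : (fun x => _) = fine \o
  (fubini_F m2 (EFin \o f)^\+%E \- fubini_F m2 (EFin \o f)^\-%E)%E); last first.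
  apply/funext => x /=; rewrite integralE /fubini_F; congr (fine (_ - _)%E).
    by apply: eq_integral => y _; rewrite !funeposE.
  by apply: eq_integral => y _; rewrite !funenegE.
apply: measurableT_comp => //; apply: emeasurable_funB.
- apply: measurable_fun_fubini_tonelli_F => [|x]; last exact: funepos_ge0.
  exact: measurable_funepos.
- apply: measurable_fun_fubini_tonelli_F => [|x]; last exact: funeneg_ge0.
  exact: measurable_funeneg.
Qed.

(** * Dilations and Gaussians on momentum space *)

Section scaling.
Context {R : realType}.
Local Notation mu := (@lebesgue_measure R).

(** Lebesgue measure is r times its pushforward under x -> r x, because the two agree on half-open
    intervals. *)
Lemma lebesgue_integral_scale (r : R) (f : measurableTypeR R -> \bar R) : 0 < r ->
  measurable_fun setT f -> (forall x, 0 <= f x)%E ->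
  (\int[mu]_x f x = r%:E * \int[mu]_x f (r * x)%R)%E.
Proof.
move=> r0 mf f0.
pose phi (x : measurableTypeR R) : measurableTypeR R := r * x.
have mphi : measurable_fun setT phi by exact: measurable_funM.
pose nu0 := [the measure _ _ of pushforward mu phi].
pose nu := [the measure _ _ of mscale (NngNum (ltW r0)) (nu0 mphi)].
rewrite (@eq_measure_integral _ _ _ _ nu).
  rewrite ge0_integral_mscale//=; congr (_ * _)%E.
  by rewrite ge0_integral_pushforward.
move=> A mA _; apply: lebesgue_measure_unique => //.
move=> _ [[a b] _ <-] /=.
rewrite /nu /nu0 /= /mscale/= /pushforward/=.
rewrite (_ : phi @^-1` _ = `](r^-1 * a), (r^-1 * b)]%classic).
  rewrite !lebesgue_measure_itv/= !lte_fin ltr_pM2l ?invr_gt0//.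
  case: ifPn => ab; last by rewrite mule0.
  rewrite -!EFinD -EFinM; congr EFin; field; lra.
apply/seteqP; split => x /=; rewrite !in_itv/=.
  by rewrite ltr_pdivrMl// ler_pdivlMl.
by rewrite ltr_pdivrMl// ler_pdivlMl.
Qed.

End scaling.

Section momentum_space.
Context {R : realType}.
Local Notation mu := (@lebesgue_measure R).
Local Notation mu3 := (lebesgue3 R).
Implicit Types (p : R3 R).

Lemma lebesgue3_tonelli (f : R3 R -> \bar R) : measurable_fun setT f ->
  (forall p, 0 <= f p)%E ->
  (\int[mu3]_p f p = \int[mu]_x \int[mu]_y \int[mu]_z f (x, (y, z)))%E.
Proof.
move=> mf f0.
rewrite (@fubini_tonelli1 _ _ _ _ R mu (lebesgue2 R) f)//.
apply: eq_integral => x _; rewrite /fubini_F.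
rewrite (@fubini_tonelli1 _ _ _ _ R mu mu (fun q => f (x, q)))//.
exact: measurableT_comp.
Qed.

Lemma measurable_sqnorm : measurable_fun setT (@sqnorm R).
Proof.
apply: measurable_funD; first apply: measurable_funD.
- by apply: measurable_funX; exact: measurable_fst.
- by apply: measurable_funX; apply: measurableT_comp => //; exact: measurable_snd.
- by apply: measurable_funX; apply: measurableT_comp => //; exact: measurable_snd.
Qed.

Lemma sqnorm_ge0 p : 0 <= sqnorm p.
Proof. by rewrite /sqnorm !addr_ge0// sqr_ge0. Qed.

(** On this null plane the mild formula says nothing and 1/|p_1| takes the default value 0. *)
Lemma ae_p1_neq0 : {ae mu3, forall p, p.1 != 0}.
Proof.
exists ([set 0] `*` setT); split.
- exact: measurableX.
- apply: etrans; first exact: product_measure1E.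
  by rewrite [X in (X * _)%E](lebesgue_measure_set1 0) mul0e.
- by move=> [x q] /= /negP; rewrite negbK => /eqP ->.
Qed.

(** A unit cube whose points have first coordinate above |r| + 1 fits in, as (|r| + 1)^2 > r. These
    sets carry the strict positivity of the integrals below. *)
Lemma lebesgue3_sqnorm_gt (r : R) : (0 < mu3 [set p | (r < sqnorm p)%R])%E.
Proof.
pose I : set (measurableTypeR R) := `]`|r| + 1, `|r| + 2]%classic.
have mI : mu I = 1%E.
  rewrite /I lebesgue_measure_itv/= lte_fin ifT; first by rewrite -EFinD; congr EFin; ring.
  by rewrite ltrD2l ltr1n.
have mmI : measurable I by exact: measurable_itv.
have e2 : lebesgue2 R (I `*` I) = 1%E.
  by apply: etrans; [exact: product_measure1E|rewrite [X in (X * _)%E]mI mul1e; exact: mI].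
have e3 : mu3 (I `*` (I `*` I)) = 1%E.
  apply: etrans; first by apply: product_measure1E => //; exact: measurableX.
  by rewrite [X in (_ * X)%E]e2 mule1; exact: mI.
suff : (mu3 (I `*` (I `*` I)) <= mu3 [set p | (r < sqnorm p)%R])%E.
  by apply: lt_le_trans; rewrite e3.
apply: le_measure; rewrite ?inE.
- by apply: measurableX => //; exact: measurableX.
- rewrite (_ : mkset _ = setT `&` (@sqnorm R) @^-1` `]r, +oo[); last first.
    by apply/seteqP; split => p /=; rewrite in_itv/= andbT // => -[].
  exact: measurable_sqnorm.
move=> p [+ _] /=; rewrite /I/= in_itv/= => /andP[h _].
rewrite /sqnorm -addrA; apply: ltr_wpDr; first by rewrite addr_ge0// sqr_ge0.
have := ler_norm r; have := normr_ge0 r; nra.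
Qed.

Definition dilate (r : R) p : R3 R := (r * p.1, (r * p.2.1, r * p.2.2)).

Lemma sqnorm_dilate r p : sqnorm (dilate r p) = r ^+ 2 * sqnorm p.
Proof. by rewrite /sqnorm/=; ring. Qed.

Lemma measurable_R3 d (T : measurableType d) (f g h : T -> R) :
  measurable_fun setT f -> measurable_fun setT g -> measurable_fun setT h ->
  measurable_fun setT (fun x => (f x, (g x, h x)) : R3 R).
Proof.
move=> mf mg mh; apply/measurable_fun_prod => //.
by apply/measurable_fun_prod.
Qed.

Lemma measurable_integral_z (f : R3 R -> \bar R) x : measurable_fun setT f ->
  (forall p, 0 <= f p)%E ->
  measurable_fun setT (fun y : measurableTypeR R => (\int[mu]_z f (x, (y, z)))%E).
Proof.
move=> mf f0.
apply: (@measurable_fun_fubini_tonelli_F _ _ _ _ R mu (fun q => f (x, q))) => //.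
exact: measurableT_comp.
Qed.

Lemma measurable_integral_yz (f : R3 R -> \bar R) : measurable_fun setT f ->
  (forall p, 0 <= f p)%E ->
  measurable_fun setT
    (fun x : measurableTypeR R => (\int[mu]_y \int[mu]_z f (x, (y, z)))%E).
Proof.
move=> mf f0.
have := @measurable_fun_fubini_tonelli_F _ _ _ _ R (lebesgue2 R) f mf f0.
apply: eq_measurable_fun => x _.
rewrite /fubini_F (@fubini_tonelli1 _ _ _ _ R mu mu (fun q => f (x, q)))//.
exact: measurableT_comp.
Qed.

Lemma measurable_dilate r : measurable_fun setT (dilate r).
Proof.
apply: measurable_R3; apply: measurable_funM => //.
- by apply: measurableT_comp => //; exact: measurable_snd.
- by apply: measurableT_comp => //; exact: measurable_snd.
Qed.

Lemma lebesgue3_dilate (r : R) (f : R3 R -> \bar R) : 0 < r ->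
  measurable_fun setT f -> (forall p, 0 <= f p)%E ->
  (\int[mu3]_p f p = (r ^+ 3)%:E * \int[mu3]_p f (dilate r p))%E.
Proof.
move=> r0 mf f0.
have mfr : measurable_fun setT (f \o dilate r).
  by apply: measurableT_comp => //; exact: measurable_dilate.
have fr0 p : (0 <= (f \o dilate r) p)%E by exact: f0.
rewrite lebesgue3_tonelli// (@lebesgue3_tonelli (f \o dilate r))//.
rewrite (lebesgue_integral_scale r0); last 2 first.
- exact: measurable_integral_yz.
- by move=> x; apply: integral_ge0 => y _; exact: integral_ge0.
rewrite exprS EFinM -muleA; congr (_ * _)%E.
rewrite -ge0_integralZl_EFin//; last 3 first.
- by move=> x _; apply: integral_ge0 => y _; exact: integral_ge0.
- exact: measurable_integral_yz.
- by rewrite exprn_ge0// ltW.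
apply: eq_integral => x _.
rewrite (lebesgue_integral_scale r0); last 2 first.
- exact: measurable_integral_z.
- by move=> y; exact: integral_ge0.
rewrite exprS expr1 EFinM -muleA; congr (_ * _)%E.
rewrite -ge0_integralZl_EFin//; last 3 first.
- by move=> y _; exact: integral_ge0.
- exact: (@measurable_integral_z (f \o dilate r)).
- by rewrite ltW.
apply: eq_integral => y _.
rewrite (lebesgue_integral_scale r0)//.
by apply: measurableT_comp => //; exact: measurableT_comp.
Qed.

(** A dilation by 1/sqrt a reduces to a = 1, where the integrand is a product of three
    one-dimensional Gaussians. *)
Lemma integrable_gauss3 (a : R) : 0 < a ->
  mu3.-integrable setT (EFin \o (fun p => expR (- (a * sqnorm p)))).
Proof.
move=> a0.
have mE (b : R) : measurable_fun setT (fun p : R3 R => expR (- (b * sqnorm p))).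
  apply: measurableT_comp => //; apply: measurableT_comp => //.
  by apply: measurable_funM => //; exact: measurable_sqnorm.
apply: integrable_ge0 => //.
rewrite (@lebesgue3_dilate (Num.sqrt a)^-1)//; last 2 first.
- by rewrite invr_gt0 sqrtr_gt0.
- exact/measurable_EFinP.
have -> : (\int[mu3]_p (expR (- (a * sqnorm (dilate (Num.sqrt a)^-1 p))))%:E =
   \int[mu3]_p (expR (- sqnorm p))%:E)%E.
  apply: eq_integral => p _; rewrite sqnorm_dilate exprVn sqr_sqrtr ?ltW//.
  by rewrite mulVKf// gt_eqF.
rewrite lebesgue3_tonelli; last 2 first.
- apply/measurable_EFinP; have := mE 1; apply: eq_measurable_fun => p _.
  by rewrite mul1r.
- by move=> p; rewrite lee_fin expR_ge0.
have cg (c : R) : 0 <= c ->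
    (\int[mu]_x (c%:E * (gauss_fun x)%:E) = (c * Num.sqrt pi)%:E)%E.
  move=> c0; rewrite ge0_integralZl_EFin//.
  - by rewrite integralT_gauss EFinM.
  - by move=> x _; rewrite lee_fin gauss_fun_ge0.
  - exact: (measurable_int mu integrableT_gauss).
have E x y z : (expR (- sqnorm (x, (y, z))))%:E =
    ((gauss_fun x * gauss_fun y)%:E * (gauss_fun z)%:E)%E.
  by rewrite -EFinM /gauss_fun -!expRD /sqnorm/=; congr (expR _)%:E; ring.
under eq_integral => x _.
  under eq_integral => y _.
    under eq_integral => z _ do rewrite E.
    rewrite cg ?mulr_ge0 ?gauss_fun_ge0//.
    rewrite (_ : _%:E = (gauss_fun x * Num.sqrt pi)%:E * (gauss_fun y)%:E)%E; last first.
      by rewrite -EFinM; congr EFin; ring.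
    over.
  rewrite cg ?mulr_ge0 ?gauss_fun_ge0 ?sqrtr_ge0//.
  rewrite (_ : _%:E = (Num.sqrt pi * Num.sqrt pi)%:E * (gauss_fun x)%:E)%E; last first.
    by rewrite -EFinM; congr EFin; ring.
  over.
rewrite cg ?mulr_ge0 ?gauss_fun_ge0 ?sqrtr_ge0//.
by rewrite -EFinM ltry.
Qed.

End momentum_space.

Section real_integrable.
Context d (T : measurableType d) (R : realType).
Variable mu : {measure set T -> \bar R}.
Implicit Types f g : T -> R.

Lemma integrable_addr f g : mu.-integrable setT (EFin \o f) ->
  mu.-integrable setT (EFin \o g) ->
  mu.-integrable setT (EFin \o (fun x => f x + g x)).
Proof.
move=> fi gi; apply: eq_integrable (integrableD measurableT fi gi) => //.
Qed.

Lemma integrable_subr f g : mu.-integrable setT (EFin \o f) ->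
  mu.-integrable setT (EFin \o g) ->
  mu.-integrable setT (EFin \o (fun x => f x - g x)).
Proof.
move=> fi gi; apply: eq_integrable (integrableB measurableT fi gi) => //.
Qed.

Lemma integrable_scaler f r : mu.-integrable setT (EFin \o f) ->
  mu.-integrable setT (EFin \o (fun x => r * f x)).
Proof.
move=> fi; apply: eq_integrable (integrableZl measurableT r fi) => //.
Qed.

End real_integrable.

(** The real power -1 is applied to f^2, whose values are nonnegative; where f = 0 both sides are 0
    by the convention on inverses. *)
Lemma measurable_invr d (T : measurableType d) (R : realType) (f : T -> R) :
  measurable_fun setT f -> measurable_fun setT (fun x => (f x)^-1).
Proof.
move=> mf; have -> : (fun x => (f x)^-1) = (fun x => f x * (f x ^+ 2) `^ (- 1)).
  apply/funext => x; rewrite powR_inv1 ?sqr_ge0//.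
  have [->|fx] := eqVneq (f x) 0; first by rewrite invr0 mul0r.
  by rewrite expr2 invfM mulVKf.
apply: measurable_funM => //.
apply: (@measurableT_comp _ _ _ _ _ _ (@powR R ^~ (-1))); first exact: measurable_powR.
exact: measurable_funX.
Qed.

(** * Quantum gases at rest *)

Section quantum_distribution.
Context {R : realType} (K : statistics).
Local Notation mu3 := (lebesgue3 R).
Local Notation q := (@qdist R K).
Local Notation bmin := (@beta_min R K).
Local Notation pm := (@pm1 R K).

Lemma expR_pm_gt0 t : bmin < t -> 0 < expR t + pm.
Proof.
rewrite /beta_min /pm1; case: K => t0; last by rewrite addr_gt0// expR_gt0.
by rewrite subr_gt0 -expR0 ltr_expR.
Qed.

Lemma qdist_gt0 t : bmin < t -> 0 < q t.
Proof. by move=> t0; rewrite /qdist invr_gt0 expR_pm_gt0. Qed.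

Lemma qdistB t t' : bmin < t -> bmin < t' ->
  q t - q t' = q t * q t' * (expR t' - expR t).
Proof.
move=> /expR_pm_gt0 h /expR_pm_gt0 h'; rewrite /qdist; field.
by rewrite !gt_eqF.
Qed.

Lemma le_qdist t t' : bmin < t -> t <= t' -> q t' <= q t.
Proof.
move=> h tt'; have h' := lt_le_trans h tt'.
rewrite -subr_ge0 qdistB// mulr_ge0//; last by rewrite subr_ge0 ler_expR.
by rewrite mulr_ge0// ltW// qdist_gt0.
Qed.

Lemma measurable_qdist : measurable_fun setT q.
Proof.
exact/measurable_invr/measurable_funD.
Qed.

Lemma expR_subr_ge (t t' : R) : expR t * (t' - t) <= expR t' - expR t.
Proof.
have := expR_ge1Dx (t' - t); rewrite -(ler_pM2l (expR_gt0 t)) -expRD.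
by rewrite [t + _]addrC subrK mulrDr mulr1 lerBrDl.
Qed.

(** Away from the singularity [qdist] is comparable to e^(-t). The factorization [qdistB] transfers
    this to difference quotients: the product q(t) q(t') has size e^(-t-t'), and the increment
    e^(t') - e^t lies between e^t (t' - t) and e^(t') (t' - t). *)
Lemma qdist_bounds t0 : bmin < t0 -> exists2 C, 0 < C &
  (forall t, t0 <= t -> expR (- t) / C <= q t <= C * expR (- t)) /\
  (forall t t', t0 <= t -> t <= t' ->
    expR (- t') / C * (t' - t) <= q t - q t' <= C * expR (- t) * (t' - t)).
Proof.
move=> t0m.
have [C C1 hC] : exists2 C, 1 <= C &
    forall t, t0 <= t -> expR (- t) / C <= q t <= C * expR (- t).
  (* The summand 1 gives C <= C^2, so that C^2 can serve both estimates; e^(-t0) handles expR t + pm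
     <= C * expR t; q t0 handles q t * expR t = 1 - q t * pm <= C. *)
  exists (1 + expR (- t0) + q t0).
    by rewrite -addrA lerDl addr_ge0 ?expR_ge0// ltW// qdist_gt0.
  move=> t t0t; have qt := le_qdist t0m t0t.
  have tm := lt_le_trans t0m t0t.
  have q0 := qdist_gt0 tm; have e1 := expR_gt0 t; have e0 := expR_gt0 (- t0).
  have d := expR_pm_gt0 tm.
  have te : expR (- t) <= expR (- t0) by rewrite ler_expR lerN2.
  have et : expR (- t) * expR t = 1 by rewrite -expRD addNr expR0.
  have qd : q t * (expR t + pm) = 1 by rewrite /qdist mulVf// gt_eqF.
  have pm1 : -1 <= pm <= 1 by rewrite /pm1; case: (K); lra.
  have eN : expR (- t) = (expR t)^-1 by rewrite expRN.
  set C := _ + _; have C0 : 0 < C by rewrite /C; lra.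
  apply/andP; split.
    rewrite ler_pdivrMr// -(ler_pM2r e1) et -[leLHS]qd -mulrA ler_pM2l//.
    have : 1 <= expR (- t0) * expR t by rewrite -et ler_pM2r.
    rewrite /C; nra.
  rewrite -(ler_pM2r e1) -mulrA et mulr1.
  have -> : q t * expR t = 1 - q t * pm by lra.
  rewrite /C; nra.
have C0 : 0 < C by exact: lt_le_trans C1.
have CC : C <= C ^+ 2 by rewrite expr2 ler_peMl// ltW.
exists (C ^+ 2); first exact: exprn_gt0.
split=> [t /hC /andP[h1 h2]|t t' t0t tt'].
  apply/andP; split.
    apply: le_trans h1; rewrite ler_pM2l ?expR_gt0// lef_pV2 ?posrE//.
    exact: exprn_gt0.
  by apply: le_trans h2 _; rewrite ler_pM2r ?expR_gt0.
have t0t' := le_trans t0t tt'.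
have /andP[h1 h2] := hC _ t0t; have /andP[h1' h2'] := hC _ t0t'.
have b := expR_subr_ge t t'; have b' := expR_subr_ge t' t.
have d0 : 0 <= t' - t by rewrite subr_ge0.
have e (x : R) : expR (- x) * expR x = 1 by rewrite -expRD addNr expR0.
have g (x : R) := expR_gt0 x.
rewrite qdistB ?(lt_le_trans t0m)//; apply/andP; split.
  apply: (@le_trans _ _ ((expR (- t) / C) * (expR (- t') / C) * (expR t * (t' - t)))).
    rewrite (_ : _ * (expR t * _) =
      (expR (- t) * expR t) * (expR (- t') / C ^+ 2 * (t' - t))).
      by rewrite e mul1r.
    by field; rewrite gt_eqF.
  apply: ler_pM => //.
  - by rewrite mulr_ge0// divr_ge0// ?ltW.
  - by rewrite mulr_ge0// ltW.
  - by apply: ler_pM => //; rewrite divr_ge0// ltW.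
apply: (@le_trans _ _ ((C * expR (- t)) * (C * expR (- t')) * (expR t' * (t' - t)))).
  apply: ler_pM => //.
  - by rewrite mulr_ge0// ltW// qdist_gt0 ?(lt_le_trans t0m).
  - by rewrite subr_ge0 ler_expR.
  - by apply: ler_pM => //; rewrite ltW// qdist_gt0 ?(lt_le_trans t0m).
  - lra.
rewrite (_ : _ * (expR t' * _) =
  (expR (- t') * expR t') * (C ^+ 2 * expR (- t) * (t' - t))); last by ring.
by rewrite e mul1r.
Qed.

End quantum_distribution.

Section gaussian_moments.
Context {R : realType}.
Local Notation mu3 := (lebesgue3 R).
Implicit Types p : R3 R.

Lemma le_1D_expR (b s : R) : 0 < b -> 0 <= s ->
  1 + s <= (1 + b^-1) * expR (b * s).
Proof.
move=> b0 s0; apply: (@le_trans _ _ ((1 + b^-1) * (1 + b * s))).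
  have b1 : 0 < b^-1 by rewrite invr_gt0.
  rewrite mulrDr mulr1 [(1 + b^-1) * _]mulrDl mul1r mulKf ?gt_eqF//.
  have := mulr_ge0 (ltW b0) s0; lra.
by rewrite ler_wpM2l ?expR_ge1Dx// addr_ge0// invr_ge0 ltW.
Qed.

Lemma measurable_gauss3 (a : R) :
  measurable_fun setT (fun p : R3 R => expR (- (a * sqnorm p))).
Proof.
apply: measurableT_comp => //; apply: measurableT_comp => //.
by apply: measurable_funM => //; exact: measurable_sqnorm.
Qed.

Lemma measurable_sqnorm_gt (r : R) : measurable [set p : R3 R | r < sqnorm p].
Proof.
rewrite -[X in measurable X]setTI.
rewrite (_ : mkset _ = (@sqnorm R) @^-1` `]r, +oo[%classic); last first.
  by apply/seteqP; split => p /=; rewrite in_itv/= andbT.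
exact: measurable_sqnorm.
Qed.

Lemma integrable_gauss3_poly k (a : R) : 0 < a ->
  mu3.-integrable setT
    (EFin \o (fun p => (1 + sqnorm p) ^+ k * expR (- (a * sqnorm p)))).
Proof.
(* Each of the k factors 1 + |p|^2 costs e^(b |p|^2), which leaves the rate a - k b = b. *)
move=> a0; pose b := a / k.+1%:R.
have b0 : 0 < b by rewrite divr_gt0.
apply: (@integrable_dominated _ _ _ _ _
    (fun p => (1 + b^-1) ^+ k * expR (- (b * sqnorm p)))).
- apply: measurable_funM; last exact: measurable_gauss3.
  by apply: measurable_funX; apply: measurable_funD => //; exact: measurable_sqnorm.
- exact/integrable_scaler/integrable_gauss3.
move=> p; have s0 := sqnorm_ge0 p.
have s1 : 0 <= 1 + sqnorm p by rewrite addr_ge0.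
rewrite ger0_norm ?mulr_ge0 ?exprn_ge0 ?expR_ge0//.
rewrite (_ : - (b * _) = k%:R * (b * sqnorm p) - a * sqnorm p); last first.
  by rewrite /b -natr1; field; rewrite natr1 pnatr_eq0.
rewrite expRD [leRHS]mulrA ler_pM2r ?expR_gt0// expRM_natl -exprMn.
apply: lerXn2r; rewrite ?nnegrE//; last exact: le_1D_expR.
by rewrite mulr_ge0 ?expR_ge0// addr_ge0// invr_ge0 ltW.
Qed.

Lemma integrable_gauss3_powers k (a : R) : 0 < a ->
  mu3.-integrable setT (EFin \o (fun p => sqnorm p ^+ k * expR (- (a * sqnorm p)))).
Proof.
move=> a0; apply: integrable_dominated (integrable_gauss3_poly k a0) _.
  apply: measurable_funM; last exact: measurable_gauss3.
  by apply: measurable_funX; exact: measurable_sqnorm.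
move=> p; have s0 := sqnorm_ge0 p.
rewrite ger0_norm ?mulr_ge0 ?exprn_ge0 ?expR_ge0//.
rewrite ler_wpM2r ?expR_ge0//.
by apply: lerXn2r; [exact: s0|exact: addr_ge0|rewrite lerDr].
Qed.

(** The quadratic form in (x, y) is definite because |p|^2 is not almost everywhere constant: its
    determinant M0 M2 - M1^2, multiplied by M0, is the integral of (M0 |p|^2 - M1)^2 against the
    Gaussian. Completing the square in y gives the bound det / M0 for x, completing it in x gives
    det / M2 for y, and the denominator M0 + M2 serves both. *)
Lemma gauss3_quadratic (a : R) : 0 < a -> exists2 v : R, 0 < v &
  forall x y : R,
    v * x ^+ 2 <= \int[mu3]_p ((x * sqnorm p + y) ^+ 2 * expR (- (a * sqnorm p))) /\
    v * y ^+ 2 <= \int[mu3]_p ((x * sqnorm p + y) ^+ 2 * expR (- (a * sqnorm p))).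
Proof.
move=> a0; pose w p := expR (- (a * sqnorm p)).
have i0 : mu3.-integrable setT (EFin \o w) by exact: integrable_gauss3.
have i1 : mu3.-integrable setT (EFin \o (fun p => sqnorm p * w p)).
  by apply: eq_integrable (integrable_gauss3_powers 1 a0).
have i2 := integrable_gauss3_powers 2 a0.
pose M0 := \int[mu3]_p w p.
pose M1 := \int[mu3]_p (sqnorm p * w p).
pose M2 := \int[mu3]_p (sqnorm p ^+ 2 * w p).
have expand x y p : (x * sqnorm p + y) ^+ 2 * w p =
    x ^+ 2 * (sqnorm p ^+ 2 * w p) + (x * y *+ 2 * (sqnorm p * w p) + y ^+ 2 * w p).
  by ring.
have qi x y : mu3.-integrable setT (EFin \o (fun p => (x * sqnorm p + y) ^+ 2 * w p)).
  apply: (@eq_integrable _ _ _ _ _ measurableT (EFin \o (fun p =>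
    x ^+ 2 * (sqnorm p ^+ 2 * w p) + (x * y *+ 2 * (sqnorm p * w p) + y ^+ 2 * w p)))).
    by move=> p _ /=; rewrite expand.
  by apply: integrable_addr; [|apply: integrable_addr]; exact: integrable_scaler.
have qE x y : \int[mu3]_p ((x * sqnorm p + y) ^+ 2 * w p) =
    x ^+ 2 * M2 + (x * y *+ 2 * M1 + y ^+ 2 * M0).
  under eq_Rintegral do rewrite expand.
  rewrite RintegralD//; [|exact: integrable_scaler|
    by apply: integrable_addr; exact: integrable_scaler].
  rewrite RintegralD//; [|exact: integrable_scaler|exact: integrable_scaler].
  by rewrite !RintegralZl.
have pos f : mu3.-integrable setT (EFin \o f) -> (forall p, 0 <= f p) ->
    forall r, (forall p, r < sqnorm p -> 0 < f p) -> 0 < \int[mu3]_p f p.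
  move=> fi f0 r fr.
  exact: (Rintegral_gt0 fi f0 (measurable_sqnorm_gt r) (lebesgue3_sqnorm_gt r)).
have w0 p : 0 < w p by exact: expR_gt0.
have M00 : 0 < M0 by apply: (pos _ i0 _ 0) => // p; rewrite ltW.
have M20 : 0 < M2.
  apply: (pos _ i2 _ 0) => p; first by rewrite mulr_ge0 ?sqr_ge0// ltW.
  by move=> s0; apply: mulr_gt0; [exact: exprn_gt0|exact: w0].
have disc : 0 < M0 * M2 - M1 ^+ 2.
  rewrite -(pmulr_rgt0 _ M00).
  rewrite (_ : M0 * _ = \int[mu3]_p ((M0 * sqnorm p + (- M1)) ^+ 2 * w p)); last first.
    by rewrite qE; ring.
  apply: (pos _ (qi M0 (- M1)) _ (M1 / M0)) => p.
    by rewrite mulr_ge0 ?sqr_ge0// ltW.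
  rewrite ltr_pdivrMr// mulrC => h.
  by apply: mulr_gt0; [rewrite exprn_gt0// subr_gt0|exact: w0].
exists ((M0 * M2 - M1 ^+ 2) / (M0 + M2)); first by rewrite divr_gt0// addr_gt0.
move=> x y.
have Q0 : 0 <= \int[mu3]_p ((x * sqnorm p + y) ^+ 2 * w p).
  by apply: Rintegral_ge0 => p _; rewrite mulr_ge0 ?sqr_ge0// ltW.
rewrite -[X in _ <= X /\ _ <= X]/(\int[mu3]_p ((x * sqnorm p + y) ^+ 2 * w p)).
move: Q0; rewrite qE; set Q := _ + _ => Q0.
have QM0 : Q * M0 = (M0 * y + M1 * x) ^+ 2 + x ^+ 2 * (M0 * M2 - M1 ^+ 2).
  by rewrite /Q; ring.
have QM2 : Q * M2 = (M2 * x + M1 * y) ^+ 2 + y ^+ 2 * (M0 * M2 - M1 ^+ 2).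
  by rewrite /Q; ring.
have le0 := mulr_ge0 Q0 (ltW M00); have le2 := mulr_ge0 Q0 (ltW M20).
rewrite -!(mulrAC _ _ (_^-1)) !ler_pdivrMr ?addr_gt0// mulrDr; split.
  by have := sqr_ge0 (M0 * y + M1 * x); lra.
by have := sqr_ge0 (M2 * x + M1 * y); lra.
Qed.

End gaussian_moments.

Section quantum_gas.
Context {R : realType} (K : statistics).
Local Notation mu3 := (lebesgue3 R).
Local Notation q := (@qdist R K).
Local Notation bmin := (@beta_min R K).
Implicit Types (p : R3 R) (a c : R).

Definition qmass a c : R := \int[mu3]_p q (a * sqnorm p + c).
Definition qenergy a c : R := \int[mu3]_p (sqnorm p * q (a * sqnorm p + c)).

Lemma measurable_qdist_sqnorm a c :
  measurable_fun setT (fun p : R3 R => q (a * sqnorm p + c)).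
Proof.
apply: (@measurableT_comp _ _ _ _ _ _ q); first exact: measurable_qdist.
by apply: measurable_funD => //; apply: measurable_funM => //; exact: measurable_sqnorm.
Qed.

Lemma integrable_qdist_poly k a c : 0 < a -> bmin < c ->
  mu3.-integrable setT
    (EFin \o (fun p => (1 + sqnorm p) ^+ k * q (a * sqnorm p + c))).
Proof.
move=> a0 c0; have [C C0 [hC _]] := qdist_bounds c0.
apply: (@integrable_dominated _ _ _ _ _
    (fun p => (C * expR (- c)) * ((1 + sqnorm p) ^+ k * expR (- (a * sqnorm p))))).
- apply: measurable_funM; last exact: measurable_qdist_sqnorm.
  by apply: measurable_funX; apply: measurable_funD => //; exact: measurable_sqnorm.
- exact/integrable_scaler/integrable_gauss3_poly.
move=> p; have s0 := sqnorm_ge0 p.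
have s1 : 0 <= 1 + sqnorm p by rewrite addr_ge0.
have tc : c <= a * sqnorm p + c by rewrite lerDr mulr_ge0// ltW.
have /andP[_ h] := hC _ tc.
have qp := qdist_gt0 (lt_le_trans c0 tc).
rewrite ger0_norm; last by rewrite mulr_ge0 ?exprn_ge0// ltW.
rewrite mulrCA ler_wpM2l ?exprn_ge0//; apply: le_trans h _.
by rewrite -mulrA -expRD opprD addrC.
Qed.

Lemma integrable_qmass a c : 0 < a -> bmin < c ->
  mu3.-integrable setT (EFin \o (fun p => q (a * sqnorm p + c))).
Proof.
move=> a0 c0; apply: eq_integrable (integrable_qdist_poly 0 a0 c0) => //.
by move=> p _ /=; rewrite expr0 mul1r.
Qed.

Lemma integrable_qenergy a c : 0 < a -> bmin < c ->
  mu3.-integrable setT (EFin \o (fun p => sqnorm p * q (a * sqnorm p + c))).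
Proof.
move=> a0 c0.
apply: integrable_dominated (integrable_qdist_poly 1 a0 c0) _.
  by apply: measurable_funM; [exact: measurable_sqnorm|exact: measurable_qdist_sqnorm].
move=> p; have s0 := sqnorm_ge0 p.
have tc : c <= a * sqnorm p + c by rewrite lerDr mulr_ge0// ltW.
have qp := qdist_gt0 (lt_le_trans c0 tc).
rewrite expr1 ger0_norm; last by rewrite mulr_ge0// ltW.
by rewrite ler_pM2r// lerDr.
Qed.

Lemma qdist_sqnorm_gt0 a c p : 0 < a -> bmin < c -> 0 < q (a * sqnorm p + c).
Proof.
move=> a0 c0; apply: qdist_gt0; apply: lt_le_trans c0 _.
by rewrite lerDr mulr_ge0 ?sqnorm_ge0// ltW.
Qed.

Lemma qmass_gt0 a c : 0 < a -> bmin < c -> 0 < qmass a c.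
Proof.
move=> a0 c0.
apply: (Rintegral_gt0 _ _ (measurable_sqnorm_gt 0) (lebesgue3_sqnorm_gt 0)).
- exact: integrable_qmass.
- by move=> p; rewrite ltW// qdist_sqnorm_gt0.
- by move=> p _; exact: qdist_sqnorm_gt0.
Qed.

Lemma qenergy_gt0 a c : 0 < a -> bmin < c -> 0 < qenergy a c.
Proof.
move=> a0 c0.
apply: (Rintegral_gt0 _ _ (measurable_sqnorm_gt 0) (lebesgue3_sqnorm_gt 0)).
- exact: integrable_qenergy.
- by move=> p; rewrite mulr_ge0 ?sqnorm_ge0// ltW// qdist_sqnorm_gt0.
- by move=> p p0; rewrite mulr_gt0// qdist_sqnorm_gt0.
Qed.

Lemma qmass_scale a c : 0 < a -> bmin < c ->
  Num.sqrt a ^+ 3 * qmass a c = qmass 1 c.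
Proof.
move=> a0 c0; have ra : 0 < Num.sqrt a by rewrite sqrtr_gt0.
apply: EFin_inj; rewrite EFinM !EFin_Rintegral; [|exact: integrable_qmass..].
rewrite [RHS](lebesgue3_dilate ra); last 2 first.
- by apply/measurable_EFinP; exact: measurable_qdist_sqnorm.
- by move=> p; rewrite lee_fin ltW// qdist_sqnorm_gt0.
congr (_ * _)%E; apply: eq_integral => p _; rewrite sqnorm_dilate sqr_sqrtr ?ltW//.
by rewrite mul1r.
Qed.

Lemma qenergy_scale a c : 0 < a -> bmin < c ->
  Num.sqrt a ^+ 5 * qenergy a c = qenergy 1 c.
Proof.
move=> a0 c0; have ra : 0 < Num.sqrt a by rewrite sqrtr_gt0.
rewrite (exprD _ 3 2) sqr_sqrtr ?ltW// -mulrA -RintegralZl//; last first.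
  exact: integrable_qenergy.
apply: EFin_inj; rewrite EFinM !EFin_Rintegral; last 2 first.
- exact: integrable_qenergy.
- exact/integrable_scaler/integrable_qenergy.
rewrite [RHS](lebesgue3_dilate ra)//.
- congr (_ * _)%E; apply: eq_integral => p _; rewrite sqnorm_dilate sqr_sqrtr ?ltW//.
  by rewrite mul1r mulrA.
- apply/measurable_EFinP.
  by apply: measurable_funM; [exact: measurable_sqnorm|exact: measurable_qdist_sqnorm].
- by move=> p; rewrite lee_fin mulr_ge0 ?sqnorm_ge0// ltW// qdist_sqnorm_gt0.
Qed.

End quantum_gas.

(** * Lipschitz inversion of mass and energy *)

Section inverse_lipschitz.
Context {R : realType} (K : statistics).
Local Notation mu3 := (lebesgue3 R).
Local Notation q := (@qdist R K).
Local Notation bmin := (@beta_min R K).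
Local Notation qmass := (@qmass R K).
Local Notation qenergy := (@qenergy R K).

(** With m the maximum of |x| and |y|, the hypotheses combine to v m^2 <= m (|X| + |Y|), and one
    factor m cancels. *)
Lemma quadratic_le_linear (v x y X Y : R) : 0 < v ->
  v * x ^+ 2 <= x * X + y * Y -> v * y ^+ 2 <= x * X + y * Y ->
  `|x| <= v^-1 * (`|X| + `|Y|) /\ `|y| <= v^-1 * (`|X| + `|Y|).
Proof.
move=> v0 hx hy.
have le : x * X + y * Y <= Num.max `|x| `|y| * (`|X| + `|Y|).
  rewrite mulrDr; apply: lerD; apply: le_trans (ler_norm _) _; rewrite normrM;
    by rewrite ler_wpM2r// le_max lexx ?orbT.
have h : v * Num.max `|x| `|y| ^+ 2 <= Num.max `|x| `|y| * (`|X| + `|Y|).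
  by apply: le_trans le; case: (leP `|x| `|y|) => _; rewrite real_normK ?num_real.
have M : Num.max `|x| `|y| <= v^-1 * (`|X| + `|Y|).
  rewrite mulrC ler_pdivlMr//.
  have := normr_ge0 x; have XY : 0 <= `|X| + `|Y| by rewrite addr_ge0.
  have xm : `|x| <= Num.max `|x| `|y| by rewrite le_max lexx.
  move: h xm; set m := Num.max _ _ => h xm x0.
  have := le_trans x0 xm; rewrite le_eqVlt => /predU1P[<-|m0]; first by rewrite mul0r.
  by move: h; rewrite expr2 mulrCA ler_pM2l// mulrC.
by split; apply: le_trans M; rewrite le_max lexx ?orbT.
Qed.

(* (mass, energy) is minus the gradient of a strictly convex function of
   (c, a), so it is strictly monotone and has a Lipschitz inverse. *)
Lemma qgas_inverse_lipschitz (a0 a1 c0 c1 : R) : 0 < a0 -> bmin < c0 ->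
  exists2 L, 0 < L & forall a a' c c',
    a0 <= a <= a1 -> a0 <= a' <= a1 -> c0 <= c <= c1 -> c0 <= c' <= c1 ->
    `|a - a'| <= L * (`|qenergy a c - qenergy a' c'| + `|qmass a c - qmass a' c'|) /\
    `|c - c'| <= L * (`|qenergy a c - qenergy a' c'| + `|qmass a c - qmass a' c'|).
Proof.
move=> a00 c0m; have [C C0 [_ hC]] := qdist_bounds c0m.
have [a10|a10] := ltP a1 a0.
  exists 1 => // a a' c c' /andP[h1 h2].
  by have := le_lt_trans (le_trans h1 h2) a10; rewrite ltxx.
have [v v0 hv] := gauss3_quadratic (lt_le_trans a00 a10).
pose m := expR (- c1) / C.
have m0 : 0 < m by rewrite divr_gt0// expR_gt0.
exists (v * m)^-1; first by rewrite invr_gt0 mulr_gt0.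
move=> a a' c c' /andP[aa0 aa1] /andP[aa0' aa1'] /andP[cc0 cc1] /andP[cc0' cc1'].
have ap := lt_le_trans a00 aa0; have ap' := lt_le_trans a00 aa0'.
have cp := lt_le_trans c0m cc0; have cp' := lt_le_trans c0m cc0'.
pose x := a - a'; pose y := c - c'.
pose t (p : R3 R) := a * sqnorm p + c; pose t' (p : R3 R) := a' * sqnorm p + c'.
have tt' p : t p - t' p = x * sqnorm p + y by rewrite /t /t' /x /y; ring.
(* The lower slope bound of [qdist], taken at the largest argument a1 |p|^2 + c1 that the parameters
   allow, bounds the monotonicity integrand from below by a Gaussian quadratic form. The integral of
   the right-hand side pairs the increments of (a, c) with those of (energy, mass). *)
have pointwise p : m * ((x * sqnorm p + y) ^+ 2 * expR (- (a1 * sqnorm p))) <=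
    (x * sqnorm p + y) * (q (t' p) - q (t p)).
  have s0 := sqnorm_ge0 p.
  have lt u w : a0 <= u <= a1 -> c0 <= w <= c1 ->
      c0 <= u * sqnorm p + w <= a1 * sqnorm p + c1.
    move=> /andP[u0 u1] /andP[w0 w1]; apply/andP; split.
      by apply: le_trans w0 _; rewrite lerDr mulr_ge0// (le_trans _ u0)// ltW.
    by apply: lerD => //; rewrite ler_wpM2r.
  have /andP[h1 h2] : c0 <= t p <= a1 * sqnorm p + c1.
    by apply: lt; rewrite ?aa0 ?cc0.
  have /andP[h1' h2'] : c0 <= t' p <= a1 * sqnorm p + c1.
    by apply: lt; rewrite ?aa0' ?cc0'.
  have key s : s <= a1 * sqnorm p + c1 ->
      m * expR (- (a1 * sqnorm p)) <= expR (- s) / C.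
    move=> hs; rewrite /m mulrAC ler_pM2r ?invr_gt0// -expRD ler_expR; lra.
  have mono u w E : u <= w -> E * (w - u) <= q u - q w ->
      E * (u - w) ^+ 2 <= (u - w) * (q w - q u).
    move=> uw h; rewrite -subr_ge0.
    rewrite (_ : _ - _ = (w - u) * (q u - q w - E * (w - u))); last by ring.
    by rewrite mulr_ge0// subr_ge0.
  rewrite -tt' mulrCA mulrC.
  have [ltt|/ltW ltt] := leP (t p) (t' p).
    apply: mono => //.
    have /andP[+ _] := hC _ _ h1 ltt; apply: le_trans.
    by apply: ler_wpM2r; [rewrite subr_ge0|exact: key].
  rewrite -sqrrN opprB (_ : (t p - _) * _ = (t' p - t p) * (q (t p) - q (t' p))); last by ring.
  apply: mono => //.
  have /andP[+ _] := hC _ _ h1' ltt; apply: le_trans.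
  by apply: ler_wpM2r; [rewrite subr_ge0|exact: key].
have im := integrable_qmass ap cp; have im' := integrable_qmass ap' cp'.
have ie := integrable_qenergy ap cp; have ie' := integrable_qenergy ap' cp'.
have imB := integrable_subr im' im; have ieB := integrable_subr ie' ie.
have E p : (x * sqnorm p + y) * (q (t' p) - q (t p)) =
    x * (sqnorm p * q (t' p) - sqnorm p * q (t p)) + y * (q (t' p) - q (t p)).
  by ring.
have I : \int[mu3]_p ((x * sqnorm p + y) * (q (t' p) - q (t p))) =
    x * (qenergy a' c' - qenergy a c) + y * (qmass a' c' - qmass a c).
  under eq_Rintegral do rewrite E.
  rewrite RintegralD//; [|exact: integrable_scaler..].
  by rewrite !RintegralZl// !RintegralB.
have il : mu3.-integrable setT
    (EFin \o (fun p => (x * sqnorm p + y) * (q (t' p) - q (t p)))).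
  apply: eq_integrable
    (integrable_addr (integrable_scaler x ieB) (integrable_scaler y imB)) => //.
  by move=> p _ /=; rewrite E.
have ir : mu3.-integrable setT
    (EFin \o (fun p => (x * sqnorm p + y) ^+ 2 * expR (- (a1 * sqnorm p)))).
  apply: (integrable_dominated _ (integrable_scaler m^-1 il)) => [|p].
    apply: measurable_funM; last exact: measurable_gauss3.
    apply: measurable_funX; apply: measurable_funD => //.
    by apply: measurable_funM => //; exact: measurable_sqnorm.
  rewrite ger0_norm; last by rewrite mulr_ge0 ?sqr_ge0 ?expR_ge0.
  by rewrite ler_pdivlMl.
have le : m * \int[mu3]_p ((x * sqnorm p + y) ^+ 2 * expR (- (a1 * sqnorm p))) <=
    x * (qenergy a' c' - qenergy a c) + y * (qmass a' c' - qmass a c).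
  rewrite -I -RintegralZl//; apply: le_Rintegral => //.
  exact: integrable_scaler.
have [h1 h2] := hv x y.
rewrite (distrC (qenergy a c)) (distrC (qmass a c)).
apply: quadratic_le_linear; first exact: mulr_gt0.
- by apply: le_trans le; rewrite [v * m]mulrC -mulrA ler_pM2l.
- by apply: le_trans le; rewrite [v * m]mulrC -mulrA ler_pM2l.
Qed.

End inverse_lipschitz.

Lemma powR_continuous {R : realType} (x r : R) : 0 < x ->
  {for x, continuous (fun a => a `^ r)}.
Proof.
move=> x0; apply/differentiable_continuous/derivable1_diffP.
by apply: derivable_powR; rewrite in_itv/= andbT.
Qed.

Lemma continuous_le_dist {R : realType} (f h : R -> R) (L : R) : continuous h ->
  (forall x y, `|f x - f y| <= L * `|h x - h y|) -> continuous f.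
Proof.
move=> ch fL x; apply/cvgrPdist_le => /= e e0.
have L0 : 0 < `|L| + 1 by rewrite ltr_wpDl.
have e1 : 0 < (`|L| + 1)^-1 * e by rewrite mulr_gt0// invr_gt0.
have /cvgrPdist_le/(_ _ e1) := ch x; apply: filterS => y hy.
apply: le_trans (fL x y) _.
apply: (@le_trans _ _ ((`|L| + 1) * `|h x - h y|)).
  by rewrite ler_wpM2r// (le_trans (ler_norm _))// lerDl.
by rewrite -ler_pdivlMl.
Qed.

Lemma lipschitz_continuous {R : realType} (f : R -> R) (L : R) :
  (forall x y, `|f x - f y| <= L * `|x - y|) -> continuous f.
Proof. by move=> fL; apply: continuous_le_dist fL => x; exact: cvg_id. Qed.

Lemma sqnorm1_ge1 {R : realType} (p : R3 R) : 1 <= 1 + sqnorm p.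
Proof. by rewrite lerDl sqnorm_ge0. Qed.

Lemma sqnorm1_ge0 {R : realType} (p : R3 R) : 0 <= 1 + sqnorm p.
Proof. exact: le_trans ler01 (sqnorm1_ge1 p). Qed.

(** * The function beta and its inverse *)

Section beta.
Context {R : realType} (K : statistics).
Local Notation mu3 := (lebesgue3 R).
Local Notation q := (@qdist R K).
Local Notation bmin := (@beta_min R K).
Local Notation qmass := (@qmass R K).
Local Notation qenergy := (@qenergy R K).
Local Notation beta := (@beta R K).
Local Notation beta_dom := (@beta_dom R K).

Lemma betaE c : beta c = qmass 1 c / qenergy 1 c `^ (3 / 5).
Proof.
have e1 : qmass 1 c = \int[mu3]_p q (sqnorm p + c).
  by apply: eq_Rintegral => p _; rewrite mul1r.
have e2 : qenergy 1 c = \int[mu3]_p (sqnorm p * q (sqnorm p + c)).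
  by apply: eq_Rintegral => p _; rewrite mul1r.
by rewrite e1 e2.
Qed.

(** A common lower bound l of both arguments preserves the exponential decay in the Lipschitz
    constant; with l quadratic in p this becomes a Gaussian. *)
Lemma qdist_lipschitz t0 : bmin < t0 -> exists2 C, 0 < C &
  forall l t t', t0 <= l -> l <= t -> l <= t' ->
    `|q t - q t'| <= C * expR (- l) * `|t - t'|.
Proof.
move=> t0m; have [C C0 [_ hC]] := qdist_bounds t0m; exists C => // l t t' t0l lt lt'.
wlog tt' : t t' lt lt' / t <= t'.
  by move=> h; have [/h|/ltW/h] := leP t t'; [|rewrite distrC [X in _ * X]distrC]; apply.
rewrite ger0_norm; last by rewrite subr_ge0 le_qdist// (lt_le_trans t0m)// (le_trans t0l).
rewrite distrC ger0_norm ?subr_ge0//.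
have /andP[_ h] := hC t t' (le_trans t0l lt) tt'.
apply: le_trans h _; apply: ler_wpM2r; first by rewrite subr_ge0.
by apply: ler_wpM2l; [exact: ltW|rewrite ler_expR lerN2].
Qed.

Lemma qgas_lipschitz c0 : bmin < c0 -> exists L, forall c c', c0 <= c -> c0 <= c' ->
  `|qmass 1 c - qmass 1 c'| <= L * `|c - c'| /\
  `|qenergy 1 c - qenergy 1 c'| <= L * `|c - c'|.
Proof.
move=> c0m; have [C C0 hC] := qdist_lipschitz c0m.
pose g (p : R3 R) := (C * expR (- c0)) * ((1 + sqnorm p) ^+ 1 * expR (- (1 * sqnorm p))).
have ig : mu3.-integrable setT (EFin \o g).
  by apply: integrable_scaler; exact: integrable_gauss3_poly.
have g0 p : 0 <= g p.
  by rewrite /g expr1 !mulr_ge0 ?expR_ge0 ?(ltW C0)// sqnorm1_ge0.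
have pt c c' p : c0 <= c -> c0 <= c' ->
  (1 + sqnorm p) * `|q (1 * sqnorm p + c) - q (1 * sqnorm p + c')| <= `|c - c'| * g p.
  move=> cc cc'; have s0 := sqnorm_ge0 p.
  have h := hC (sqnorm p + c0) (1 * sqnorm p + c) (1 * sqnorm p + c').
  apply: (@le_trans _ _ ((1 + sqnorm p) * (C * expR (- (sqnorm p + c0)) * `|c - c'|))).
    rewrite ler_wpM2l ?sqnorm1_ge0//.
    have <- : 1 * sqnorm p + c - (1 * sqnorm p + c') = c - c' by ring.
    by apply: h; rewrite ?mul1r ?lerD2l// lerDr.
  by rewrite /g expr1 mul1r opprD expRD le_eqVlt; apply/orP; left; apply/eqP; ring.
exists (\int[mu3]_p g p) => c c' cc cc'.
have cm := lt_le_trans c0m cc; have cm' := lt_le_trans c0m cc'.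
have bound (f f' : R3 R -> R) : mu3.-integrable setT (EFin \o f) ->
    mu3.-integrable setT (EFin \o f') ->
    (forall p, `|f p - f' p| <= `|c - c'| * g p) ->
    `|\int[mu3]_p f p - \int[mu3]_p f' p| <= (\int[mu3]_p g p) * `|c - c'|.
  move=> fi fi' ff'; rewrite -RintegralB//.
  have iB := integrable_subr fi fi'.
  apply: le_trans (le_normr_Rintegral measurableT iB) _.
  rewrite mulrC -RintegralZl//; apply: le_Rintegral => //.
    by apply: (integrable_norm iB).
  exact: integrable_scaler.
split; apply: bound.
- exact: integrable_qmass.
- exact: integrable_qmass.
- move=> p; apply: le_trans (pt _ _ _ cc cc'); rewrite ler_peMl// lerDl; exact: sqnorm_ge0.
- exact: integrable_qenergy.
- exact: integrable_qenergy.
- move=> p; rewrite -mulrBr normrM ger0_norm ?sqnorm_ge0//.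
  by apply: le_trans (pt _ _ _ cc cc'); rewrite ler_wpM2r// lerDr.
Qed.

(** The maximum with c0 yields a function that is continuous on the whole line and avoids the
    endpoint, where the integrals may be singular. The intermediate value theorem is applied to this
    function. *)
Lemma beta_continuous c0 : bmin < c0 -> continuous (fun c => beta (Num.max c c0)).
Proof.
move=> c0m; have [L hL] := qgas_lipschitz c0m.
have max_lip (x y : R) : `|Num.max x c0 - Num.max y c0| <= `|x - y|.
  have := ler_norm (x - y); have := ler_norm (- (x - y)); rewrite normrN => h1 h2.
  by rewrite ler_norml; case: (leP x c0); case: (leP y c0) => *; apply/andP; split; lra.
have cont (f : R -> R) : (forall c c', c0 <= c -> c0 <= c' -> `|f c - f c'| <= L * `|c - c'|) ->
    continuous (fun c => f (Num.max c c0)).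
  move=> fL; apply: (@lipschitz_continuous _ _ `|L|) => x y.
  apply: (le_trans (fL _ _ _ _)); rewrite ?le_max ?lexx ?orbT//.
  apply: (@le_trans _ _ (`|L| * `|Num.max x c0 - Num.max y c0|)).
    by rewrite ler_wpM2r// ler_norm.
  by rewrite ler_wpM2l.
have cm := cont _ (fun c c' cc cc' => (hL c c' cc cc').1).
have ce := cont _ (fun c c' cc cc' => (hL c c' cc cc').2).
have mc x : bmin < Num.max x c0 by rewrite lt_max c0m orbT.
rewrite (_ : (fun c => _) = (fun c => qmass 1 (Num.max c c0) *
   (qenergy 1 (Num.max c c0) `^ (3 / 5))^-1)); last by apply/funext => c; rewrite betaE.
move=> x; have e0 : 0 < qenergy 1 (Num.max x c0) by exact: qenergy_gt0.
apply: cvgM; first exact: cm.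
apply: cvgV; first by rewrite gt_eqF// powR_gt0.
apply: (@continuous_comp _ _ _ (fun c => qenergy 1 (Num.max c c0)) (fun a => a `^ (3/5))).
  exact: ce.
exact: powR_continuous.
Qed.

End beta.

Section beta_range.
Context {R : realType} (K : statistics).
Local Notation mu3 := (lebesgue3 R).
Local Notation q := (@qdist R K).
Local Notation bmin := (@beta_min R K).
Local Notation qmass := (@qmass R K).
Local Notation qenergy := (@qenergy R K).
Local Notation beta := (@beta R K).
Local Notation beta_dom := (@beta_dom R K).

Lemma qdist_ge0 t : bmin <= t -> 0 <= q t.
Proof.
rewrite /beta_min /qdist /pm1 invr_ge0; case: K => t0; last by rewrite addr_ge0 ?expR_ge0.
by rewrite subr_ge0 -expR0 ler_expR.
Qed.

(** The mass is at most a constant times e^(-c) and the energy at least a constant times e^(-c), so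
    beta is O(e^(-c + 3c/5)) = O(e^(-2c/5)). *)
Lemma beta_lt_at_infty (y : R) : 0 < y -> exists c1, forall c, c1 < c -> beta c < y.
Proof.
move=> y0.
have bm1 : bmin < bmin + 1 by rewrite ltrDl.
have [C C0 [hC _]] := qdist_bounds bm1.
pose G0 : R := \int[mu3]_p expR (- (1 * sqnorm p)).
pose G1 : R := \int[mu3]_p (sqnorm p ^+ 1 * expR (- (1 * sqnorm p))).
have i0 := @integrable_gauss3 R _ ltr01.
have i1 := @integrable_gauss3_powers R 1 _ ltr01.
have G00 : 0 < G0.
  apply: (Rintegral_gt0 i0 _ (measurable_sqnorm_gt 0) (lebesgue3_sqnorm_gt 0)) => p.
    exact: expR_ge0.
  by rewrite expR_gt0.
have G10 : 0 < G1.
  apply: (Rintegral_gt0 i1 _ (measurable_sqnorm_gt 0) (lebesgue3_sqnorm_gt 0)) => p.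
    by rewrite expr1 mulr_ge0 ?expR_ge0 ?sqnorm_ge0.
  by move=> p0; rewrite expr1 mulr_gt0 ?expR_gt0.
pose A := C * G0 / (G1 / C) `^ (3 / 5).
have A0 : 0 < A.
  by rewrite /A divr_gt0 ?mulr_gt0// powR_gt0// divr_gt0.
(* The second threshold makes 2c/5 exceed A/y, which suffices because e^(2c/5) >= 1 + 2c/5. *)
exists (Num.max (bmin + 1) (5 / 2 * (A / y))) => c; rewrite gt_max => /andP[cb cA].
have cm : bmin < c := lt_trans bm1 cb.
have e0 := expR_gt0 (- c).
have hn : qmass 1 c <= C * expR (- c) * G0.
  rewrite -RintegralZl//; apply: le_Rintegral => //.
  - exact: integrable_qmass.
  - exact: integrable_scaler.
  move=> p _; have s0 := sqnorm_ge0 p.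
  have /andP[_ h] := hC (1 * sqnorm p + c) (le_trans (ltW cb) (ler_wpDl (mulr_ge0 ler01 s0) (lexx c))).
  by apply: le_trans h _; rewrite -mulrA -expRD opprD addrC.
have he : expR (- c) * (G1 / C) <= qenergy 1 c.
  rewrite (_ : _ * _ = expR (- c) / C * G1); last by ring.
  rewrite -RintegralZl//; apply: le_Rintegral => //.
  - exact: integrable_scaler.
  - exact: integrable_qenergy.
  move=> p _; have s0 := sqnorm_ge0 p.
  have /andP[h _] := hC (1 * sqnorm p + c) (le_trans (ltW cb) (ler_wpDl (mulr_ge0 ler01 s0) (lexx c))).
  rewrite expr1 mulrCA ler_wpM2l//; apply: le_trans h.
  by rewrite mulrAC -expRD opprD addrC.
have qe : 0 < qenergy 1 c by exact: qenergy_gt0.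
have GC : 0 < G1 / C by exact: divr_gt0.
have ee : 0 < expR (- c) * (G1 / C) by exact: mulr_gt0.
have : beta c <= A * expR (- (2 / 5 * c)).
  rewrite betaE.
  apply: (@le_trans _ _ (C * expR (- c) * G0 / (expR (- c) * (G1 / C)) `^ (3 / 5))).
    apply: ler_pM => //.
    - exact/ltW/qmass_gt0.
    - by rewrite invr_ge0 powR_ge0.
    rewrite lef_pV2 ?posrE ?powR_gt0//.
    by apply: ge0_ler_powR => //; rewrite nnegrE; exact: ltW.
  rewrite powRM ?expR_ge0 ?(ltW GC)//.
  rewrite -[expR (- c) `^ _]expRM /A.
  have -> : expR (- (2 / 5 * c)) = expR (- c) / expR (- c * (3 / 5)).
    by rewrite -expRN -expRD; congr expR; field.
  have p0 : 0 < (G1 / C) `^ (3 / 5) by exact: powR_gt0.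
  rewrite le_eqVlt; apply/orP; left; apply/eqP; field.
  by rewrite !gt_eqF// expR_gt0.
move/le_lt_trans; apply.
rewrite expRN ltr_pdivrMr ?expR_gt0// mulrC -ltr_pdivrMr//.
apply: (@lt_le_trans _ _ (1 + 2 / 5 * c)); last exact: expR_ge1Dx.
lra.
Qed.


Lemma qdist_cvg (s : R) : 0 < s ->
  q (s + (bmin + k.+1%:R^-1)) @[k --> \oo] --> q (s + bmin).
Proof.
move=> s0; apply: cvgV; first by rewrite gt_eqF// expR_pm_gt0// ltrDr.
apply: cvgD; last exact: cvg_cst.
have h : (s + bmin) + harmonic k @[k --> \oo] --> s + bmin.
  rewrite -[X in _ --> X]addr0; apply: cvgD; first exact: cvg_cst.
  exact: cvg_harmonic.
have h' := continuous_cvg _ (@continuous_expR R (s + bmin)) h.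
under eq_fun do rewrite addrA.
exact: h'.
Qed.

(** A divergent integral of a nonnegative function has [Rintegral] 0, since [fine] sends infinity to
    0; a nonzero value therefore certifies convergence. *)
Lemma Rintegral_neq0_integrable (f : R3 R -> R) : measurable_fun setT f ->
  (forall p, 0 <= f p) -> \int[mu3]_p f p != 0 ->
  mu3.-integrable setT (EFin \o f).
Proof.
move=> mf f0 /eqP i0; apply: integrable_ge0 => //.
by rewrite ltey; apply/eqP => h; apply: i0; rewrite /Rintegral h.
Qed.

Lemma qmass_cvg_bmin : mu3.-integrable setT (EFin \o (fun p => q (1 * sqnorm p + bmin))) ->
  qmass 1 (bmin + k.+1%:R^-1) @[k --> \oo] --> qmass 1 bmin.
Proof.
move=> ib; apply: fine_cvg; rewrite fineK; last exact: integrable_fin_num.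
(* At p = 0 the boson integrand at the endpoint is 1/0 = 0 by convention, which is neither the limit
   nor a majorant. *)
have ae_s : {ae mu3, forall p, 0 < sqnorm p}.
  apply: filterS ae_p1_neq0 => p p0.
  rewrite /sqnorm -addrA; apply: ltr_pwDl; first by rewrite exprn_even_gt0.
  by rewrite addr_ge0// sqr_ge0.
have [] := @dominated_convergence _ _ _ mu3 _ measurableT
  (fun k p => (q (1 * sqnorm p + (bmin + k.+1%:R^-1)))%:E)
  (fun p => (q (1 * sqnorm p + bmin))%:E) (fun p => (q (1 * sqnorm p + bmin))%:E).
- by move=> n; apply/measurable_EFinP; exact: measurable_qdist_sqnorm.
- by apply/measurable_EFinP; exact: measurable_qdist_sqnorm.
- apply: filterS ae_s => p s0 _; apply: cvg_EFin; first exact: nearW.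
  by apply: qdist_cvg; rewrite mul1r.
- exact: ib.
- apply: filterS ae_s => p s0 n _; rewrite lee_fin mul1r.
  have b0 : bmin < sqnorm p + bmin by rewrite ltrDr.
  have bn : sqnorm p + bmin <= sqnorm p + (bmin + n.+1%:R^-1).
    by rewrite lerD2l lerDl invr_ge0.
  by rewrite ger0_norm ?le_qdist// qdist_ge0// (le_trans (ltW b0)).
by [].
Qed.

End beta_range.

Section beta_inverse.
Context {R : realType} (K : statistics).
Local Notation mu3 := (lebesgue3 R).
Local Notation q := (@qdist R K).
Local Notation bmin := (@beta_min R K).
Local Notation qmass := (@qmass R K).
Local Notation qenergy := (@qenergy R K).
Local Notation beta := (@beta R K).
Local Notation beta_dom := (@beta_dom R K).

Lemma beta_dom_ge c : beta_dom c -> bmin <= c.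
Proof.
by rewrite /beta_dom /beta_min; case: K => /=; rewrite in_itv/= andbT// => /ltW.
Qed.

Lemma beta_dom_gt c : bmin < c -> beta_dom c.
Proof.
by rewrite /beta_dom /beta_min; case: K => /=; rewrite in_itv/= andbT// => /ltW.
Qed.

Lemma lt_ratio_powR (r y n0 n e0 e : R) : 0 <= y -> 0 <= r -> 0 < e -> e <= e0 ->
  y * e0 `^ r < n0 -> n0 <= n -> y < n / e `^ r.
Proof.
move=> y0 r0 e_gt0 ee0 yn0 n0n; rewrite ltr_pdivlMr ?powR_gt0//.
apply: le_lt_trans (lt_le_trans yn0 n0n).
apply: ler_wpM2l => //; apply: ge0_ler_powR => //; rewrite nnegrE ltW//.
exact: lt_le_trans ee0.
Qed.

(** Mass and energy each decrease in c. For c below c0 the mass is at least its value at c0 and the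
    energy at most its value at the endpoint, so the ratio built from these two values bounds beta c
    from below. It exceeds y once c0 is close to the endpoint. *)
Lemma beta_gt_near_min (y : R) : 0 <= y -> y < beta bmin -> exists2 c0,
  bmin < c0 & forall c, beta_dom c -> c < c0 -> y < beta c.
Proof.
move=> y0; rewrite betaE => yb.
have r0 : 0 <= 3 / 5 :> R by lra.
have qq0 (c : R) (p : R3 R) : bmin <= c -> 0 <= q (1 * sqnorm p + c).
  by move=> bc; rewrite qdist_ge0// mul1r (le_trans bc)// lerDr sqnorm_ge0.
(* As beta is positive at the endpoint, neither integral has the value 0 that a divergent one would
   take; hence both converge there. *)
have b0 : 0 < qmass 1 bmin / qenergy 1 bmin `^ (3 / 5) := le_lt_trans y0 yb.
have m0 : 0 < qmass 1 bmin.
  rewrite lt_neqAle Rintegral_ge0 ?andbT; last by move=> p _; exact: qq0.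
  by apply/eqP => m0; move: b0; rewrite -m0 mul0r ltxx.
have e0 : 0 < qenergy 1 bmin.
  rewrite lt_neqAle Rintegral_ge0 ?andbT; last first.
    by move=> p _; rewrite mulr_ge0 ?sqnorm_ge0 ?qq0.
  have nz : (3 / 5 : R) != 0 by apply: lt0r_neq0; lra.
  by apply/eqP => e0; move: b0; rewrite -e0 powR0// invr0 mulr0 ltxx.
have im : mu3.-integrable setT (EFin \o (fun p => q (1 * sqnorm p + bmin))).
  apply: Rintegral_neq0_integrable; last by rewrite gt_eqF.
    exact: measurable_qdist_sqnorm.
  by move=> p; exact: qq0.
have ie : mu3.-integrable setT (EFin \o (fun p => sqnorm p * q (1 * sqnorm p + bmin))).
  apply: Rintegral_neq0_integrable; last by rewrite gt_eqF.
    by apply: measurable_funM; [exact: measurable_sqnorm|exact: measurable_qdist_sqnorm].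
  by move=> p; rewrite mulr_ge0 ?sqnorm_ge0 ?qq0.
have ep : 0 < qenergy 1 bmin `^ (3 / 5) by exact: powR_gt0.
have [k yk] : exists k, y * qenergy 1 bmin `^ (3 / 5) < qmass 1 (bmin + k.+1%:R^-1).
  move: yb; rewrite ltr_pdivlMr// => yb.
  have [k _ hk] := cvgr_gt _ (qmass_cvg_bmin im) _ yb.
  by exists k; apply: hk => /=.
have kb : bmin < bmin + k.+1%:R^-1 by rewrite ltrDl invr_gt0.
exists (bmin + k.+1%:R^-1); first exact: kb.
move=> c /beta_dom_ge bc ck.
rewrite betaE.
(* The boson domain contains the endpoint c = bmin, where the default value of the integrand at p =
   0 is too small; the mass comparison there holds only almost everywhere. *)
have [ec hm he] : [/\ 0 < qenergy 1 c, qmass 1 (bmin + k.+1%:R^-1) <= qmass 1 c &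
    qenergy 1 c <= qenergy 1 bmin].
  move: bc; rewrite le_eqVlt => /predU1P[<-|bc]; split; [exact: e0| |exact: lexx| | |].
  - apply: ae_ge0_le_Rintegral => //; first exact: integrable_qmass.
    apply: filterS ae_p1_neq0 => p p0; apply: le_qdist; last by rewrite lerD2l ltW.
    rewrite ltrDr mul1r /sqnorm -addrA; apply: ltr_pwDl; first by rewrite exprn_even_gt0.
    by rewrite addr_ge0// sqr_ge0.
  - exact: qenergy_gt0.
  - apply: le_Rintegral => //; [exact: integrable_qmass|exact: integrable_qmass|].
    move=> p _; apply: le_qdist; last by rewrite lerD2l ltW.
    by rewrite mul1r (lt_le_trans bc)// lerDr sqnorm_ge0.
  - apply: le_Rintegral => //; first exact: integrable_qenergy.
    move=> p _; have := sqnorm_ge0 p; rewrite le_eqVlt => /predU1P[<-|s0].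
      by rewrite !mul0r.
    rewrite ler_pM2l// le_qdist// ?lerD2l ?(ltW bc)//.
    by rewrite ltrDr mul1r.
exact: (lt_ratio_powR y0 r0 ec he yk hm).
Qed.

(** Whatever preimage [beta_inv] selects lies between c0 and c1, since beta exceeds y1 below c0 and
    is less than y0 beyond c1. That a preimage exists is the intermediate value theorem. *)
Lemma beta_inv_bounds (y0 y1 : R) : 0 < y0 -> y1 < beta bmin -> y0 <= y1 ->
  exists c0 c1, bmin < c0 /\ forall y, y0 <= y <= y1 ->
  [/\ (beta @` beta_dom) y, c0 <= beta_inv K y <= c1 & beta (beta_inv K y) = y].
Proof.
move=> y00 y1b y01.
have [c0 c0m hc0] := beta_gt_near_min (le_trans (ltW y00) y01) y1b.
have [c1 hc1] := beta_lt_at_infty K y00.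
exists c0, c1; split => // y /andP[yy0 yy1].
(* Strictly between the endpoint and c0: beta is continuous from here on, and its value here still
   exceeds y1. *)
pose m := (bmin + c0) / 2.
have mb : bmin < m by rewrite /m; lra.
have mc : m < c0 by rewrite /m; lra.
pose c2 := Num.max m (c1 + 1).
have mc2 : m <= c2 by rewrite /c2 le_max lexx.
have im : (beta @` beta_dom) y.
  have [||c] := @IVT R (fun c => beta (Num.max c m)) m c2 y mc2.
  - exact/continuous_subspaceT/beta_continuous.
  - rewrite maxxx (max_l mc2) ge_min le_max; apply/andP; split.
      apply/orP; right; apply: ltW; apply: lt_le_trans yy0; apply: hc1.
      by rewrite /c2 lt_max ltrDl ltr01 orbT.
    by apply/orP; left; apply: (le_trans yy1); apply: ltW; apply: hc0 => //; exact: beta_dom_gt.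
  - rewrite in_itv/= => /andP[mc' _]; rewrite max_l// => <-.
    by exists c => //; apply: beta_dom_gt; exact: lt_le_trans mc'.
have [id bd] := pinv_mem (fun=> 0) im.
split => //; rewrite -/(beta_inv K y) in id bd.
apply/andP; split; rewrite leNgt; apply/negP => h.
  by have := hc0 _ id h; rewrite /beta_inv bd ltNge yy1.
by have := hc1 _ h; rewrite /beta_inv bd ltNge yy0.
Qed.

End beta_inverse.

Inductive moment := Mass | Mom1 | Mom2 | Mom3 | Energy.

Lemma ratio_powR_bounds {R : realType} (r m2 m m0 N0 N N1 : R) :
  0 <= r -> 0 < m2 -> 0 < N0 -> m2 <= m -> m <= m0 -> N0 <= N <= N1 ->
  (m2 / N1) `^ r <= (m / N) `^ r <= (m0 / N0) `^ r.
Proof.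
move=> r0 m20 N00 m2m mm0 /andP[N0N NN1].
have N_gt0 := lt_le_trans N00 N0N; have N1_gt0 := lt_le_trans N_gt0 NN1.
have m_gt0 := lt_le_trans m20 m2m; have m0_gt0 := lt_le_trans m_gt0 mm0.
apply/andP; split; apply: ge0_ler_powR; rewrite ?nnegrE ?divr_ge0//;
  try exact: ltW.
- by apply: ler_pM; rewrite ?invr_ge0 ?(ltW m20) ?(ltW N1_gt0)// lef_pV2 ?posrE.
- by apply: ler_pM; rewrite ?invr_ge0 ?(ltW m_gt0) ?(ltW N_gt0)// lef_pV2 ?posrE.
Qed.

Lemma powR_div_sym {R : realType} (x y r : R) : 0 <= x -> 0 < y ->
  x `^ r * y `^ (- r) = (x / y) `^ r.
Proof.
move=> x0 y0; rewrite powRM ?invr_ge0 ?(ltW y0)//.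
by congr (_ * _); rewrite -(powR_inv1 (ltW y0)) -powRrM mulN1r.
Qed.

(** * Local equilibria *)

Section equilibrium.
Context {R : realType} (K : statistics).
Local Notation mu3 := (lebesgue3 R).
Local Notation q := (@qdist R K).
Local Notation bmin := (@beta_min R K).
Local Notation qmass := (@qmass R K).
Local Notation qenergy := (@qenergy R K).
Local Notation beta := (@beta R K).
Local Notation beta_dom := (@beta_dom R K).
Implicit Types s : moment -> R.

(** From here to [state_eq], the local equilibrium is restated with a free state s in place of the
    moments of a distribution. At [state_of f x] the formulas reduce to the original ones by
    unfolding, so the mild formula can be written for moments alone. *)
Definition state_momentum s : R3 R := (s Mom1, (s Mom2, s Mom3)).
Definition state_velocity s : R3 R :=
  (s Mom1 / s Mass, (s Mom2 / s Mass, s Mom3 / s Mass)).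
Definition state_gap s : R := s Energy * s Mass - sqnorm (state_momentum s).
Definition state_internal s : R := s Energy - sqnorm (state_momentum s) / s Mass.
Definition state_arg s : R := s Mass * state_internal s `^ (- (3 / 5)).
Definition state_c s : R := beta_inv K (state_arg s).
Definition state_a s : R :=
  (\int[mu3]_p q (sqnorm p + state_c s)) `^ (2 / 3) * s Mass `^ (- (2 / 3)).
Definition state_eq s (p : R3 R) : R :=
  q (state_a s * sqnorm (p - state_velocity s) + state_c s).

Definition state_of (f : R -> R3 R -> R) (x : R) (i : moment) : R :=
  match i with
  | Mass => density f x
  | Mom1 => (momentum f x).1
  | Mom2 => (momentum f x).2.1
  | Mom3 => (momentum f x).2.2
  | Energy => energy f x
  end.

Lemma qmass1E c : qmass 1 c = \int[mu3]_p q (sqnorm p + c).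
Proof. by apply: eq_Rintegral => p _; rewrite mul1r. Qed.

Lemma qmass_le c c' : bmin < c -> c <= c' -> qmass 1 c' <= qmass 1 c.
Proof.
move=> bc cc'; apply: le_Rintegral => //.
- by apply: integrable_qmass; rewrite // (lt_le_trans bc).
- exact: integrable_qmass.
move=> p _; apply: le_qdist; last by rewrite lerD2l.
by rewrite mul1r (lt_le_trans bc)// lerDr sqnorm_ge0.
Qed.

(* A dilation by [sqrt a] turns the equation [beta c = N e^(-3/5)] into the
   two moment equations. *)
Lemma moments_of_beta (c N e : R) : bmin < c -> 0 < N -> 0 < e ->
  beta c = N * e `^ (- (3 / 5)) ->
  qmass ((qmass 1 c / N) `^ (2 / 3)) c = N /\
  qenergy ((qmass 1 c / N) `^ (2 / 3)) c = e.
Proof.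
move=> bc N0 e0; rewrite betaE; set x := qmass 1 c / N => bE.
have n0 : 0 < qmass 1 c by exact: qmass_gt0.
have E0 : 0 < qenergy 1 c by exact: qenergy_gt0.
have x0 : 0 < x by exact: divr_gt0.
have a0 : 0 < x `^ (2 / 3) by exact: powR_gt0.
have sq k : Num.sqrt (x `^ (2 / 3)) ^+ k = x `^ (k%:R / 3).
  rewrite -powR12_sqrt ?powR_ge0// -powR_mulrn ?powR_ge0// -!powRrM.
  by congr (x `^ _); field.
have hm := qmass_scale a0 bc; have he := qenergy_scale a0 bc.
have p3 : x `^ (3%:R / 3) = x by rewrite divff ?powRr1// ltW.
split.
  move: hm; rewrite sq p3 => hm.
  by apply: (mulfI (lt0r_neq0 x0)); rewrite hm /x; field; rewrite gt_eqF.
apply: (mulfI (lt0r_neq0 (powR_gt0 (5%:R / 3) x0))).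
rewrite -sq he sq.
have h : qenergy 1 c `^ (3 / 5) = x * e `^ (3 / 5).
  have p0 := powR_gt0 (3 / 5) E0; have q0 := powR_gt0 (3 / 5) e0.
  move: bE; rewrite powRN => bE.
  have -> : x = qenergy 1 c `^ (3 / 5) / e `^ (3 / 5).
    by apply: (mulIf (lt0r_neq0 N0)); rewrite divfK ?gt_eqF//;
       move/(canRL (divfK (lt0r_neq0 p0))): bE => ->; field; rewrite gt_eqF.
  by rewrite divfK// gt_eqF.
have e53 : (3 / 5) * (5%:R / 3) = 1 :> R by field.
have := congr1 (fun z => z `^ (5%:R / 3)) h.
by rewrite powRM ?powR_ge0 ?(ltW x0)// -!powRrM e53 !powRr1// ltW.
Qed.

Variables n0 n1 e1 k : R.
Hypothesis n0_gt0 : 0 < n0.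
Hypothesis n1_gt0 : 0 < n1.
Hypothesis e1_gt0 : 0 < e1.
Hypothesis k_gt0 : 0 < k.
Hypothesis ratio : n1 `^ (8 / 5) / k `^ (3 / 5) < beta bmin.

(** It is the gap bound, not the energy bound, that keeps the internal energy away from 0. All
    conditions are closed, hence stable under pointwise limits of states. *)
Definition state_ok s := [/\ n0 <= s Mass <= n1, 0 <= s Energy <= e1 & k <= state_gap s].

Lemma state_internalE s : state_ok s -> state_internal s = state_gap s / s Mass.
Proof.
move=> [/andP[h _] _ _]; rewrite /state_internal /state_gap mulrBl mulfK//.
by rewrite gt_eqF// (lt_le_trans n0_gt0).
Qed.

Lemma state_internal_bounds s : state_ok s -> k / n1 <= state_internal s <= e1.
Proof.
move=> ok; rewrite state_internalE//; move: ok => [/andP[hn hn'] /andP[he he'] hk].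
have N0 := lt_le_trans n0_gt0 hn.
apply/andP; split.
  apply: ler_pM => //; [exact: ltW|by rewrite invr_ge0 ltW|].
  by rewrite lef_pV2 ?posrE.
rewrite ler_pdivrMr// /state_gap.
have := sqnorm_ge0 (state_momentum s).
have := ler_wpM2r (ltW N0) he'; lra.
Qed.

(** The internal energy is gap / N, so the argument of [beta_inv] is N^(8/5) gap^(-3/5): this is the
    origin of the exponents in the ratio condition. *)
Lemma state_arg_bounds s : state_ok s ->
  n0 * e1 `^ (- (3 / 5)) <= state_arg s <= n1 `^ (8 / 5) / k `^ (3 / 5).
Proof.
move=> ok; have /andP[i0 i1] := state_internal_bounds ok.
move: (ok) => [/andP[hn hn'] _ _].
have kn : 0 < k / n1 by exact: divr_gt0.
have i_gt0 := lt_le_trans kn i0.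
have r35 : 0 <= 3 / 5 :> R by lra.
have N0 := lt_le_trans n0_gt0 hn.
rewrite /state_arg; apply/andP; split.
  apply: ler_pM => //; [exact: ltW|exact: powR_ge0|].
  rewrite !powRN lef_pV2 ?posrE ?powR_gt0//.
  by apply: ge0_ler_powR => //; rewrite nnegrE ltW.
apply: (@le_trans _ _ (n1 * (k / n1) `^ (- (3 / 5)))).
  apply: ler_pM => //; [exact: ltW|exact: powR_ge0|].
  rewrite !powRN lef_pV2 ?posrE ?powR_gt0//.
  by apply: ge0_ler_powR => //; rewrite nnegrE ltW.
rewrite powRM ?invr_ge0 ?(ltW k_gt0) ?(ltW n1_gt0)//.
rewrite -(powR_inv1 (ltW n1_gt0)) -powRrM [k `^ _]powRN mulrCA mulrC.
rewrite -{1}(powRr1 (ltW n1_gt0)) -powRD; last by rewrite (gt_eqF n1_gt0) implybT.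
by rewrite (_ : 1 + _ = 8 / 5)//; field.
Qed.

Lemma state_params : exists a0 a1 c0 c1, [/\ 0 < a0, bmin < c0 &
  forall s, state_ok s ->
  [/\ (beta @` beta_dom) (state_arg s),
      a0 <= state_a s <= a1, c0 <= state_c s <= c1,
      qmass (state_a s) (state_c s) = s Mass &
      qenergy (state_a s) (state_c s) = state_internal s]].
Proof.
set y1 := n1 `^ (8 / 5) / k `^ (3 / 5).
have y1_gt0 : 0 < y1 by rewrite divr_gt0 ?powR_gt0.
(* The minimum with y1 secures y0 <= y1 without exhibiting a state. *)
pose y0 := Num.min (n0 * e1 `^ (- (3 / 5))) y1.
have y0_gt0 : 0 < y0 by rewrite lt_min y1_gt0 andbT mulr_gt0 ?powR_gt0.
have y01 : y0 <= y1 by rewrite ge_min lexx orbT.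
have [c0 [c1 [c0m hc]]] := beta_inv_bounds y0_gt0 ratio y01.
(* [c1] is not known to exceed [bmin], which the positivity of the mass at the upper parameter
   requires. *)
pose c2 := Num.max c0 c1.
have c2m : bmin < c2 by rewrite lt_max c0m.
have m2 : 0 < qmass 1 c2 by exact: qmass_gt0.
exists ((qmass 1 c2 / n1) `^ (2 / 3)), ((qmass 1 c0 / n0) `^ (2 / 3)), c0, c1.
split => //; first by rewrite powR_gt0 ?divr_gt0.
move=> s ok; have /andP[b0 b1] := state_arg_bounds ok.
have [|h1 /andP[h2 h2'] h3] := hc (state_arg s).
  by rewrite ge_min b0 orTb/= b1.
have /andP[i0 i1] := state_internal_bounds ok.
have i_gt0 : 0 < state_internal s by apply: lt_le_trans i0; exact: divr_gt0.
move: (ok) => [/andP[hn hn'] _ _].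
have N0 := lt_le_trans n0_gt0 hn.
have cm := lt_le_trans c0m h2.
have aE : state_a s = (qmass 1 (state_c s) / s Mass) `^ (2 / 3).
  rewrite /state_a -qmass1E; apply: powR_div_sym => //.
  exact/ltW/qmass_gt0.
have [M1 M2] := moments_of_beta cm N0 i_gt0 h3.
split; [exact: h1| |by apply/andP; split|by rewrite aE|by rewrite aE].
have r23 : 0 <= 2 / 3 :> R by [].
rewrite aE; apply: (ratio_powR_bounds r23 m2 n0_gt0); last by apply/andP.
  by apply: qmass_le => //; rewrite le_max h2' orbT.
exact: qmass_le.
Qed.

End equilibrium.

(** * Lipschitz dependence of the local equilibrium on the moments *)

Section algebra.
Context {R : realType}.

Lemma lipschitz_mul (x x' y y' X Y dx dy : R) : `|x| <= X -> `|y'| <= Y ->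
  `|x - x'| <= dx -> `|y - y'| <= dy -> `|x * y - x' * y'| <= X * dy + Y * dx.
Proof.
move=> hx hy hdx hdy.
rewrite (_ : _ - _ = x * (y - y') + y' * (x - x')); last by ring.
apply: le_trans (ler_normD _ _) _; rewrite !normrM.
by apply: lerD; apply: ler_pM.
Qed.

Lemma lipschitz_inv (n0 x y d : R) : 0 < n0 -> n0 <= x -> n0 <= y -> `|x - y| <= d ->
  `|x^-1 - y^-1| <= n0 ^- 2 * d.
Proof.
move=> n00 hx hy hd; have x0 := lt_le_trans n00 hx; have y0 := lt_le_trans n00 hy.
rewrite (_ : _ - _ = (x * y)^-1 * (y - x)); last first.
  by field; rewrite !gt_eqF.
rewrite normrM [`|y - x|]distrC ger0_norm ?invr_ge0 ?mulr_ge0 ?(ltW x0) ?(ltW y0)//.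
apply: ler_pM => //; first by rewrite invr_ge0 mulr_ge0 ?(ltW x0) ?(ltW y0).
rewrite lef_pV2 ?posrE ?mulr_gt0// ?exprn_gt0// expr2.
by apply: ler_pM => //; rewrite ltW.
Qed.

Lemma sqnorm_shift_lower (p u : R3 R) : sqnorm p / 2 - sqnorm u <= sqnorm (p - u).
Proof.
have h (x y : R) : x ^+ 2 / 2 - y ^+ 2 <= (x - y) ^+ 2.
  by have := sqr_ge0 (x - 2 * y); rewrite !expr2; lra.
have := h p.1 u.1; have := h p.2.1 u.2.1; have := h p.2.2 u.2.2.
rewrite /sqnorm/=; lra.
Qed.

Lemma sqnorm_shift_upper (p u : R3 R) : sqnorm (p - u) <= 2 * sqnorm p + 2 * sqnorm u.
Proof.
have h (x y : R) : (x - y) ^+ 2 <= 2 * x ^+ 2 + 2 * y ^+ 2.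
  by have := sqr_ge0 (x + y); rewrite !expr2; lra.
have := h p.1 u.1; have := h p.2.1 u.2.1; have := h p.2.2 u.2.2.
rewrite /sqnorm/=; lra.
Qed.

Definition coord_le (U : R) (u : R3 R) := [/\ `|u.1| <= U, `|u.2.1| <= U & `|u.2.2| <= U].

Lemma sqnorm_coord_le U u : coord_le U u -> sqnorm u <= 3 * U ^+ 2.
Proof.
have h (x : R) : `|x| <= U -> x ^+ 2 <= U ^+ 2.
  by move=> xU; rewrite -[x ^+ 2]real_normK ?num_real// ler_sqr ?nnegrE// (le_trans _ xU).
by move=> [/h h1 /h h2 /h h3]; rewrite /sqnorm; lra.
Qed.

Lemma sqnorm_shift_lipschitz (U d : R) (p u u' : R3 R) :
  coord_le U u -> coord_le U u' -> coord_le d (u - u') ->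
  `|sqnorm (p - u) - sqnorm (p - u')| <= d * (3 + 6 * U) * (1 + sqnorm p).
Proof.
move=> [u1 u2 u3] [u1' u2' u3'] [d1 d2 d3].
have U0 : 0 <= U by exact: le_trans u1.
have d0 : 0 <= d by exact: le_trans d1.
have h (x y y' : R) : `|y| <= U -> `|y'| <= U -> `|y - y'| <= d ->
    `|(x - y) ^+ 2 - (x - y') ^+ 2| <= d * (1 + x ^+ 2 + 2 * U).
  move=> yU yU' yd.
  rewrite (_ : _ - _ = (y - y') * (y + y' - 2 * x)); last by ring.
  rewrite normrM; apply: ler_pM => //.
  apply: le_trans (ler_normB _ _) _.
  have := ler_normD y y'; rewrite normrM (@ger0_norm _ 2)//.
  have : 2 * `|x| <= 1 + x ^+ 2.
    have := sqr_ge0 (`|x| - 1); rewrite -[x ^+ 2]real_normK ?num_real//; rewrite !expr2; lra.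
  lra.
have h1 := h p.1 _ _ u1 u1' d1; have h2 := h p.2.1 _ _ u2 u2' d2.
have h3 := h p.2.2 _ _ u3 u3' d3.
rewrite (_ : sqnorm (p - u) - sqnorm (p - u') =
  ((p.1 - u.1) ^+ 2 - (p.1 - u'.1) ^+ 2) +
  ((p.2.1 - u.2.1) ^+ 2 - (p.2.1 - u'.2.1) ^+ 2) +
  ((p.2.2 - u.2.2) ^+ 2 - (p.2.2 - u'.2.2) ^+ 2)); last by rewrite /sqnorm/=; ring.
apply: le_trans (ler_normD _ _) _.
apply: (@le_trans _ _ (d * (1 + p.1 ^+ 2 + 2 * U) + d * (1 + p.2.1 ^+ 2 + 2 * U) +
   d * (1 + p.2.2 ^+ 2 + 2 * U))).
  by apply: lerD => //; apply: le_trans (ler_normD _ _) _; exact: lerD.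
rewrite -!mulrDr -mulrA ler_wpM2l//.
have s0 := sqnorm_ge0 p.
apply: (@le_trans _ _ (3 + 6 * U + sqnorm p)); first by rewrite /sqnorm; lra.
have Us := mulr_ge0 U0 s0; lra.
Qed.

End algebra.

Section equilibrium_lipschitz.
Context {R : realType} (K : statistics).
Local Notation mu3 := (lebesgue3 R).
Local Notation q := (@qdist R K).
Local Notation bmin := (@beta_min R K).
Local Notation beta := (@beta R K).
Implicit Types s : moment -> R.

Variables n0 n1 e1 k : R.
Hypothesis n0_gt0 : 0 < n0.
Hypothesis n1_gt0 : 0 < n1.
Hypothesis e1_gt0 : 0 < e1.
Hypothesis k_gt0 : 0 < k.
Local Notation ok := (state_ok n0 n1 e1 k).

Definition state_dist_le (D : R) s s' := forall i : moment, `|s i - s' i| <= D.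

(** A positive gap means |P|^2 <= E N, so no separate bound on the momentum is imposed on states.
    The inequality |x| <= 1 + x^2 replaces a square root. *)
Lemma state_momentum_bound s : ok s -> coord_le (1 + e1 * n1) (state_momentum s).
Proof.
move=> [/andP[hn hn'] /andP[he he'] hk].
have : sqnorm (state_momentum s) <= e1 * n1.
  have N0 := lt_le_trans n0_gt0 hn.
  have EN : s Energy * s Mass <= e1 * n1 by apply: ler_pM => //; exact: ltW.
  apply: le_trans EN; have := le_trans (ltW k_gt0) hk.
  by rewrite /state_gap subr_ge0.
rewrite /sqnorm/= => h.
have abs (x : R) : x ^+ 2 <= e1 * n1 -> `|x| <= 1 + e1 * n1.
  have := sqr_ge0 (`|x| - 1); rewrite -[x ^+ 2]real_normK ?num_real// !expr2; nra.
have := sqr_ge0 (s Mom1); have := sqr_ge0 (s Mom2); have := sqr_ge0 (s Mom3) => h1 h2 h3.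
by split; apply: abs; rewrite /=; lra.
Qed.

Lemma state_velocity_lipschitz : exists U L, [/\ 0 <= U, 0 <= L,
  forall s, ok s -> coord_le U (state_velocity s) &
  forall s s' (D : R), ok s -> ok s' -> state_dist_le D s s' ->
    coord_le (L * D) (state_velocity s - state_velocity s') /\
    `|state_internal s - state_internal s'| <= L * D].
Proof.
pose M := 1 + e1 * n1.
have M0 : 0 <= M by rewrite addr_ge0// mulr_ge0// ltW.
pose U := M / n0; pose L1 := M * n0 ^- 2 + n0^-1.
have i0 : 0 <= n0^-1 by rewrite invr_ge0 ltW.
have U0 : 0 <= U by rewrite mulr_ge0.
have L10 : 0 <= L1 by rewrite addr_ge0// mulr_ge0// invr_ge0 exprn_ge0// ltW.
have inv s : ok s -> `|(s Mass)^-1| <= n0^-1.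
  move=> [/andP[hn _] _ _]; have N0 := lt_le_trans n0_gt0 hn.
  by rewrite ger0_norm ?invr_ge0 ?(ltW N0)// lef_pV2 ?posrE.
have vel s : ok s -> coord_le U (state_velocity s).
  move=> oks; have [h1 h2 h3] := state_momentum_bound oks; have hi := inv _ oks.
  by split; rewrite normrM; apply: ler_pM.
have ML1 : 0 <= M * L1 by exact: mulr_ge0.
have tail0 : 0 <= 1 + (M * L1 + U *+ 3 + M * L1 *+ 2).
  apply: addr_ge0 => //; apply: addr_ge0; last exact: mulrn_wge0.
  by apply: addr_ge0 => //; exact: mulrn_wge0.
(* [L1] is for the velocity. The rest is 1 + 3 (M L1 + U), for the internal energy: 1 for the energy
   and M L1 + U for each of the three products of momentum and velocity. *)
exists U, (L1 + (1 + (M * L1 + U *+ 3 + M * L1 *+ 2))); split => //.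
  exact: addr_ge0.
move=> s s' D oks oks' ss'.
have D0 : 0 <= D by exact: le_trans (ss' Mass).
have [h1 h2 h3] := state_momentum_bound oks.
have [h1' h2' h3'] := state_momentum_bound oks'.
have hi' := inv _ oks'.
have [v1 v2 v3] := vel _ oks; have [v1' v2' v3'] := vel _ oks'.
have di : `|(s Mass)^-1 - (s' Mass)^-1| <= n0 ^- 2 * D.
  by apply: lipschitz_inv => //; [case: oks => /andP[]|case: oks' => /andP[]].
have dv i : `|s i| <= M -> `|s i / s Mass - s' i / s' Mass| <= L1 * D.
  move=> hs; apply: le_trans (lipschitz_mul hs hi' (ss' i) di) _.
  by rewrite mulrA -mulrDl.
have dP i : `|s i| <= M -> `|s' i / s' Mass| <= U ->
    `|s i * (s i / s Mass) - s' i * (s' i / s' Mass)| <= (M * L1 + U) * D.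
  move=> hs hu; apply: le_trans (lipschitz_mul hs hu (ss' i) (dv i hs)) _.
  by rewrite mulrA -mulrDl.
have LD : L1 * D <= (L1 + (1 + (M * L1 + U *+ 3 + M * L1 *+ 2))) * D.
  by rewrite ler_wpM2r// lerDl.
split.
  by split; apply: le_trans LD; apply: dv.
have iE t : state_internal t = t Energy - (t Mom1 * (t Mom1 / t Mass) +
    t Mom2 * (t Mom2 / t Mass) + t Mom3 * (t Mom3 / t Mass)).
  by rewrite /state_internal /sqnorm/= !expr2; ring.
have g1 := dP Mom1 h1 v1'; have g2 := dP Mom2 h2 v2'; have g3 := dP Mom3 h3 v3'.
have g0 := ss' Energy.
have L1D : 0 <= L1 * D by exact: mulr_ge0.
move: g0 g1 g2 g3; rewrite !iE !ler_norml => /andP[? ?] /andP[? ?] /andP[? ?] /andP[? ?].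
apply/andP; split; lra.
Qed.

Hypothesis ratio : n1 `^ (8 / 5) / k `^ (3 / 5) < beta bmin.

(** Mass and internal energy of the state are the two moments of the gas at rest with parameters (a,
    c). Both depend on the state in a Lipschitz way, so the Lipschitz inverse of the moment map
    gives the claim without any estimate on [beta_inv] itself. *)
Lemma state_params_lipschitz : exists a0 a1 c0 L, [/\ 0 < a0, bmin < c0, 0 <= L,
  forall s, ok s -> a0 <= state_a K s <= a1 /\ c0 <= state_c K s &
  forall s s' (D : R), ok s -> ok s' -> state_dist_le D s s' ->
    `|state_a K s - state_a K s'| <= L * D /\
    `|state_c K s - state_c K s'| <= L * D].
Proof.
have [a0 [a1 [c0 [c1 [a00 c0m hp]]]]] :=
  state_params n0_gt0 n1_gt0 e1_gt0 k_gt0 ratio.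
have [L L0 hL] := @qgas_inverse_lipschitz R K a0 a1 c0 c1 a00 c0m.
have [U [Lv [U0 Lv0 _ hv]]] := state_velocity_lipschitz.
exists a0, a1, c0, (L * (Lv + 1)); split => //.
- by rewrite mulr_ge0 ?addr_ge0// ltW.
- by move=> s /hp[_ ha /andP[hc _] _ _]; split.
move=> s s' D oks oks' ss'.
have [_ ha hc hm he] := hp _ oks; have [_ ha' hc' hm' he'] := hp _ oks'.
have [h1 h2] := hL _ _ _ _ ha ha' hc hc'.
have [_ hi] := hv _ _ _ oks oks' ss'.
have le : L * (`|state_internal s - state_internal s'| + `|s Mass - s' Mass|) <=
    L * (Lv + 1) * D.
  rewrite -mulrA ler_pM2l// mulrDl mul1r; apply: lerD => //; exact: ss'.
move: h1 h2; rewrite hm hm' he he' => h1 h2.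
by split; [exact: le_trans h1 le|exact: le_trans h2 le].
Qed.

Lemma state_eq_lipschitz : exists C b, [/\ 0 < C, 0 < b,
  forall s, ok s -> forall p, 0 <= state_eq K s p <= C * expR (- (b * sqnorm p)) &
  forall s s' (D : R), ok s -> ok s' -> state_dist_le D s s' ->
    forall p, `|state_eq K s p - state_eq K s' p| <= C * D * expR (- (b * sqnorm p))].
Proof.
have [a0 [a1 [c0 [L [a00 c0m L0 hac hL]]]]] := state_params_lipschitz.
have [U [Lv [U0 Lv0 hU hv]]] := state_velocity_lipschitz.
have [C1 C10 [hq1 _]] := qdist_bounds c0m.
have [C2 C20 hq2] := qdist_lipschitz c0m.
(* The argument of [qdist] grows at least like a0 |p|^2 / 2 = 2 b |p|^2; half of this rate is spent
   on absorbing the factor 1 + |p|^2 of the Lipschitz estimate. *)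
pose b := a0 / 4.
have b0 : 0 < b by rewrite divr_gt0.
pose E0 := expR (- (c0 - a0 * (3 * U ^+ 2))).
have E00 : 0 < E0 := expR_gt0 _.
(* A lower bound of the [qdist] argument common to all states of the set, from |p - u|^2 >= |p|^2 /
   2 - |u|^2 and |u|^2 <= 3 U^2. The maximum with 0 keeps it at or above c0, where the estimates on
   [qdist] hold. *)
pose l p := c0 + Num.max 0 (a0 * (sqnorm p / 2 - 3 * U ^+ 2)).
have lE p : expR (- l p) <= E0 * expR (- (2 * b * sqnorm p)).
  rewrite -expRD ler_expR /l /b.
  have : a0 * (sqnorm p / 2 - 3 * U ^+ 2) <= Num.max 0 (a0 * (sqnorm p / 2 - 3 * U ^+ 2)).
    by rewrite le_max lexx orbT.
  set m := Num.max _ _; lra.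
have l0 p : c0 <= l p by rewrite lerDl le_max lexx.
have lt s p : ok s -> l p <= state_a K s * sqnorm (p - state_velocity s) + state_c K s.
  move=> oks; have [/andP[ha _] hc] := hac _ oks.
  rewrite addrC; apply: lerD => //.
  have S0 := sqnorm_ge0 (p - state_velocity s).
  have aS : 0 <= state_a K s * sqnorm (p - state_velocity s).
    by apply: mulr_ge0 => //; exact: le_trans (ltW a00) ha.
  rewrite ge_max aS/=.
  apply: (@le_trans _ _ (a0 * sqnorm (p - state_velocity s))); last exact: ler_wpM2r.
  rewrite ler_wpM2l ?(ltW a00)//; apply: le_trans (sqnorm_shift_lower _ _).
  by rewrite lerD2l lerN2; apply: sqnorm_coord_le; exact: hU.
(* Lipschitz constant of the [qdist] argument relative to 1 + |p|^2; its three summands vary a, the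
   velocity and c. *)
pose T := L * (2 + 6 * U ^+ 2) + `|a1| * (Lv * (3 + 6 * U)) + L.
have T0 : 0 <= T.
  by rewrite !addr_ge0 ?mulr_ge0 ?addr_ge0 ?mulr_ge0 ?exprn_ge0.
pose C := C1 * E0 + C2 * E0 * (T * (1 + b^-1)).
have ib : 0 <= 1 + b^-1 by rewrite addr_ge0// invr_ge0 ltW.
exists C, b; split => //.
- by rewrite ltr_wpDr ?mulr_gt0// !mulr_ge0// ltW.
- move=> s oks p; have h := lt s p oks.
  have /andP[_ hq] := hq1 _ (le_trans (l0 p) h).
  have bt := lt_le_trans c0m (le_trans (l0 p) h).
  apply/andP; split; first by rewrite ltW// qdist_gt0.
  apply: le_trans hq _; apply: (@le_trans _ _ (C1 * E0 * expR (- (b * sqnorm p)))).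
    rewrite -mulrA ler_pM2l//; apply: (@le_trans _ _ (expR (- l p))).
      by rewrite ler_expR lerN2.
    apply: le_trans (lE p) _; rewrite ler_pM2l// ler_expR lerN2.
    by rewrite ler_wpM2r ?sqnorm_ge0// ler_peMl ?(ltW b0)// ler1n.
  rewrite ler_wpM2r ?expR_ge0// lerDl !mulr_ge0// ltW//.
move=> s s' D oks oks' ss' p.
have D0 : 0 <= D by exact: le_trans (ss' Mass).
have h := lt s p oks; have h' := lt s' p oks'.
have hq := hq2 _ _ _ (l0 p) h h'.
have s0 := sqnorm_ge0 p; have s1 := sqnorm1_ge0 p; have s2 := sqnorm1_ge1 p.
have [dv _] := hv _ _ _ oks oks' ss'.
have [da dc] := hL _ _ _ oks oks' ss'.
have [/andP[a0s a1s] _] := hac _ oks'.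
have dt : `|state_a K s * sqnorm (p - state_velocity s) + state_c K s -
    (state_a K s' * sqnorm (p - state_velocity s') + state_c K s')| <=
    T * D * (1 + sqnorm p).
  rewrite (_ : _ - _ = (state_a K s - state_a K s') * sqnorm (p - state_velocity s) +
    state_a K s' * (sqnorm (p - state_velocity s) - sqnorm (p - state_velocity s')) +
    (state_c K s - state_c K s')); last by ring.
  apply: (@le_trans _ _ (L * D * ((2 + 6 * U ^+ 2) * (1 + sqnorm p)) +
     `|a1| * (Lv * D * (3 + 6 * U) * (1 + sqnorm p)) + L * D * (1 + sqnorm p))); last first.
    by rewrite /T le_eqVlt; apply/orP; left; apply/eqP; ring.
  apply: le_trans (ler_normD _ _) _; apply: lerD; last first.
    by apply: le_trans dc _; rewrite ler_peMr// mulr_ge0.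
  apply: le_trans (ler_normD _ _) _; apply: lerD; rewrite normrM.
    apply: ler_pM => //; rewrite ger0_norm ?sqnorm_ge0//.
    apply: le_trans (sqnorm_shift_upper _ _) _.
    have := sqnorm_coord_le (hU _ oks); have := mulr_ge0 (sqr_ge0 U) s0; lra.
  apply: ler_pM => //.
    rewrite (ger0_norm (le_trans (ltW a00) a0s)).
    exact: le_trans a1s (ler_norm a1).
  by apply: sqnorm_shift_lipschitz => //; exact: hU.
apply: le_trans hq _.
apply: (@le_trans _ _ (C2 * (E0 * expR (- (2 * b * sqnorm p))) *
   (T * D * ((1 + b^-1) * expR (b * sqnorm p))))).
  apply: ler_pM => //; first by rewrite mulr_ge0 ?expR_ge0 ?(ltW C20).
    by rewrite ler_pM2l.
  apply: le_trans dt _; rewrite ler_wpM2l ?mulr_ge0//; exact: le_1D_expR.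
rewrite (_ : _ * (T * D * _) = C2 * E0 * (T * (1 + b^-1)) * D *
   (expR (- (2 * b * sqnorm p)) * expR (b * sqnorm p))); last by ring.
rewrite -expRD (_ : - (2 * b * _) + _ = - (b * sqnorm p)); last by ring.
rewrite ler_wpM2r ?expR_ge0// ler_wpM2r// lerDr.
by rewrite mulr_ge0// ltW.
Qed.

End equilibrium_lipschitz.

(** * Measurability of the local equilibrium *)

Section equilibrium_measurable.
Context {R : realType} (K : statistics).
Local Notation mu3 := (lebesgue3 R).
Local Notation q := (@qdist R K).
Local Notation bmin := (@beta_min R K).
Local Notation beta := (@beta R K).

Definition clamp (y0 y1 y : R) := Num.max y0 (Num.min y y1).

Lemma clamp_bounds y0 y1 y : y0 <= y1 -> y0 <= clamp y0 y1 y <= y1.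
Proof.
by move=> y01; rewrite /clamp le_max lexx/= ge_max y01 ge_min lexx orbT.
Qed.

Lemma clamp_id y0 y1 y : y0 <= y <= y1 -> clamp y0 y1 y = y.
Proof. by move=> /andP[h h']; rewrite /clamp min_l// max_r. Qed.

Lemma clamp_continuous y0 y1 : continuous (clamp y0 y1).
Proof.
apply: (@lipschitz_continuous _ _ 1) => x y; rewrite mul1r /clamp.
have bnd (u v : R) : - `|u - v| <= u - v <= `|u - v| by rewrite -ler_norml.
have hmin : `|Num.min x y1 - Num.min y y1| <= `|x - y|.
  have /andP[h1 h2] := bnd x y; rewrite ler_norml; apply/andP.
  by case: (leP x y1) => ?; case: (leP y y1) => ?; split; lra.
apply: le_trans hmin; move: (Num.min x y1) (Num.min y y1) => u v.
have /andP[h1 h2] := bnd u v; rewrite ler_norml; apply/andP.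
by case: (leP y0 u) => ?; case: (leP y0 v) => ?; split; lra.
Qed.

(* At unit density and zero momentum [beta_inv y] is the parameter [c] of the
   state of energy [y ^ (-5/3)]. *)
Let unit_state (y : R) (i : moment) : R :=
  match i with Mass => 1 | Energy => y `^ (- (5 / 3)) | _ => 0 end.

(** The parameter c is Lipschitz in the energy of the unit-density state, and this energy is a
    continuous function of the clamped y; so the composite is continuous. The clamp is there because
    [beta_inv] takes arbitrary values off the range of beta. *)
Lemma beta_inv_measurable (y0 y1 : R) : 0 < y0 -> y0 <= y1 -> y1 < beta bmin ->
  measurable_fun setT (fun y => beta_inv K (clamp y0 y1 y)).
Proof.
move=> y00 y01 y1b; have y10 := lt_le_trans y00 y01.
have pw y : 0 < y -> (y `^ (- (5 / 3))) `^ (- (3 / 5)) = y.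
  move=> y_gt0; rewrite -powRrM (_ : _ * _ = 1) ?powRr1 ?ltW//; by field.
have pdec x y : 0 < x -> x <= y -> y `^ (- (5 / 3)) <= x `^ (- (5 / 3)).
  move=> x0 xy; have r0 : 0 <= 5 / 3 :> R by [].
  rewrite !powRN lef_pV2 ?posrE ?powR_gt0//; last exact: lt_le_trans xy.
  by apply: ge0_ler_powR => //; rewrite nnegrE ltW// (lt_le_trans x0).
pose e1 := y0 `^ (- (5 / 3)); pose k := y1 `^ (- (5 / 3)).
have e10 : 0 < e1 by exact: powR_gt0.
have k0 : 0 < k by exact: powR_gt0.
(* With density 1 and k = y1^(-5/3) the left-hand side equals y1. *)
have ratio : 1 `^ (8 / 5) / k `^ (3 / 5) < beta bmin.
  by rewrite powR1 mul1r -powRN pw.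
have [a0 [a1 [c0 [L [_ _ _ _ hL]]]]] :=
  state_params_lipschitz ltr01 ltr01 e10 k0 ratio.
have sq0 y : sqnorm (state_momentum (unit_state y)) = 0.
  by rewrite /sqnorm/= expr0n/= !addr0.
have cE y : 0 < y -> state_c K (unit_state y) = beta_inv K y.
  move=> y_gt0; rewrite /state_c /state_arg /state_internal sq0 mul0r subr0/=.
  by rewrite mul1r pw.
have ok y : y0 <= y <= y1 -> state_ok 1 1 e1 k (unit_state y).
  move=> /andP[yy0 yy1]; have y_gt0 := lt_le_trans y00 yy0.
  split; rewrite /= ?lexx ?powR_ge0//=; first exact: pdec.
  by rewrite /state_gap sq0 subr0 mulr1; exact: pdec.
apply: continuous_measurable_fun.
apply: (@continuous_le_dist _ _ (fun y => clamp y0 y1 y `^ (- (5 / 3))) L).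
  move=> x; apply: (@continuous_comp _ _ _ (clamp y0 y1) (fun a => a `^ (- (5 / 3)))).
    exact: clamp_continuous.
  apply: powR_continuous; have /andP[h _] := clamp_bounds x y01.
  exact: lt_le_trans h.
move=> x y; have bx := clamp_bounds x y01; have by_ := clamp_bounds y y01.
rewrite -!cE; [|by move: by_ => /andP[h _]; exact: lt_le_trans h|
  by move: bx => /andP[h _]; exact: lt_le_trans h].
by apply: (hL _ _ _ (ok _ bx) (ok _ by_) _).2 => -[]/=; rewrite ?subrr ?normr0.
Qed.

Variables n0 n1 e1 k : R.
Hypothesis n0_gt0 : 0 < n0.
Hypothesis n1_gt0 : 0 < n1.
Hypothesis e1_gt0 : 0 < e1.
Hypothesis k_gt0 : 0 < k.
Hypothesis ratio : n1 `^ (8 / 5) / k `^ (3 / 5) < beta bmin.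
Local Notation ok := (state_ok n0 n1 e1 k).

Section state_family.
Context d (T : measurableType d) (m : T -> moment -> R).
Hypothesis mm : forall i, measurable_fun setT (fun y => m y i).
Hypothesis okm : forall y, ok (m y).

Lemma measurable_powR_comp (f : T -> R) r : measurable_fun setT f ->
  measurable_fun setT (fun y => f y `^ r).
Proof.
by move=> mf; apply: (@measurableT_comp _ _ _ _ _ _ (@powR R ^~ r)) => //;
  exact: measurable_powR.
Qed.

Lemma measurable_state_c : measurable_fun setT (fun y => state_c K (m y)).
Proof.
pose y1 := n1 `^ (8 / 5) / k `^ (3 / 5).
pose y0 := Num.min (n0 * e1 `^ (- (3 / 5))) y1.
have y1_gt0 : 0 < y1 by rewrite divr_gt0 ?powR_gt0.
have y0_gt0 : 0 < y0 by rewrite lt_min y1_gt0 andbT mulr_gt0 ?powR_gt0.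
have y01 : y0 <= y1 by rewrite ge_min lexx orbT.
have mg := beta_inv_measurable y0_gt0 y01 ratio.
have -> : (fun y => state_c K (m y)) =
    (fun x => beta_inv K (clamp y0 y1 x)) \o (fun y => state_arg (m y)).
  apply/funext => y /=; rewrite clamp_id//.
  have /andP[b0 b1] : n0 * e1 `^ (- (3 / 5)) <= state_arg (m y) <= y1.
    exact: state_arg_bounds.
  by rewrite ge_min b0 b1.
apply: measurableT_comp => //.
apply: measurable_funM => //; apply: measurable_powR_comp.
apply: measurable_funB => //; apply: measurable_funM; last exact: measurable_invr.
by apply: measurableT_comp; [exact: measurable_sqnorm|exact: measurable_R3].
Qed.

Lemma measurable_state_a : measurable_fun setT (fun y => state_a K (m y)).
Proof.
apply: measurable_funM; last exact: measurable_powR_comp.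
apply: measurable_powR_comp.
apply: (@measurable_fun_Rintegral _ _ _ _ R mu3
  (fun z : T * R3 R => q (sqnorm z.2 + state_c K (m z.1)))).
apply: (@measurableT_comp _ _ _ _ _ _ q); first exact: measurable_qdist.
apply: measurable_funD.
  by apply: measurableT_comp; [exact: measurable_sqnorm|exact: measurable_snd].
by apply: (measurableT_comp measurable_state_c); exact: measurable_fst.
Qed.

Lemma measurable_state_eq :
  measurable_fun setT (fun z : T * R3 R => state_eq K (m z.1) z.2).
Proof.
apply: (@measurableT_comp _ _ _ _ _ _ q); first exact: measurable_qdist.
apply: measurable_funD; last first.
  by apply: (measurableT_comp measurable_state_c); exact: measurable_fst.
apply: measurable_funM.
  by apply: (measurableT_comp measurable_state_a); exact: measurable_fst.
apply: measurableT_comp; first exact: measurable_sqnorm.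
have mv i : measurable_fun setT (fun z : T * R3 R => m z.1 i / m z.1 Mass).
  apply: measurable_funM; last apply: measurable_invr.
  - by apply: (measurableT_comp (mm i)); exact: measurable_fst.
  - by apply: (measurableT_comp (mm Mass)); exact: measurable_fst.
have ms : measurable_fun setT (fun z : T * R3 R => z.2) by exact: measurable_snd.
apply: measurable_R3; apply: measurable_funB; try exact: mv.
- by apply: measurableT_comp => //; exact: measurable_fst.
- by do 2 apply: measurableT_comp => //.
- by do 2 apply: measurableT_comp => //.
Qed.

End state_family.

End equilibrium_measurable.

(** * The transport operator *)

Section optical_depth.
Context {R : realType}.
Local Notation mu := (@lebesgue_measure R).

Definition optical_depth (n : R -> R) (x : R) : R := \int[mu]_(z in `[0, x]) n z.

Lemma lebesgue_itvcc (a b : R) : a <= b -> fine (mu `[a, b]%classic) = b - a.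
Proof.
move=> ab; rewrite lebesgue_measure_itv/= lte_fin.
have [//|ba] := ltP a b.
have -> : b = a by apply/eqP; rewrite eq_le ba ab.
by rewrite subrr.
Qed.

Section bounded.
Variables (n : R -> R) (n0 n1 : R).
Hypothesis mn : measurable_fun setT n.
Hypothesis n_bd : forall x, n0 <= n x <= n1.
Hypothesis n0_gt0 : 0 < n0.

Lemma bounded_integrable_itv (f : R -> R) (M a b : R) : measurable_fun setT f ->
  (forall x, `|f x| <= M) -> mu.-integrable `[a, b] (EFin \o f).
Proof.
move=> mf fM; apply: measurable_bounded_integrable => //.
- rewrite [ltLHS](lebesgue_measure_itv `[a, b])/=; case: ifPn => _; rewrite ?ltry//.
- exact: measurable_funTS.
exists M; split; first exact: num_real.
by move=> y My x _; apply: le_trans (fM x) (ltW My).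
Qed.

Let n_norm x : `|n x| <= n1.
Proof. by have /andP[h1 h2] := n_bd x; rewrite ger0_norm// (le_trans (ltW n0_gt0)). Qed.

Lemma optical_depthB y x : 0 <= y -> y <= x ->
  \int[mu]_(z in `[y, x]) n z = optical_depth n x - optical_depth n y.
Proof.
move=> y0 yx; rewrite /optical_depth Rintegral_itvB; last 3 first.
- exact: bounded_integrable_itv n_norm.
- by rewrite bnd_simp.
- by rewrite bnd_simp.
rewrite Rintegral_itv_obnd_cbnd//.
apply: (integrableS _ _ _ (bounded_integrable_itv y x mn n_norm)) => //.
by apply: subset_itvr; rewrite bnd_simp.
Qed.

Lemma optical_depth_bounds x y : 0 <= x -> 0 <= y ->
  n0 * `|x - y| <= `|optical_depth n x - optical_depth n y| <= n1 * `|x - y|.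
Proof.
wlog yx : x y / y <= x.
  move=> h x0 y0; have [/h|/ltW/h] := leP y x; first exact.
  by rewrite distrC [X in _ <= X <= _]distrC; exact.
move=> x0 y0; rewrite -optical_depthB// (@ger0_norm _ (x - y)) ?subr_ge0//.
rewrite ger0_norm; last first.
  by apply: Rintegral_ge0 => z _; have /andP[h _] := n_bd z; rewrite (le_trans (ltW n0_gt0)).
have icst (c : R) : mu.-integrable `[y, x] (EFin \o cst c).
  exact: (@bounded_integrable_itv _ `|c|).
have cst_int (c : R) : \int[mu]_(z in `[y, x]) c = c * (x - y).
  by rewrite Rintegral_cst// lebesgue_itvcc.
have intn := bounded_integrable_itv y x mn n_norm.
apply/andP; split; rewrite -cst_int; apply: le_Rintegral => //; try exact: icst.
- by move=> z _; have /andP[] := n_bd z.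
- by move=> z _; have /andP[] := n_bd z.
Qed.

End bounded.

Lemma optical_depth0 (n : R -> R) : optical_depth n 0 = 0.
Proof. by rewrite /optical_depth set_itv1 Rintegral_set1. Qed.

Lemma measurable_optical_depth n : measurable_fun setT n ->
  measurable_fun setT (optical_depth n).
Proof.
move=> mn.
have -> : optical_depth n = (fun x => \int[mu]_z (if 0 <= z <= x then n z else 0)).
  apply/funext => x; rewrite /optical_depth Rintegral_mkcond.
  by apply: eq_Rintegral => z _; rewrite patchE mem_setE in_itv/=.
apply: (@measurable_fun_Rintegral _ _ _ _ R mu
  (fun z : measurableTypeR R * measurableTypeR R => if 0 <= z.2 <= z.1 then n z.2 else 0)).
apply: measurable_fun_ifT => //.
- apply: measurable_and; apply: measurable_fun_ler => //; exact: measurable_snd.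
- by apply: (measurableT_comp mn); exact: measurable_snd.
Qed.

Lemma optical_depth_lipschitz (n n' : R -> R) (n0 n1 D x y : R) :
  measurable_fun setT n -> measurable_fun setT n' -> 0 < n0 ->
  (forall z, n0 <= n z <= n1) -> (forall z, n0 <= n' z <= n1) ->
  (forall z, `|n z - n' z| <= D) -> 0 <= x -> 0 <= y ->
  `|(`|optical_depth n x - optical_depth n y|) -
    (`|optical_depth n' x - optical_depth n' y|)| <= D * `|x - y|.
Proof.
move=> mn mn' n00 hn hn' nn'.
wlog yx : x y / y <= x.
  move=> h x0 y0; have [/h|/ltW/h] := leP y x; first exact.
  rewrite (distrC (optical_depth n x)) (distrC (optical_depth n' x)) (distrC x); exact.
move=> x0 y0; apply: le_trans (ler_dist_dist _ _) _.
rewrite -(optical_depthB mn hn n00)// -(optical_depthB mn' hn' n00)//.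
have bnd u : (forall z, n0 <= u z <= n1) -> forall z : R, `|u z| <= n1.
  by move=> hu z; have /andP[h h'] := hu z; rewrite ger0_norm// (le_trans (ltW n00)).
have i1 := bounded_integrable_itv y x mn (bnd _ hn).
have i2 := bounded_integrable_itv y x mn' (bnd _ hn').
have mB : measurable_fun setT (fun z => n z - n' z) by exact: measurable_funB.
have i3 := bounded_integrable_itv y x mB nn'.
rewrite -RintegralB//; apply: le_trans (le_normr_Rintegral _ i3) _ => //.
rewrite (ger0_norm (_ : 0 <= x - y)) ?subr_ge0//.
rewrite -lebesgue_itvcc// -Rintegral_cst//; apply: le_Rintegral => //.
- exact: integrable_norm i3.
- by apply: (@bounded_integrable_itv _ `|D|).
Qed.



Lemma Rintegral_expR (b x y : R) : b != 0 -> x <= y ->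
  \int[mu]_(z in `[x, y]) expR (b * z) = (expR (b * y) - expR (b * x)) / b.
Proof.
move=> b0; rewrite le_eqVlt => /predU1P[->|xy].
  by rewrite set_itv1 Rintegral_set1 subrr mul0r.
have cb : continuous (fun z : R^o => expR (b * z)).
  move=> z; apply: continuous_comp; last exact: continuous_expR.
  by apply: continuousM => //; exact: cst_continuous.
pose F (z : R) : R := b^-1 * expR (b * z).
have cF : continuous (F : R^o -> R^o).
  move=> z; apply: (@continuousM _ R^o (fun=> b^-1) (fun z => expR (b * z))).
    exact: cst_continuous.
  exact: cb.
rewrite /Rintegral (@continuous_FTC2 _ _ F)//.
- by rewrite /= /F; field.
- exact: continuous_subspaceT.
- split.
  + by move=> z _; exact: ex_derive.
  + by apply: cvg_at_right_filter; exact: cF.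
  + by apply: cvg_at_left_filter; exact: cF.
- move=> z _; rewrite /F derive1Ml// derive1_comp// derive1E.
  have /funeqP -> := @derive_expR R.
  by rewrite derive1Ml// derive1_id mulr1 mulrCA mulVf// mulr1.
Qed.

End optical_depth.

(** * Estimates of the exponential kernel *)

Section exponential_kernel.
Context {R : realType}.
Local Notation mu := (@lebesgue_measure R).

Lemma measurable_exp_dist (k x : R) :
  measurable_fun setT (fun y : R => expR (- (k * `|x - y|))).
Proof.
apply: measurableT_comp => //; apply: measurableT_comp => //.
apply: measurable_funM => //; apply: measurableT_comp => //.
exact: measurable_funB.
Qed.

Lemma exp_dist_le1 (k x y : R) : 0 <= k -> `|expR (- (k * `|x - y|))| <= 1.
Proof.
move=> k0; rewrite ger0_norm ?expR_ge0//.
by rewrite -expR0 ler_expR oppr_le0 mulr_ge0.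
Qed.

(** The integrand is at most 1 on an interval of length 1, which gives A; each side of x contributes
    at most 1/(A k) to the integral, which gives 2/k. *)
Lemma exp_kernel_bound (A k x : R) : 0 <= A -> 0 < k -> 0 <= x <= 1 ->
  A * \int[mu]_(y in `[0, 1]) expR (- (A * k * `|x - y|)) <= Num.min A (2 / k).
Proof.
move=> A0 k0 /andP[x0 x1].
have Ak0 : 0 <= A * k by rewrite mulr_ge0// ltW.
have ii (u v : R) := bounded_integrable_itv u v (measurable_exp_dist (A * k) x)
  (fun y => exp_dist_le1 x y Ak0).
rewrite le_min; apply/andP; split.
  rewrite ler_piMr//.
  apply: (@le_trans _ _ (\int[mu]_(y in `[0, 1]) (1 : R))); last first.
    by rewrite Rintegral_cst// lebesgue_itvcc// subr0 mul1r.
  apply: le_Rintegral => //.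
    by apply: (@bounded_integrable_itv _ _ 1) => // y; rewrite normr1.
  by move=> y _; exact: le_trans (ler_norm _) (exp_dist_le1 x y Ak0).
(* The value A = 0 does occur: it is the absorption on the plane p_1 = 0, where the inverse of 0 is
   0. *)
move: A0; rewrite le_eqVlt => /predU1P[<-|A0]; first by rewrite mul0r divr_ge0// ltW.
have b0 : 0 < A * k by exact: mulr_gt0.
have iE (c u v : R) : mu.-integrable `[u, v] (EFin \o (fun z => expR (c * z))).
  apply: continuous_compact_integrable; first exact: segment_compact.
  apply: continuous_subspaceT => z; apply: continuous_comp; last exact: continuous_expR.
  by apply: (@continuousM _ R^o (fun=> c) id) => //; exact: cst_continuous.
have I1 : \int[mu]_(y in `[0, x]) expR (- (A * k * `|x - y|)) <= (A * k)^-1.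
  rewrite (@eq_Rintegral _ _ _ _ _ (fun y : measurableTypeR R =>
    expR (- (A * k * x)) * expR (A * k * y))); last first.
    move=> y; rewrite inE/= in_itv/= => /andP[y0 yx].
    rewrite ger0_norm ?subr_ge0// -expRD; congr expR; ring.
  rewrite RintegralZl// Rintegral_expR ?gt_eqF// mulr0 expR0.
  rewrite mulrA ler_piMl ?invr_ge0 ?(ltW b0)// mulrBr -expRD addNr expR0 mulr1.
  by rewrite gerBl expR_ge0.
have I2 : \int[mu]_(y in `[x, 1]) expR (- (A * k * `|x - y|)) <= (A * k)^-1.
  rewrite (@eq_Rintegral _ _ _ _ _ (fun y : measurableTypeR R =>
    expR (A * k * x) * expR (- (A * k) * y))); last first.
    move=> y; rewrite inE/= in_itv/= => /andP[xy y1].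
    rewrite distrC ger0_norm ?subr_ge0// -expRD; congr expR; ring.
  rewrite RintegralZl// Rintegral_expR// ?oppr_eq0 ?gt_eqF//.
  rewrite invrN mulrN -mulNr opprB mulrA ler_piMl ?invr_ge0 ?(ltW b0)//.
  rewrite mulrBr -!expRD mulNr subrr expR0.
  by rewrite gerBl expR_ge0.
have split01 : \int[mu]_(y in `[0, 1]) expR (- (A * k * `|x - y|)) =
   \int[mu]_(y in `[0, x]) expR (- (A * k * `|x - y|)) +
   \int[mu]_(y in `[x, 1]) expR (- (A * k * `|x - y|)).
  rewrite -(@Rintegral_itv_obnd_cbnd _ _ (BRight 1)); last first.
    apply: (integrableS _ _ _ (ii x 1)) => //.
    by apply: subset_itvr; rewrite bnd_simp.
  rewrite -(@Rintegral_itvB _ _ (BLeft 0) (BRight 1) x); [|exact: ii|..]; rewrite ?bnd_simp//.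
  by rewrite addrC subrK.
rewrite split01; apply: (@le_trans _ _ (A * ((A * k)^-1 + (A * k)^-1))).
  by rewrite ler_pM2l//; exact: lerD.
rewrite le_eqVlt; apply/orP; left; apply/eqP; field.
by rewrite !gt_eqF.
Qed.


End exponential_kernel.

Section kernel_estimates.
Context {R : realType}.

Lemma expRN_lipschitz (w u v : R) : w <= u -> w <= v ->
  `|expR (- u) - expR (- v)| <= expR (- w) * `|u - v|.
Proof.
wlog uv : u v / u <= v.
  move=> h wu wv; have [/h|/ltW/h] := leP u v; first exact.
  by rewrite (distrC (expR (- u))) (distrC u); exact.
move=> wu wv.
rewrite ger0_norm ?subr_ge0 ?ler_expR ?lerN2// distrC ger0_norm ?subr_ge0//.
have h := expR_subr_ge (- u) (- v).
have h' : expR (- u) <= expR (- w) by rewrite ler_expR lerN2.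
have := ler_wpM2r (_ : 0 <= v - u) h'; rewrite subr_ge0 => /(_ uv); lra.
Qed.

(** Let w = A n0 t / 2, so that both exponentials are at most e^(-2w). Varying the depth costs a
    factor A D t = (2/n0) D w, and w e^(-w) <= 1 absorbs w at the price of half the decay rate. The
    summands 2 n1/n0, 1 and n1 of the constant come from varying the depth, n and q. *)
Lemma kernel_lipschitz (A n0 n1 t h h' n n' q q' G D : R) :
  0 <= A -> 0 < n0 -> 0 <= t -> n0 * t <= h -> n0 * t <= h' -> `|h - h'| <= D * t ->
  0 <= n <= n1 -> 0 <= n' <= n1 -> `|n - n'| <= D ->
  0 <= q <= G -> 0 <= q' <= G -> `|q - q'| <= D * G ->
  `|expR (- (A * h)) * n * q - expR (- (A * h')) * n' * q'| <=
  D * (2 * n1 / n0 + 1 + n1) * G * expR (- (A * (n0 / 2) * t)).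
Proof.
move=> A0 n00 t0 hh hh' dh /andP[nge nle] /andP[nge' nle'] dn /andP[qge qle]
  /andP[qge' qle'] dq.
have D0 : 0 <= D by exact: le_trans dn.
have G0 : 0 <= G by exact: le_trans qle.
have n10 : 0 <= n1 by exact: le_trans nle.
set w := A * (n0 / 2) * t.
have w0 : 0 <= w by rewrite !mulr_ge0// ltW// invr_gt0.
have ww u : n0 * t <= u -> 2 * w <= A * u.
  move=> hu; rewrite (_ : 2 * w = A * (n0 * t)); last by rewrite /w; field.
  by rewrite ler_wpM2l.
set E := expR (- w).
have E0 : 0 <= E by exact: expR_ge0.
have de : `|expR (- (A * h)) - expR (- (A * h'))| <= (2 / n0) * D * E.
  apply: le_trans (expRN_lipschitz (ww _ hh) (ww _ hh')) _.
  rewrite -mulrBr normrM (ger0_norm A0).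
  apply: (@le_trans _ _ (expR (- (2 * w)) * (A * (D * t)))).
    by rewrite ler_wpM2l ?expR_ge0// ler_wpM2l.
  rewrite (_ : A * (D * t) = (2 / n0) * D * w); last first.
    by rewrite /w; field; rewrite gt_eqF.
  rewrite (_ : _ * (2 / n0 * D * w) = 2 / n0 * D * (E * (E * w))); last first.
    rewrite (_ : - (2 * w) = - w + - w); last by ring.
    by rewrite expRD /E; ring.
  have cD : 0 <= 2 / n0 * D by apply: mulr_ge0 => //; apply: divr_ge0 => //; exact: ltW.
  apply: ler_wpM2l => //; rewrite ler_piMr//.
  rewrite /E expRN mulrC ler_pdivrMr ?expR_gt0// mul1r.
  by apply: le_trans (expR_ge1Dx w); rewrite lerDr.
have e'E : expR (- (A * h')) <= E.
  by rewrite ler_expR lerN2; apply: le_trans (ww _ hh'); rewrite ler_peMl// ler1n.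
rewrite (_ : _ - _ = (expR (- (A * h)) - expR (- (A * h'))) * (n * q) +
  expR (- (A * h')) * ((n - n') * q + n' * (q - q'))); last by ring.
apply: le_trans (ler_normD _ _) _.
rewrite (_ : D * _ * G * _ = (2 / n0) * D * E * (n1 * G) + E * (D * G + n1 * (D * G))); last first.
  by field; rewrite gt_eqF.
apply: lerD; rewrite normrM.
  apply: ler_pM => //; rewrite ger0_norm ?mulr_ge0//; exact: ler_pM.
apply: ler_pM => //; first by rewrite ger0_norm ?expR_ge0.
apply: le_trans (ler_normD _ _) _; rewrite !normrM.
rewrite (ger0_norm qge) (ger0_norm nge').
by apply: lerD; exact: ler_pM.
Qed.

End kernel_estimates.

(** * Gain and loss terms *)

Section transport.
Context {R : realType} (K : statistics).
Local Notation mu := (@lebesgue_measure R).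
Local Notation mu3 := (lebesgue3 R).
Local Notation RT := (measurableTypeR R).
Implicit Types (m : R -> moment -> R) (p : R3 R).

Variables (tau : R) (phi : R3 R -> R).

Definition absorption p : R := (tau * `|p.1|)^-1.

Definition upstream p (x y : R) : bool := if 0 < p.1 then y <= x else x <= y.

Definition entry_depth (n : R -> R) p x : R :=
  if 0 < p.1 then optical_depth n x else optical_depth n 1 - optical_depth n x.

(** Extension by 0 off the upstream side puts both directions of flight on the fixed interval
    [0, 1], and the absolute value gives them the same formula for the depth. *)
Definition gain_integrand m x p y : R :=
  if upstream p x y then
    expR (- (absorption p *
      `|optical_depth (m^~ Mass) x - optical_depth (m^~ Mass) y|)) *
      m y Mass * state_eq K (m y) p
  else 0.

Definition gain m x p : R :=
  absorption p * \int[mu]_(y in `[0, 1]) gain_integrand m x p y.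

Definition loss m x p : R := expR (- (absorption p * entry_depth (m^~ Mass) p x)) * phi p.

(** Clamping x makes every bound hold at all real x, so that admissibility and the sup distance need
    no restriction to [0, 1]. *)
Definition transport m x p : R := loss m (clamp 0 1 x) p + gain m (clamp 0 1 x) p.

Hypothesis tau_gt0 : 0 < tau.
Hypothesis phi_ge0 : forall p, 0 <= phi p.
Hypothesis mphi : measurable_fun setT phi.

Lemma absorption_ge0 p : 0 <= absorption p.
Proof. by rewrite invr_ge0 mulr_ge0// ltW. Qed.

Lemma measurable_absorption : measurable_fun setT absorption.
Proof.
apply: measurable_invr; apply: measurable_funM => //.
by apply: measurableT_comp => //; exact: measurable_fst.
Qed.

Variables n0 n1 e1 k : R.
Hypothesis n0_gt0 : 0 < n0.
Hypothesis n1_gt0 : 0 < n1.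
Hypothesis e1_gt0 : 0 < e1.
Hypothesis k_gt0 : 0 < k.
Hypothesis ratio : n1 `^ (8 / 5) / k `^ (3 / 5) < beta K (beta_min K).
Local Notation ok := (state_ok n0 n1 e1 k).

Definition admissible m := (forall i, measurable_fun setT (fun y => m y i)) /\
  forall y, ok (m y).

Lemma admissible_mass m : admissible m -> forall x, n0 <= m x Mass <= n1.
Proof. by move=> [_ okm] x; have [] := okm x. Qed.

Lemma measurable_gain_integrand m : admissible m ->
  measurable_fun setT (fun z : (RT * R3 R) * RT => gain_integrand m z.1.1 z.1.2 z.2).
Proof.
move=> [mm okm].
have mH := measurable_optical_depth (mm Mass).
have mx : measurable_fun setT (fun z : (RT * R3 R) * RT => z.1.1).
  by apply: measurableT_comp; [exact: measurable_fst|exact: measurable_fst].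
have mp : measurable_fun setT (fun z : (RT * R3 R) * RT => z.1.2).
  by apply: measurableT_comp; [exact: measurable_snd|exact: measurable_fst].
have my : measurable_fun setT (fun z : (RT * R3 R) * RT => z.2) by exact: measurable_snd.
have mp1 : measurable_fun setT (fun z : (RT * R3 R) * RT => z.1.2.1).
  by apply: measurableT_comp mp; exact: measurable_fst.
apply: measurable_fun_ifT => //.
  apply: measurable_fun_ifT; [|exact: measurable_fun_ler|exact: measurable_fun_ler].
  exact: measurable_fun_ltr.
apply: measurable_funM; last first.
  have mpair : measurable_fun setT (fun z : (RT * R3 R) * RT => (z.2, z.1.2) : RT * R3 R).
    exact/measurable_fun_prod.
  exact: (measurableT_comp
    (measurable_state_eq n0_gt0 n1_gt0 e1_gt0 k_gt0 ratio mm okm) mpair).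
apply: measurable_funM; last exact: (measurableT_comp (mm Mass) my).
apply: measurableT_comp => //; apply: measurableT_comp => //.
apply: measurable_funM; first exact: (measurableT_comp measurable_absorption mp).
apply: measurableT_comp => //; apply: measurable_funB.
- exact: (measurableT_comp mH mx).
- exact: (measurableT_comp mH my).
Qed.

End transport.

Section transport_estimates.
Context {R : realType} (K : statistics).
Local Notation mu := (@lebesgue_measure R).
Local Notation mu3 := (lebesgue3 R).
Local Notation RT := (measurableTypeR R).
Implicit Types (m : R -> moment -> R) (p : R3 R).

Variables (tau : R) (phi : R3 R -> R).
Hypothesis tau_gt0 : 0 < tau.
Hypothesis phi_ge0 : forall p, 0 <= phi p.
Hypothesis mphi : measurable_fun setT phi.

Variables n0 n1 e1 k : R.
Hypothesis n0_gt0 : 0 < n0.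
Hypothesis n1_gt0 : 0 < n1.
Hypothesis e1_gt0 : 0 < e1.
Hypothesis k_gt0 : 0 < k.
Hypothesis ratio : n1 `^ (8 / 5) / k `^ (3 / 5) < beta K (beta_min K).
Local Notation ok := (state_ok n0 n1 e1 k).
Local Notation admissible := (admissible n0 n1 e1 k).

Variables C b : R.
Hypothesis C_gt0 : 0 < C.
Hypothesis b_gt0 : 0 < b.
Hypothesis state_eq_bound : forall s, ok s -> forall p,
  0 <= state_eq K s p <= C * expR (- (b * sqnorm p)).
Hypothesis state_eq_lip : forall s s' (D : R), ok s -> ok s' ->
  state_dist_le D s s' -> forall p,
  `|state_eq K s p - state_eq K s' p| <= C * D * expR (- (b * sqnorm p)).

Local Notation A := (absorption tau).

Definition envelope p : R := C * expR (- (b * sqnorm p)).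
(** The value 4/n0 is 2/k from [exp_kernel_bound] at k = n0/2: half of the decay rate n0 is given
    away in the Lipschitz estimate of the kernel. *)
Definition weight p : R := Num.min (A p) (4 / n0).

Definition moments_dist_le (D : R) m m' := forall y, state_dist_le D (m y) (m' y).

Lemma envelope_ge0 p : 0 <= envelope p.
Proof. by rewrite mulr_ge0 ?expR_ge0 ?ltW. Qed.

Lemma weight_ge0 p : 0 <= weight p.
Proof. by rewrite le_min absorption_ge0// divr_ge0 ?ltW. Qed.

Lemma admissible_depth m x y : admissible m -> 0 <= x -> 0 <= y ->
  n0 * `|x - y| <=
  `|optical_depth (m^~ Mass) x - optical_depth (m^~ Mass) y| <= n1 * `|x - y|.
Proof.
move=> adm; apply: optical_depth_bounds => //; first by case: adm.
exact: admissible_mass adm.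
Qed.

Lemma admissible_depth_lip m m' D x y : admissible m -> admissible m' ->
  moments_dist_le D m m' -> 0 <= x -> 0 <= y ->
  `|(`|optical_depth (m^~ Mass) x - optical_depth (m^~ Mass) y|) -
    (`|optical_depth (m'^~ Mass) x - optical_depth (m'^~ Mass) y|)| <= D * `|x - y|.
Proof.
move=> adm adm' mm'; apply: (optical_depth_lipschitz _ _ n0_gt0 (n1 := n1)).
- by case: adm.
- by case: adm'.
- exact: admissible_mass adm.
- exact: admissible_mass adm'.
- by move=> z; exact: mm'.
Qed.

Lemma gain_integrand_le m x p y : admissible m ->
  0 <= gain_integrand K tau m x p y <= n1 * envelope p.
Proof.
move=> adm; rewrite /gain_integrand; case: (upstream p x y); last first.
  by rewrite lexx mulr_ge0 ?envelope_ge0// ltW.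
have /andP[h1 h2] := admissible_mass adm y.
have mge := le_trans (ltW n0_gt0) h1.
have /andP[q0 q1] := state_eq_bound (adm.2 y) p.
set E := expR _.
have E0 : 0 <= E by exact: expR_ge0.
have E1 : E <= 1.
  by rewrite /E -expR0 ler_expR oppr_le0 mulr_ge0// absorption_ge0.
apply/andP; split; first by rewrite !mulr_ge0.
apply: ler_pM => //; first exact: mulr_ge0.
by rewrite -[leRHS]mul1r; apply: ler_pM.
Qed.

(** Half of the available decay rate n0 is dropped on purpose, so that one weight serves both the
    size of the gain and its Lipschitz constant. *)
Lemma gain_integrand_bound m x p y : admissible m -> 0 <= x -> 0 <= y ->
  gain_integrand K tau m x p y <=
  n1 * envelope p * expR (- (A p * (n0 / 2) * `|x - y|)).
Proof.
move=> adm x0 y0; rewrite /gain_integrand; case: (upstream p x y); last first.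
  by rewrite !mulr_ge0 ?envelope_ge0 ?expR_ge0// ltW.
have /andP[h1 h2] := admissible_mass adm y.
have mge := le_trans (ltW n0_gt0) h1.
have /andP[q0 q1] := state_eq_bound (adm.2 y) p.
have /andP[d0 _] := admissible_depth adm x0 y0.
rewrite -mulrA [leRHS]mulrC; apply: ler_pM => //.
- exact: mulr_ge0.
- rewrite ler_expR lerN2 -mulrA ler_wpM2l ?absorption_ge0//.
  apply: le_trans d0; rewrite ler_wpM2r// ler_pdivrMr// ler_peMr ?(ltW n0_gt0)//.
  by rewrite ler1n.
- exact: ler_pM.
Qed.

Definition gain_const : R := 2 * n1 / n0 + 1 + n1.

Lemma gain_const_ge0 : 0 <= gain_const.
Proof. by rewrite !addr_ge0 ?mulr_ge0 ?invr_ge0 ?ltW. Qed.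

Lemma gain_integrand_lip m m' D x p y : admissible m -> admissible m' ->
  moments_dist_le D m m' -> 0 <= x -> 0 <= y ->
  `|gain_integrand K tau m x p y - gain_integrand K tau m' x p y| <=
  D * gain_const * envelope p * expR (- (A p * (n0 / 2) * `|x - y|)).
Proof.
move=> adm adm' mm' x0 y0.
have D0 : 0 <= D by exact: le_trans (mm' 0 Mass).
rewrite /gain_integrand; case: (upstream p x y); last first.
  rewrite subrr normr0.
  by apply: mulr_ge0 (expR_ge0 _); apply: mulr_ge0 (envelope_ge0 p); exact: mulr_ge0 gain_const_ge0.
have /andP[d0 _] := admissible_depth adm x0 y0.
have /andP[d0' _] := admissible_depth adm' x0 y0.
have /andP[h1 h2] := admissible_mass adm y.
have /andP[h1' h2'] := admissible_mass adm' y.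
apply: kernel_lipschitz => //.
- exact: absorption_ge0.
- exact: admissible_depth_lip.
- by rewrite h2 (le_trans (ltW n0_gt0)).
- by rewrite h2' (le_trans (ltW n0_gt0)).
- exact: mm'.
- exact: state_eq_bound (adm.2 y) p.
- exact: state_eq_bound (adm'.2 y) p.
- rewrite /envelope mulrA [D * C]mulrC; apply: state_eq_lip => //.
  + exact: adm.2.
  + exact: adm'.2.
Qed.

Lemma integrable_gain_integrand m x p : admissible m ->
  mu.-integrable `[0, 1] (EFin \o gain_integrand K tau m x p).
Proof.
move=> adm; apply: (@bounded_integrable_itv _ _ (n1 * envelope p)).
  have mp : measurable_fun setT (fun y : RT => ((x, p), y) : (RT * R3 R) * RT).
    by apply/measurable_fun_prod.
  exact: (measurableT_comp
    (measurable_gain_integrand tau n0_gt0 n1_gt0 e1_gt0 k_gt0 ratio adm) mp).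
by move=> y; have /andP[h1 h2] := gain_integrand_le x p y adm; rewrite ger0_norm.
Qed.

Lemma exp_kernel_weight x p : 0 <= x <= 1 ->
  A p * \int[mu]_(y in `[0, 1]) expR (- (A p * (n0 / 2) * `|x - y|)) <= weight p.
Proof.
move=> x01; have n20 : 0 < n0 / 2 by rewrite divr_gt0.
apply: le_trans (exp_kernel_bound (absorption_ge0 tau_gt0 p) n20 x01) _.
by rewrite /weight (_ : 2 / (n0 / 2) = 4 / n0)//; field; rewrite gt_eqF.
Qed.

Lemma integrable_exp_kernel c x p :
  mu.-integrable `[0, 1] (EFin \o (fun y => c * expR (- (A p * (n0 / 2) * `|x - y|)))).
Proof.
apply: (@bounded_integrable_itv _ _ `|c|).
  by apply: measurable_funM => //; exact: measurable_exp_dist.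
move=> y; rewrite normrM ler_piMr//; apply: exp_dist_le1.
by rewrite mulr_ge0 ?absorption_ge0// divr_ge0// ltW.
Qed.

Lemma Rintegral_exp_kernelZ c x p :
  \int[mu]_(y in `[0, 1]) (c * expR (- (A p * (n0 / 2) * `|x - y|))) =
  c * \int[mu]_(y in `[0, 1]) expR (- (A p * (n0 / 2) * `|x - y|)).
Proof.
rewrite RintegralZl//.
by apply: eq_integrable (integrable_exp_kernel 1 x p) => // y _ /=; rewrite mul1r.
Qed.

Lemma gain_ge0 m x p : admissible m -> 0 <= gain K tau m x p.
Proof.
move=> adm; rewrite mulr_ge0 ?absorption_ge0//; apply: Rintegral_ge0 => y _.
by have /andP[] := gain_integrand_le x p y adm.
Qed.

Lemma gain_bound m x p : admissible m -> 0 <= x <= 1 ->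
  gain K tau m x p <= n1 * (envelope p * weight p).
Proof.
move=> adm x01; have /andP[x0 x1] := x01.
rewrite mulrA; apply: le_trans (ler_wpM2l _ (exp_kernel_weight p x01)); last first.
  by rewrite mulr_ge0 ?envelope_ge0// ltW.
rewrite mulrCA ler_wpM2l ?absorption_ge0// -Rintegral_exp_kernelZ.
apply: le_Rintegral => //.
- exact: integrable_gain_integrand.
- exact: integrable_exp_kernel.
- move=> y /=; rewrite in_itv/= => /andP[y0 _]; exact: gain_integrand_bound.
Qed.

Lemma gain_lip m m' D x p : admissible m -> admissible m' ->
  moments_dist_le D m m' -> 0 <= x <= 1 ->
  `|gain K tau m x p - gain K tau m' x p| <=
  D * (gain_const * (envelope p * weight p)).
Proof.
move=> adm adm' mm' x01; have /andP[x0 x1] := x01.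
have D0 : 0 <= D by exact: le_trans (mm' 0 Mass).
have i1 := integrable_gain_integrand x p adm.
have i2 := integrable_gain_integrand x p adm'.
have mI : measurable (`[0, 1]%classic : set RT) by exact: measurable_itv.
have i3 : mu.-integrable `[0, 1]
    (EFin \o (fun y => gain_integrand K tau m x p y - gain_integrand K tau m' x p y)).
  by apply: eq_integrable (integrableB mI i1 i2).
rewrite 2!mulrA; apply: le_trans (ler_wpM2l _ (exp_kernel_weight p x01)); last first.
  by apply: mulr_ge0 (envelope_ge0 p); exact: mulr_ge0 gain_const_ge0.
rewrite -mulrBr normrM ger0_norm ?absorption_ge0//.
rewrite [leRHS]mulrCA; apply: (ler_wpM2l (absorption_ge0 tau_gt0 p)).
rewrite -Rintegral_exp_kernelZ -(RintegralB mI i1 i2).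
apply: le_trans (le_normr_Rintegral _ i3) _ => //.
apply: le_Rintegral => //.
- exact: (integrable_norm i3).
- exact: integrable_exp_kernel.
- move=> y /=; rewrite in_itv/= => /andP[y0 _]; exact: gain_integrand_lip.
Qed.

(** Written as distances between two depths, both directions of flight fall under the same
    estimates. *)
Lemma entry_depthE m p x : admissible m -> 0 <= x <= 1 ->
  entry_depth (m^~ Mass) p x =
  if 0 < p.1 then `|optical_depth (m^~ Mass) x - optical_depth (m^~ Mass) 0|
  else `|optical_depth (m^~ Mass) 1 - optical_depth (m^~ Mass) x|.
Proof.
move=> adm /andP[x0 x1]; rewrite /entry_depth optical_depth0 subr0.
have ge0 u v : 0 <= u -> u <= v ->
    0 <= optical_depth (m^~ Mass) v - optical_depth (m^~ Mass) u.
  move=> u0 uv; rewrite -(optical_depthB (adm.1 Mass) (admissible_mass adm) n0_gt0)//.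
  by apply: Rintegral_ge0 => z _; have /andP[h _] := admissible_mass adm z;
    exact: le_trans (ltW n0_gt0) h.
case: ifPn => _; last by rewrite ger0_norm// ge0.
by have := ge0 0 x (lexx _) x0; rewrite optical_depth0 subr0 => /ger0_norm.
Qed.

Lemma entry_depth_bounds m p x : admissible m -> 0 <= x <= 1 ->
  0 <= entry_depth (m^~ Mass) p x <= n1.
Proof.
move=> adm x01; have /andP[x0 x1] := x01; rewrite entry_depthE//.
have n1u (u : R) : 0 <= u <= 1 -> n1 * `|u| <= n1.
  by move=> /andP[u0 u1]; rewrite ger0_norm// ler_piMr// ltW.
case: ifPn => _; rewrite normr_ge0/=.
  have /andP[_ h] := admissible_depth adm x0 (lexx 0).
  by apply: le_trans h _; apply: n1u; rewrite subr0.
have /andP[_ h] := admissible_depth adm ler01 x0.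
by apply: le_trans h _; apply: n1u; rewrite subr_ge0 x1 lerBlDr lerDl.
Qed.

Lemma entry_depth_lip m m' D p x : admissible m -> admissible m' ->
  moments_dist_le D m m' -> 0 <= x <= 1 ->
  `|entry_depth (m^~ Mass) p x - entry_depth (m'^~ Mass) p x| <= D.
Proof.
move=> adm adm' mm' x01; have /andP[x0 x1] := x01; rewrite !entry_depthE//.
have D0 : 0 <= D by exact: le_trans (mm' 0 Mass).
have Du (u : R) : 0 <= u <= 1 -> D * `|u| <= D.
  by move=> /andP[u0 u1]; rewrite ger0_norm// ler_piMr.
case: ifPn => _.
  apply: le_trans (admissible_depth_lip adm adm' mm' x0 (lexx 0)) _.
  by apply: Du; rewrite subr0.
apply: le_trans (admissible_depth_lip adm adm' mm' ler01 x0) _.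
by apply: Du; rewrite subr_ge0 x1 lerBlDr lerDl.
Qed.

Lemma loss_bounds m x p : admissible m -> 0 <= x <= 1 ->
  expR (- (A p * n1)) * phi p <= loss tau phi m x p <= phi p.
Proof.
move=> adm x01; have /andP[h0 h1] := entry_depth_bounds p adm x01.
have A0 := absorption_ge0 tau_gt0 p.
apply/andP; split.
  by rewrite ler_wpM2r// ler_expR lerN2 ler_wpM2l.
by rewrite ler_piMl// -expR0 ler_expR oppr_le0 mulr_ge0.
Qed.

(** The derivative of the exponential in the depth brings down the absorption 1/(tau |p_1|). It is
    not absorbed here: the integrability of f_LR / |p_1| takes care of it, and 1/tau makes it
    small. *)
Lemma loss_lip m m' D x p : admissible m -> admissible m' ->
  moments_dist_le D m m' -> 0 <= x <= 1 ->
  `|loss tau phi m x p - loss tau phi m' x p| <= D * (A p * phi p).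
Proof.
move=> adm adm' mm' x01.
have A0 := absorption_ge0 tau_gt0 p.
have /andP[h0 _] := entry_depth_bounds p adm x01.
have /andP[h0' _] := entry_depth_bounds p adm' x01.
rewrite -mulrBl normrM (ger0_norm (phi_ge0 p)) mulrA ler_wpM2r//.
apply: le_trans (@expRN_lipschitz _ 0 _ _ _ _) _; rewrite ?mulr_ge0//.
rewrite oppr0 expR0 mul1r -mulrBr normrM ger0_norm// mulrC ler_wpM2r//.
exact: entry_depth_lip.
Qed.

Lemma measurable_transport m : admissible m ->
  measurable_fun setT (fun z : RT * R3 R => transport K tau phi m z.1 z.2).
Proof.
move=> adm; have mH := measurable_optical_depth (adm.1 Mass).
have mx : measurable_fun setT (fun z : RT * R3 R => clamp 0 1 z.1 : RT).
  apply: measurableT_comp; last exact: measurable_fst.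
  apply: continuous_measurable_fun; exact: clamp_continuous.
have mp : measurable_fun setT (fun z : RT * R3 R => z.2) by exact: measurable_snd.
have mA : measurable_fun setT (fun z : RT * R3 R => A z.2).
  exact: (measurableT_comp (measurable_absorption tau) mp).
have mHx := measurableT_comp mH mx.
apply: measurable_funD; apply: measurable_funM => //.
- apply: measurableT_comp => //; apply: measurableT_comp => //; apply: measurable_funM => //.
  apply: measurable_fun_ifT => //; last exact: measurable_funB.
  apply: measurable_fun_ltr => //.
  by apply: measurableT_comp mp; exact: measurable_fst.
- exact: (measurableT_comp mphi mp).
have mpair : measurable_fun setT (fun z : (RT * R3 R) * RT =>
    ((clamp 0 1 z.1.1, z.1.2), z.2) : (RT * R3 R) * RT).
  apply/measurable_fun_prod; last exact: measurable_snd.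
  apply/measurable_fun_prod.
    exact: (measurableT_comp mx measurable_fst).
  exact: (measurableT_comp mp measurable_fst).
have mgi := measurableT_comp
  (measurable_gain_integrand tau n0_gt0 n1_gt0 e1_gt0 k_gt0 ratio adm) mpair.
(* The domain [0, 1] moves into the integrand as a condition, so that joint measurability on the
   full product applies. *)
have := @measurable_fun_Rintegral _ _ _ _ R mu
  (fun z : (RT * R3 R) * RT => if 0 <= z.2 <= 1
     then gain_integrand K tau m (clamp 0 1 z.1.1) z.1.2 z.2 else 0).
have mif : measurable_fun setT (fun z : (RT * R3 R) * RT => if 0 <= z.2 <= 1
     then gain_integrand K tau m (clamp 0 1 z.1.1) z.1.2 z.2 else 0).
  apply: measurable_fun_ifT => //.
  by apply: measurable_and; apply: measurable_fun_ler => //; exact: measurable_snd.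
move=> /(_ mif); apply: eq_measurable_fun => z _.
rewrite [RHS]Rintegral_mkcond; apply: eq_Rintegral => y _.
by rewrite patchE mem_setE in_itv.
Qed.

End transport_estimates.

(** * Moments of the transported distribution *)

Definition moment_weight {R : realType} (i : moment) (p : R3 R) : R :=
  match i with
  | Mass => 1
  | Mom1 => p.1
  | Mom2 => p.2.1
  | Mom3 => p.2.2
  | Energy => sqnorm p
  end.

Section moment_weight.
Context {R : realType}.
Local Notation mu3 := (lebesgue3 R).

Lemma state_ofE f x i :
  state_of f x i = \int[mu3]_p (f x p * moment_weight i p).
Proof. by case: i => //=; apply: eq_Rintegral => p _; rewrite mulr1. Qed.

Lemma moment_weight_le i (p : R3 R) : `|moment_weight i p| <= 1 + sqnorm p.
Proof.
have abs (x r : R) : x ^+ 2 <= r -> `|x| <= 1 + r.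
  move=> xr; have := sqr_ge0 (`|x| - 1); have := sqr_ge0 `|x|.
  move: xr; rewrite -[x ^+ 2]real_normK ?num_real// !expr2 => *; lra.
have := sqr_ge0 p.1; have := sqr_ge0 p.2.1; have := sqr_ge0 p.2.2 => h3 h2 h1.
case: i => /=; try by apply: abs; rewrite /sqnorm; lra.
- by rewrite normr1 sqnorm1_ge1.
- by rewrite ger0_norm ?sqnorm_ge0// lerDr.
Qed.

Lemma measurable_moment_weight i : measurable_fun setT (@moment_weight R i).
Proof.
case: i => /=.
- exact: measurable_cst.
- exact: measurable_fst.
- by apply: measurableT_comp => //; exact: measurable_snd.
- by apply: measurableT_comp => //; exact: measurable_snd.
- exact: measurable_sqnorm.
Qed.

Lemma integrable_moment (f : R3 R -> R) i : measurable_fun setT f ->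
  mu3.-integrable setT (EFin \o (fun p => `|f p| * (1 + sqnorm p))) ->
  mu3.-integrable setT (EFin \o (fun p => f p * moment_weight i p)).
Proof.
move=> mf fi; apply: integrable_dominated fi _.
  by apply: measurable_funM => //; exact: measurable_moment_weight.
by move=> p; rewrite normrM ler_wpM2l// moment_weight_le.
Qed.

End moment_weight.

Section moment_operator.
Context {R : realType} (K : statistics).
Local Notation mu3 := (lebesgue3 R).
Local Notation RT := (measurableTypeR R).
Implicit Types (m : R -> moment -> R) (p : R3 R).

Variables (tau : R) (phi : R3 R -> R).
Hypothesis tau_gt0 : 0 < tau.
Hypothesis phi_ge0 : forall p, 0 <= phi p.
Hypothesis mphi : measurable_fun setT phi.
Hypothesis phi_int : mu3.-integrable setT (EFin \o (fun p => phi p * (1 + sqnorm p))).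
Hypothesis phi_int_inv :
  mu3.-integrable setT (EFin \o (fun p => `|p.1|^-1 * phi p * (1 + sqnorm p))).

Variables n0 n1 e1 k : R.
Hypothesis n0_gt0 : 0 < n0.
Hypothesis n1_gt0 : 0 < n1.
Hypothesis e1_gt0 : 0 < e1.
Hypothesis k_gt0 : 0 < k.
Hypothesis ratio : n1 `^ (8 / 5) / k `^ (3 / 5) < beta K (beta_min K).
Local Notation ok := (state_ok n0 n1 e1 k).
Local Notation admissible := (admissible n0 n1 e1 k).

Variables C b : R.
Hypothesis C_gt0 : 0 < C.
Hypothesis b_gt0 : 0 < b.
Hypothesis state_eq_bound : forall s, ok s -> forall p,
  0 <= state_eq K s p <= C * expR (- (b * sqnorm p)).
Hypothesis state_eq_lip : forall s s' (D : R), ok s -> ok s' ->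
  state_dist_le D s s' -> forall p,
  `|state_eq K s p - state_eq K s' p| <= C * D * expR (- (b * sqnorm p)).

Local Notation F := (transport K tau phi).
Local Notation env := (envelope C b).
Local Notation wt := (weight tau n0).

Definition moment_op m x i : R := \int[mu3]_p (F m x p * moment_weight i p).

Definition weight_integral : R := \int[mu3]_p ((1 + sqnorm p) * (env p * wt p)).
Definition inverse_integral : R := \int[mu3]_p (`|p.1|^-1 * phi p * (1 + sqnorm p)).

Lemma clamp01 x : 0 <= clamp (0 : R) 1 x <= 1.
Proof. exact: clamp_bounds. Qed.

Lemma measurable_env_weight : measurable_fun setT (fun p => env p * wt p).
Proof.
apply: measurable_funM.
  by apply: measurable_funM => //; exact: measurable_gauss3.
by apply: measurable_minr => //; exact: measurable_absorption.
Qed.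

Lemma integrable_env_weight :
  mu3.-integrable setT (EFin \o (fun p => (1 + sqnorm p) * (env p * wt p))).
Proof.
apply: integrable_dominated
  (integrable_scaler (C * (4 / n0)) (integrable_gauss3_poly 1 b_gt0)) _.
  apply: measurable_funM; last exact: measurable_env_weight.
  by apply: measurable_funD => //; exact: measurable_sqnorm.
move=> p; have s1 := sqnorm1_ge0 p.
have w0 := weight_ge0 tau_gt0 n0_gt0 p; have e0 := envelope_ge0 b C_gt0 p.
have P0 : 0 <= (1 + sqnorm p) * (env p * wt p).
  by apply: mulr_ge0 s1 _; exact: mulr_ge0.
rewrite (ger0_norm P0) expr1.
have -> : C * (4 / n0) * ((1 + sqnorm p) * expR (- (b * sqnorm p))) =
  (1 + sqnorm p) * (env p * (4 / n0)) by rewrite /envelope; ring.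
by rewrite ler_wpM2l// ler_wpM2l// ge_min lexx orbT.
Qed.

Lemma measurable_transport_at m x : admissible m -> measurable_fun setT (F m x).
Proof.
move=> adm.
have mF : measurable_fun setT (fun z : RT * R3 R => F m z.1 z.2).
  exact: (measurable_transport tau mphi n0_gt0 n1_gt0 e1_gt0 k_gt0 ratio adm).
have mp : measurable_fun setT (fun p : R3 R => (x, p) : RT * R3 R).
  by apply/measurable_fun_prod.
exact: (measurableT_comp mF mp).
Qed.

(** The lower bound discards the gain; at n1 = a_u it is the damped boundary data that enters a_l,
    c_l and k. *)
Lemma transport_bounds m x p : admissible m ->
  expR (- (absorption tau p * n1)) * phi p <= F m x p <= phi p + n1 * (env p * wt p).
Proof.
move=> adm; have x01 := clamp01 x.
have /andP[l0 l1] : expR (- (absorption tau p * n1)) * phi p <=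
    loss tau phi m (clamp 0 1 x) p <= phi p.
  exact: (loss_bounds tau_gt0 phi_ge0 n0_gt0 n1_gt0 p adm x01).
have g0 : 0 <= gain K tau m (clamp 0 1 x) p.
  exact: (gain_ge0 tau_gt0 n0_gt0 n1_gt0 C_gt0 state_eq_bound _ p adm).
have g1 : gain K tau m (clamp 0 1 x) p <= n1 * (env p * wt p).
  exact: (gain_bound tau_gt0 n0_gt0 n1_gt0 e1_gt0 k_gt0 ratio C_gt0
    state_eq_bound p adm x01).
by apply/andP; split; [rewrite -[leLHS]addr0|]; exact: lerD.
Qed.

Lemma transport_ge0 m x p : admissible m -> 0 <= F m x p.
Proof.
move=> adm; have /andP[h _] := transport_bounds x p adm.
by apply: le_trans h; rewrite mulr_ge0 ?expR_ge0.
Qed.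

Lemma integrable_transport m x : admissible m ->
  mu3.-integrable setT (EFin \o (fun p => `|F m x p| * (1 + sqnorm p))).
Proof.
move=> adm; apply: integrable_dominated
  (integrable_addr phi_int (integrable_scaler n1 integrable_env_weight)) _.
  apply: measurable_funM.
    by apply: measurableT_comp => //; exact: measurable_transport_at.
  by apply: measurable_funD => //; exact: measurable_sqnorm.
move=> p; have /andP[_ h] := transport_bounds x p adm.
have s1 := sqnorm1_ge0 p; have F0 := transport_ge0 x p adm.
rewrite normrM normr_id !ger0_norm//.
rewrite (_ : n1 * ((1 + sqnorm p) * _) = n1 * (env p * wt p) * (1 + sqnorm p)); last by ring.
by rewrite -mulrDl ler_wpM2r.
Qed.

Lemma transport_lip m m' D x p : admissible m -> admissible m' ->
  moments_dist_le D m m' ->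
  `|F m x p - F m' x p| <=
  D * (tau^-1 * (`|p.1|^-1 * phi p) + gain_const n0 n1 * (env p * wt p)).
Proof.
move=> adm adm' mm'; have x01 := clamp01 x.
rewrite /transport opprD addrACA; apply: le_trans (ler_normD _ _) _.
rewrite mulrDr; apply: lerD.
  have -> : tau^-1 * (`|p.1|^-1 * phi p) = absorption tau p * phi p.
    by rewrite mulrA -invfM.
  exact: (loss_lip tau_gt0 phi_ge0 n0_gt0 n1_gt0 p adm adm' mm' x01).
exact: (gain_lip tau_gt0 n0_gt0 n1_gt0 e1_gt0 k_gt0 ratio C_gt0
  state_eq_bound state_eq_lip p adm adm' mm' x01).
Qed.

Lemma moment_op_lip m m' D x i : admissible m -> admissible m' ->
  moments_dist_le D m m' ->
  `|moment_op m x i - moment_op m' x i| <=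
  D * (tau^-1 * inverse_integral + gain_const n0 n1 * weight_integral).
Proof.
move=> adm adm' mm'.
have i1 := integrable_moment i (measurable_transport_at x adm) (integrable_transport x adm).
have i2 := integrable_moment i (measurable_transport_at x adm') (integrable_transport x adm').
have i3 := integrable_subr i1 i2.
rewrite /moment_op -(RintegralB measurableT i1 i2).
apply: le_trans (le_normr_Rintegral measurableT i3) _.
have i4 := integrable_scaler tau^-1 phi_int_inv.
have i5 := integrable_scaler (gain_const n0 n1) integrable_env_weight.
have i6 := integrable_addr i4 i5.
rewrite -(RintegralZl tau^-1 measurableT phi_int_inv).
rewrite -(RintegralZl (gain_const n0 n1) measurableT integrable_env_weight).
rewrite -(RintegralD measurableT i4 i5) -(RintegralZl D measurableT i6).
apply: (le_Rintegral measurableT (integrable_norm i3) (integrable_scaler D i6)).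
move=> p _ /=; rewrite -mulrBl normrM.
have s1 := sqnorm1_ge0 p.
apply: (@le_trans _ _ (`|F m x p - F m' x p| * (1 + sqnorm p))).
  by rewrite ler_wpM2l// moment_weight_le.
apply: le_trans (ler_wpM2r s1 (transport_lip x p adm adm' mm')) _.
by rewrite le_eqVlt; apply/orP; left; apply/eqP; ring.
Qed.

Lemma measurable_moment_op m i : admissible m ->
  measurable_fun setT (fun x : RT => moment_op m x i).
Proof.
move=> adm.
apply: (@measurable_fun_Rintegral _ _ _ _ R mu3
  (fun z : RT * R3 R => F m z.1 z.2 * moment_weight i z.2)).
apply: measurable_funM.
  exact: (measurable_transport tau mphi n0_gt0 n1_gt0 e1_gt0 k_gt0 ratio adm).
by apply: (measurableT_comp (measurable_moment_weight i)); exact: measurable_snd.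
Qed.

End moment_operator.

Section weight_integral.
Context {R : realType}.
Local Notation mu3 := (lebesgue3 R).
Implicit Types p : R3 R.

(** Pointwise the weight is at most 1/(tau |p_1|) and tends to 0, while its other bound 4/n0 times
    the envelope is an integrable majorant. Dominated convergence along the integers is enough,
    because the weight decreases in tau. *)
Lemma weight_integral_small (n0 C b eps : R) : 0 < n0 -> 0 < C -> 0 < b -> 0 < eps ->
  exists2 tau2, 0 < tau2 & forall tau, tau2 <= tau -> weight_integral tau n0 C b <= eps.
Proof.
move=> n00 C0 b0 eps0.
pose W n : R3 R -> R := fun p => (1 + sqnorm p) * (envelope C b p * weight n.+1%:R n0 p).
have iW tau : 0 < tau -> mu3.-integrable setT (EFin \o
    (fun p => (1 + sqnorm p) * (envelope C b p * weight tau n0 p))).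
  by move=> tau0; exact: integrable_env_weight.
have nS0 n : 0 < n.+1%:R :> R by rewrite ltr0n.
have X0 p : 0 <= (1 + sqnorm p) * envelope C b p.
  by rewrite mulr_ge0 ?sqnorm1_ge0 ?envelope_ge0.
pose g p := (C * (4 / n0)) * ((1 + sqnorm p) ^+ 1 * expR (- (b * sqnorm p))).
have ig : mu3.-integrable setT (EFin \o g).
  by apply: integrable_scaler; exact: integrable_gauss3_poly.
have Wcvg p : W n p @[n --> \oo] --> (0 : R).
  have w0 : weight n.+1%:R n0 p @[n --> \oo] --> (0 : R).
    have hp : `|p.1|^-1 * harmonic n @[n --> \oo] --> `|p.1|^-1 * 0.
      by apply: cvgMr; exact: cvg_harmonic.
    apply: (@squeeze_cvgr _ _ _ _ (cst 0) (fun n => `|p.1|^-1 * harmonic n)).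
    - apply: nearW => n /=; rewrite weight_ge0//=.
      by rewrite ge_min /absorption invfM mulrC lexx.
    - exact: cvg_cst.
    - by move: hp; rewrite mulr0.
  rewrite (_ : (fun n => W n p) =
    (fun n => (1 + sqnorm p) * envelope C b p * weight n.+1%:R n0 p)); last first.
    by apply/funext => n; rewrite /W mulrA.
  have : (1 + sqnorm p) * envelope C b p * weight n.+1%:R n0 p @[n --> \oo] -->
    (1 + sqnorm p) * envelope C b p * 0 by exact: cvgMr.
  by rewrite mulr0.
have : (\int[mu3]_p W n p) @[n --> \oo] --> (0 : R).
  have [] := @dominated_convergence _ _ _ mu3 _ measurableT
    (fun n p => (W n p)%:E) (fun=> 0%E) (EFin \o g).
  - by move=> n; exact: (measurable_int mu3 (iW _ (nS0 n))).
  - exact: measurable_cst.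
  - by apply: aeW => p _; apply: cvg_EFin; [exact: nearW|exact: Wcvg].
  - exact: ig.
  - apply: aeW => p n _; rewrite lee_fin ger0_norm; last first.
      by rewrite /W mulrA mulr_ge0// weight_ge0.
    rewrite /W /g expr1.
    have -> : C * (4 / n0) * ((1 + sqnorm p) * expR (- (b * sqnorm p))) =
      (1 + sqnorm p) * envelope C b p * (4 / n0) by rewrite /envelope; ring.
    by rewrite mulrA ler_wpM2l// ge_min lexx orbT.
  - move=> _ _; rewrite integral0 => h; exact: (fine_cvg h).
move=> /cvgr_lt/(_ _ eps0)[N _ hN].
exists N.+1%:R => // tau Ntau.
have tau0 : 0 < tau by exact: lt_le_trans Ntau.
apply: le_trans (ltW (hN N (leqnn N))).
apply: (le_Rintegral measurableT (iW _ tau0) (iW _ (nS0 N))) => p _.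
apply: ler_wpM2l; first exact: sqnorm1_ge0.
apply: ler_wpM2l; first exact: envelope_ge0.
rewrite /weight le_min ge_min; apply/andP; split; last by rewrite ge_min lexx orbT.
apply/orP; left; rewrite /absorption !invfM ler_wpM2r ?invr_ge0//.
by rewrite lef_pV2 ?posrE.
Qed.

End weight_integral.

(** * Bounds from the boundary data *)

Section gap.
Context {R : realType}.
Local Notation mu3 := (lebesgue3 R).
Implicit Types p : R3 R.

Lemma quadratic_discriminant (S M N : R) : 0 <= N -> 
  (forall t, 0 <= S - 2 * t * M + t ^+ 2 * N) -> M ^+ 2 <= S * N.
Proof.
rewrite le_eqVlt => /predU1P[<- h|N0 h].
  have [->|M0] := eqVneq M 0; first by rewrite expr0n/= mulr0.
  (* For N = 0 the polynomial is affine in t, and this t gives it the value -1. *)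
  have := h ((S + 1) / (2 * M)).
  rewrite mulr0 addr0 (_ : 2 * _ * M = S + 1); last by field.
  lra.
have := mulr_ge0 (ltW N0) (h (M / N)).
rewrite (_ : N * _ = S * N - M ^+ 2); first by rewrite subr_ge0.
by field; rewrite gt_eqF.
Qed.

Lemma cauchy_schwarz_moment (f u : R3 R -> R) : (forall p, 0 <= f p) ->
  mu3.-integrable setT (EFin \o f) ->
  mu3.-integrable setT (EFin \o (fun p => f p * u p)) ->
  mu3.-integrable setT (EFin \o (fun p => f p * u p ^+ 2)) ->
  (\int[mu3]_p (f p * u p)) ^+ 2 <=
  (\int[mu3]_p (f p * u p ^+ 2)) * \int[mu3]_p f p.
Proof.
move=> f0 i0 i1 i2; apply: quadratic_discriminant; first exact: Rintegral_ge0.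
move=> t; have i3 := integrable_scaler (2 * t) i1.
have i4 := integrable_scaler (t ^+ 2) i0.
rewrite -(RintegralZl (2 * t) measurableT i1) -(RintegralZl (t ^+ 2) measurableT i0).
rewrite -(RintegralB measurableT i2 i3) -(RintegralD measurableT (integrable_subr i2 i3) i4).
apply: Rintegral_ge0 => p _.
rewrite (_ : _ + _ = f p * (u p - t) ^+ 2); last by ring.
by rewrite mulr_ge0 ?sqr_ge0.
Qed.

(* The off-diagonal terms [Sr * Nl + Sl * Nr] are nonnegative and the cross term
   of [(Mr - Ml) ^ 2] has the good sign. *)
Lemma two_stream_gap (E E1 E2 E3 N P1 P2 P3 Sr Sl Nr Nl Mr Ml : R) :
  0 <= Sr -> 0 <= Sl -> 0 <= Nr -> 0 <= Nl -> 0 <= Mr -> 0 <= Ml ->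
  E = E1 + E2 + E3 -> N = Nr + Nl -> E1 = Sr + Sl -> P1 = Mr - Ml ->
  Mr ^+ 2 <= Sr * Nr -> Ml ^+ 2 <= Sl * Nl -> P2 ^+ 2 <= E2 * N -> P3 ^+ 2 <= E3 * N ->
  Mr * Ml <= E * N - (P1 ^+ 2 + P2 ^+ 2 + P3 ^+ 2).
Proof.
move=> Sr0 Sl0 Nr0 Nl0 Mr0 Ml0 -> -> -> -> hr hl h2 h3.
have := mulr_ge0 Sr0 Nl0; have := mulr_ge0 Sl0 Nr0; have := mulr_ge0 Mr0 Ml0.
lra.
Qed.

End gap.

Section two_streams.
Context {R : realType}.
Local Notation mu3 := (lebesgue3 R).
Implicit Types p : R3 R.

(** The plane p_1 = 0 is counted as left, so the two indicators sum to 1 everywhere. *)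
Definition side_right p : R := if 0 < p.1 then 1 else 0.
Definition side_left p : R := if 0 < p.1 then 0 else 1.

Lemma measurable_side_right : measurable_fun setT side_right.
Proof. by apply: measurable_fun_ifT => //; apply: measurable_fun_ltr. Qed.

Lemma measurable_side_left : measurable_fun setT side_left.
Proof. by apply: measurable_fun_ifT => //; apply: measurable_fun_ltr. Qed.

Lemma sqr_coord_le p :
  [/\ p.1 ^+ 2 <= sqnorm p, p.2.1 ^+ 2 <= sqnorm p & p.2.2 ^+ 2 <= sqnorm p].
Proof.
have := sqr_ge0 p.1; have := sqr_ge0 p.2.1; have := sqr_ge0 p.2.2.
by rewrite /sqnorm => *; split; lra.
Qed.

Lemma norm_p1_le p : `|p.1| <= 1 + sqnorm p.
Proof. exact: (moment_weight_le Mom1). Qed.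

Section one_function.
Variable f : R3 R -> R.
Hypothesis f0 : forall p, 0 <= f p.
Hypothesis mf : measurable_fun setT f.
Hypothesis fi : mu3.-integrable setT (EFin \o (fun p => `|f p| * (1 + sqnorm p))).

Lemma integrable_weighted (u : R3 R -> R) : measurable_fun setT u ->
  (forall p, `|u p| <= 1 + sqnorm p) ->
  mu3.-integrable setT (EFin \o (fun p => f p * u p)).
Proof.
move=> mu_ hu; apply: integrable_dominated fi _; first exact: measurable_funM.
by move=> p; rewrite normrM ler_wpM2l.
Qed.

Lemma half_space_cauchy_schwarz (side u : R3 R -> R) : measurable_fun setT side ->
  measurable_fun setT u -> (forall p, side p = 0 \/ side p = 1) ->
  (forall p, `|u p| <= 1 + sqnorm p) -> (forall p, u p ^+ 2 <= sqnorm p) ->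
  (\int[mu3]_p (f p * (u p * side p))) ^+ 2 <=
  (\int[mu3]_p (f p * (u p ^+ 2 * side p))) * \int[mu3]_p (f p * side p).
Proof.
move=> ms mu_ s01 u1 u2.
have e1 : \int[mu3]_p (f p * (u p * side p)) = \int[mu3]_p ((f p * side p) * u p).
  by apply: eq_Rintegral => p _; ring.
have e2 : \int[mu3]_p (f p * (u p ^+ 2 * side p)) =
    \int[mu3]_p ((f p * side p) * u p ^+ 2).
  by apply: eq_Rintegral => p _; ring.
have sn p : `|side p| <= 1 by case: (s01 p) => ->; rewrite ?normr0 ?normr1.
have i (v : R3 R -> R) : measurable_fun setT v -> (forall p, `|v p| <= 1 + sqnorm p) ->
    mu3.-integrable setT (EFin \o (fun p => (f p * side p) * v p)).
  move=> mv hv; have := integrable_weighted (measurable_funM ms mv).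
  move=> /(_ _)/(eq_integrable measurableT); apply => //.
  - by move=> p _ /=; rewrite mulrA.
  - move=> p; rewrite normrM; apply: le_trans (hv p).
    by rewrite ler_piMl.
rewrite e1 e2; apply: cauchy_schwarz_moment.
- by move=> p; rewrite mulr_ge0//; case: (s01 p) => ->.
- apply: integrable_weighted => // p.
  exact: le_trans (sn p) (sqnorm1_ge1 p).
- exact: i.
- apply: i; first exact: measurable_funX.
  by move=> p; rewrite ger0_norm ?sqr_ge0// (le_trans (u2 p))// lerDr.
Qed.

End one_function.

(** Over all of momentum space Cauchy-Schwarz yields only a nonnegative gap. Applied separately to
    p_1 > 0 and p_1 <= 0 it yields the product of the two fluxes, because the first momentum is
    their difference; the transverse directions use the whole-space inequality. *)
Lemma two_stream_integrals (f : R3 R -> R) : (forall p, 0 <= f p) ->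
  measurable_fun setT f ->
  mu3.-integrable setT (EFin \o (fun p => `|f p| * (1 + sqnorm p))) ->
  (\int[mu3]_p (f p * (`|p.1| * side_right p))) *
  (\int[mu3]_p (f p * (`|p.1| * side_left p))) <=
  state_gap (fun i => \int[mu3]_p (f p * moment_weight i p)).
Proof.
move=> f0 mf fi.
have m1 : measurable_fun setT (fun p : R3 R => p.1) by exact: measurable_fst.
have ma : measurable_fun setT (fun p : R3 R => `|p.1|) by apply: measurableT_comp m1.
have m2 : measurable_fun setT (fun p : R3 R => p.2.1).
  by apply: measurableT_comp => //; exact: measurable_snd.
have m3 : measurable_fun setT (fun p : R3 R => p.2.2).
  by apply: measurableT_comp => //; exact: measurable_snd.
have mr := measurable_side_right; have ml := measurable_side_left.
have r01 p : side_right p = 0 \/ side_right p = 1.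
  by rewrite /side_right; case: ifPn; [right|left].
have l01 p : side_left p = 0 \/ side_left p = 1.
  by rewrite /side_left; case: ifPn; [left|right].
have side_le (side u : R3 R -> R) : (forall p, side p = 0 \/ side p = 1) ->
    (forall p, `|u p| <= 1 + sqnorm p) -> forall p, `|u p * side p| <= 1 + sqnorm p.
  by move=> s01 hu p; case: (s01 p) => ->; rewrite ?mulr0 ?mulr1 ?normr0 ?sqnorm1_ge0.
have abs1 p : `|(`|p.1|)| <= 1 + sqnorm p by rewrite normr_id norm_p1_le.
have w1 (p : R3 R) : `|1 : R| <= 1 + sqnorm p by rewrite normr1 sqnorm1_ge1.
have sq_le (u : R3 R -> R) : (forall p, u p ^+ 2 <= sqnorm p) ->
    forall p, `|u p ^+ 2| <= 1 + sqnorm p.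
  by move=> hu p; rewrite ger0_norm ?sqr_ge0// (le_trans (hu p))// lerDr.
have c1 p : p.1 ^+ 2 <= sqnorm p by have [] := sqr_coord_le p.
have c2 p : p.2.1 ^+ 2 <= sqnorm p by have [] := sqr_coord_le p.
have c3 p : p.2.2 ^+ 2 <= sqnorm p by have [] := sqr_coord_le p.
have ca p : `|p.1| ^+ 2 <= sqnorm p by rewrite real_normK ?num_real.
have I (u : R3 R -> R) := integrable_weighted mf fi (u := u).
have iS (side : R3 R -> R) : measurable_fun setT side -> (forall p, side p = 0 \/ side p = 1) ->
    [/\ mu3.-integrable setT (EFin \o (fun p => f p * side p)),
      mu3.-integrable setT (EFin \o (fun p => f p * (`|p.1| * side p))) &
      mu3.-integrable setT (EFin \o (fun p => f p * (`|p.1| ^+ 2 * side p)))].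
  move=> ms s01; split; apply: I.
  - exact: ms.
  - by move=> p; rewrite -[side p]mul1r; exact: (side_le side (fun=> 1)).
  - exact: measurable_funM.
  - exact: side_le.
  - by apply: measurable_funM => //; exact: measurable_funX.
  - by apply: side_le => //; exact: sq_le.
have [Ir0 Ir1 Ir2] := iS _ mr r01; have [Il0 Il1 Il2] := iS _ ml l01.
have rl p : side_right p + side_left p = 1.
  by rewrite /side_right /side_left; case: ifPn; rewrite ?addr0 ?add0r.
have Fge (u : R3 R -> R) : (forall p, 0 <= u p) -> 0 <= \int[mu3]_p (f p * u p).
  by move=> u0; apply: Rintegral_ge0 => p _; rewrite mulr_ge0.
have r0 p : 0 <= side_right p by case: (r01 p) => ->.
have l0 p : 0 <= side_left p by case: (l01 p) => ->.
have IE2 := I (fun p => p.2.1 ^+ 2) (measurable_funX _ m2) (sq_le _ c2).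
have IE3 := I (fun p => p.2.2 ^+ 2) (measurable_funX _ m3) (sq_le _ c3).
have IE1 := I (fun p => p.1 ^+ 2) (measurable_funX _ m1) (sq_le _ c1).
have NE : \int[mu3]_p f p = \int[mu3]_p (f p * 1).
  by apply: eq_Rintegral => p _; rewrite mulr1.
have If : mu3.-integrable setT (EFin \o f).
  by apply: eq_integrable (I (fun=> 1) (measurable_cst _) w1) => // p _ /=; rewrite mulr1.
rewrite /state_gap.
apply: (@two_stream_gap R _ (\int[mu3]_p (f p * p.1 ^+ 2))
  (\int[mu3]_p (f p * p.2.1 ^+ 2)) (\int[mu3]_p (f p * p.2.2 ^+ 2)) _ _ _ _
  (\int[mu3]_p (f p * (`|p.1| ^+ 2 * side_right p)))
  (\int[mu3]_p (f p * (`|p.1| ^+ 2 * side_left p)))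
  (\int[mu3]_p (f p * side_right p)) (\int[mu3]_p (f p * side_left p))).
- by apply: Fge => p; rewrite mulr_ge0 ?sqr_ge0.
- by apply: Fge => p; rewrite mulr_ge0 ?sqr_ge0.
- exact: Fge.
- exact: Fge.
- by apply: Fge => p; rewrite mulr_ge0.
- by apply: Fge => p; rewrite mulr_ge0.
- rewrite -(RintegralD measurableT IE1 IE2) -(RintegralD measurableT (integrable_addr IE1 IE2) IE3).
  by apply: eq_Rintegral => p _; rewrite /= /sqnorm; ring.
- rewrite -(RintegralD measurableT Ir0 Il0).
  by apply: eq_Rintegral => p _; rewrite -mulrDr rl.
- rewrite -(RintegralD measurableT Ir2 Il2).
  by apply: eq_Rintegral => p _; rewrite -mulrDr -mulrDr rl mulr1 real_normK ?num_real.
- rewrite -(RintegralB measurableT Ir1 Il1).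
  apply: eq_Rintegral => p _; rewrite /= -mulrBr; congr (_ * _).
  rewrite /side_right /side_left; case: ifPn => [h|].
    by rewrite mulr1 mulr0 subr0 gtr0_norm.
  by rewrite -leNgt => h; rewrite mulr1 mulr0 sub0r ler0_norm ?opprK.
- exact: half_space_cauchy_schwarz.
- exact: half_space_cauchy_schwarz.
- rewrite /= -NE; apply: cauchy_schwarz_moment => //.
  exact: (integrable_moment Mom2 mf fi).
- rewrite /= -NE; apply: cauchy_schwarz_moment => //.
  exact: (integrable_moment Mom3 mf fi).
Qed.

End two_streams.

(** * Damped boundary data *)

Section boundary_data.
Context {R : realType} (fL fR : R3 R -> R).
Local Notation mu3 := (lebesgue3 R).
Local Notation phi := (fLR fL fR).
Hypothesis mfL : measurable_fun [set p : R3 R | 0 < p.1] fL.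
Hypothesis mfR : measurable_fun [set p : R3 R | p.1 < 0] fR.
Implicit Types p : R3 R.

Lemma fLR_right p : 0 < p.1 -> phi p = fL p.
Proof.
move=> h; rewrite /fLR !indicE.
have -> : p \in [set q : R3 R | 0 < q.1] by rewrite inE.
have -> : p \in [set q : R3 R | q.1 < 0] = false by apply: memNset; rewrite /= lt_gtF.
by rewrite mulr1 mulr0 addr0.
Qed.

Lemma fLR_left p : p.1 < 0 -> phi p = fR p.
Proof.
move=> h; rewrite /fLR !indicE.
have -> : p \in [set q : R3 R | q.1 < 0] by rewrite inE.
have -> : p \in [set q : R3 R | 0 < q.1] = false by apply: memNset; rewrite /= lt_gtF.
by rewrite mulr1 mulr0 add0r.
Qed.

Lemma measurable_fLR : measurable_fun setT phi.
Proof.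
have m1 : measurable_fun setT (fun p : R3 R => p.1) by exact: measurable_fst.
have mA : measurable [set p : R3 R | 0 < p.1].
  rewrite -[X in measurable X]setTI.
  rewrite (_ : mkset _ = (fun p : R3 R => p.1) @^-1` `]0, +oo[%classic); last first.
    by apply/seteqP; split => p /=; rewrite in_itv/= andbT.
  exact: m1.
have mB : measurable [set p : R3 R | p.1 < 0].
  rewrite -[X in measurable X]setTI.
  rewrite (_ : mkset _ = (fun p : R3 R => p.1) @^-1` `]-oo, 0[%classic); last first.
    by apply/seteqP; split => p /=; rewrite in_itv/=.
  exact: m1.
have restrictE (g : R3 R -> R) (S : set (R3 R)) :
    (fun p => g p * \1_S p) = g \_ S.
  apply/funext => p; rewrite patchE indicE.
  by case: (p \in S); rewrite ?mulr1 ?mulr0.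
rewrite /fLR; apply: measurable_funD; rewrite restrictE.
- exact: (measurable_restrictT fL mA).1.
- exact: (measurable_restrictT fR mB).1.
Qed.

Hypothesis phi_ge0 : forall p, 0 <= phi p.
Hypothesis phi_int : mu3.-integrable setT (EFin \o (fun p => phi p * (1 + sqnorm p))).

Local Notation au := (const_au fL fR).

Definition damped tau p : R := damping fL fR tau p * phi p.

Lemma au_ge0 : 0 <= au.
Proof. by rewrite mulr_ge0// Rintegral_ge0. Qed.

Lemma dampingE tau p : damping fL fR tau p = expR (- (absorption tau p * au)).
Proof. by rewrite /damping mulrC. Qed.

Lemma damping_le1 tau p : 0 < tau -> damping fL fR tau p <= 1.
Proof.
move=> tau0; rewrite dampingE -expR0 ler_expR oppr_le0 mulr_ge0 ?au_ge0//.
exact: absorption_ge0.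
Qed.

Lemma damped_ge0 tau p : 0 <= damped tau p.
Proof. by rewrite mulr_ge0 ?expR_ge0. Qed.

Lemma measurable_damped tau : measurable_fun setT (damped tau).
Proof.
apply: measurable_funM; last exact: measurable_fLR.
rewrite (_ : damping fL fR tau = fun p => expR (- (absorption tau p * au))); last first.
  by apply/funext => p; rewrite dampingE.
apply: measurableT_comp => //; apply: measurableT_comp => //.
by apply: measurable_funM => //; exact: measurable_absorption.
Qed.

Lemma integrable_damped tau : 0 < tau ->
  mu3.-integrable setT (EFin \o (fun p => `|damped tau p| * (1 + sqnorm p))).
Proof.
move=> tau0; apply: integrable_dominated phi_int _.
  apply: measurable_funM.
    by apply: measurableT_comp => //; exact: measurable_damped.
  by apply: measurable_funD => //; exact: measurable_sqnorm.
move=> p; have s1 := sqnorm1_ge0 p; have d0 := damped_ge0 tau p.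
rewrite normrM normr_id (ger0_norm d0) (ger0_norm s1) ler_wpM2r//.
by rewrite /damped ler_piMl// damping_le1.
Qed.

(** Absorption decreases in tau; this is the source of the monotonicity of a_l and k. *)
Lemma damping_mono tau tau' p : 0 < tau -> tau <= tau' ->
  damped tau p <= damped tau' p.
Proof.
move=> tau0 tt'; rewrite /damped !dampingE ler_wpM2r// ler_expR lerN2.
rewrite ler_wpM2r ?au_ge0// /absorption !invfM ler_wpM2r ?invr_ge0//.
by rewrite lef_pV2 ?posrE// (lt_le_trans tau0).
Qed.

Lemma const_kE tau : const_k fL fR tau =
  (\int[mu3]_p (damped tau p * (`|p.1| * side_right p))) *
  (\int[mu3]_p (damped tau p * (`|p.1| * side_left p))).
Proof.
have memE (P : pred (R3 R)) p : (p \in [set q : R3 R | P q]) = P p.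
  by apply/idP/idP => [/set_mem//|h]; exact/mem_set.
rewrite /const_k; congr (_ * _); rewrite Rintegral_mkcond; apply: eq_Rintegral => p _;
  rewrite patchE memE/= /side_right /side_left /damped.
- have [h|h] := ltP 0 p.1; last by rewrite !mulr0.
  by rewrite fLR_right// mulr1.
- have [h|h|<-] := ltgtP 0 p.1.
  + by rewrite !mulr0.
  + by rewrite fLR_left// mulr1.
  + by rewrite normr0 mul0r mulr0.
Qed.

Lemma const_alE tau : const_al fL fR tau =
  \int[mu3]_p (damped tau p * moment_weight Mass p).
Proof. by apply: eq_Rintegral => p _; rewrite mulr1. Qed.

Lemma const_clE tau : const_cl fL fR tau =
  \int[mu3]_p (damped tau p * moment_weight Energy p).
Proof. by []. Qed.

Section above_damped.
Variables (tau : R) (f : R3 R -> R).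
Hypothesis tau_gt0 : 0 < tau.
Hypothesis df : forall p, damped tau p <= f p.
Hypothesis mf : measurable_fun setT f.
Hypothesis fi : mu3.-integrable setT (EFin \o (fun p => `|f p| * (1 + sqnorm p))).

Let f0 p : 0 <= f p. Proof. exact: le_trans (damped_ge0 tau p) (df p). Qed.

Lemma damped_integral_le (u : R3 R -> R) : measurable_fun setT u ->
  (forall p, 0 <= u p <= 1 + sqnorm p) ->
  \int[mu3]_p (damped tau p * u p) <= \int[mu3]_p (f p * u p).
Proof.
move=> meas_u hu; have un p : `|u p| <= 1 + sqnorm p.
  by have /andP[h1 h2] := hu p; rewrite ger0_norm.
have i1 := integrable_weighted (measurable_damped tau) (integrable_damped tau_gt0) meas_u un.
have i2 := integrable_weighted mf fi meas_u un.
apply: (le_Rintegral measurableT i1 i2) => p _.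
by rewrite ler_wpM2r//; have /andP[] := hu p.
Qed.

(** Any f above the damped data is allowed: the transported distribution leads to the gap bound, and
    the damped data of a larger tau lead to the monotonicity of k. *)
Lemma const_k_le_flux : const_k fL fR tau <=
  (\int[mu3]_p (f p * (`|p.1| * side_right p))) *
  (\int[mu3]_p (f p * (`|p.1| * side_left p))).
Proof.
rewrite const_kE.
have r01 p : 0 <= side_right p <= 1 by rewrite /side_right; case: ifPn; rewrite ?lexx ?ler01.
have l01 p : 0 <= side_left p <= 1 by rewrite /side_left; case: ifPn; rewrite ?lexx ?ler01.
have nb (side : R3 R -> R) : (forall p, 0 <= side p <= 1) ->
    forall p, 0 <= `|p.1| * side p <= 1 + sqnorm p.
  move=> h p; have /andP[h1 h2] := h p; rewrite mulr_ge0//=.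
  by apply: le_trans (norm_p1_le p); rewrite ler_piMr.
have mp : measurable_fun setT (fun p : R3 R => `|p.1|).
  by apply: measurableT_comp => //; exact: measurable_fst.
have pos (side : R3 R -> R) : (forall p, 0 <= side p <= 1) ->
    0 <= \int[mu3]_p (damped tau p * (`|p.1| * side p)).
  move=> h; apply: Rintegral_ge0 => p _; rewrite mulr_ge0 ?damped_ge0//.
  by have /andP[] := nb _ h p.
apply: ler_pM; [exact: pos|exact: pos| |].
- apply: damped_integral_le; last exact: nb.
  by apply: measurable_funM => //; exact: measurable_side_right.
- apply: damped_integral_le; last exact: nb.
  by apply: measurable_funM => //; exact: measurable_side_left.
Qed.

Lemma const_k_le : const_k fL fR tau <=
  state_gap (fun i => \int[mu3]_p (f p * moment_weight i p)).
Proof. exact: le_trans const_k_le_flux (two_stream_integrals f0 mf fi). Qed.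

Lemma const_al_le : const_al fL fR tau <= \int[mu3]_p (f p * moment_weight Mass p).
Proof.
rewrite const_alE; apply: damped_integral_le; first exact: measurable_cst.
by move=> p; rewrite /= ler01 sqnorm1_ge1.
Qed.

Lemma const_cl_le : const_cl fL fR tau <= \int[mu3]_p (f p * moment_weight Energy p).
Proof.
rewrite const_clE; apply: damped_integral_le; first exact: measurable_sqnorm.
by move=> p; apply/andP; split; [exact: sqnorm_ge0|rewrite lerDr].
Qed.

End above_damped.

Let integrable_normr_fLR :
  mu3.-integrable setT (EFin \o (fun p => `|phi p| * (1 + sqnorm p))).
Proof. by apply: eq_integrable phi_int => // p _ /=; rewrite ger0_norm. Qed.

Let damped_le tau p : 0 < tau -> damped tau p <= phi p.
Proof. by move=> tau0; rewrite /damped ler_piMl// damping_le1. Qed.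

Lemma fLR_mass : \int[mu3]_p (phi p * moment_weight Mass p) = au / 2.
Proof.
rewrite /const_au mulrAC divff// mul1r.
by apply: eq_Rintegral => p _; rewrite mulr1.
Qed.

Lemma fLR_energy : \int[mu3]_p (phi p * moment_weight Energy p) = const_cu fL fR / 2.
Proof. by rewrite /const_cu mulrAC divff// mul1r. Qed.

Lemma const_k_le_fLR tau : 0 < tau -> const_k fL fR tau <=
  state_gap (fun i => \int[mu3]_p (phi p * moment_weight i p)).
Proof.
move=> tau0; apply: (const_k_le tau0) => [p| |].
- exact: damped_le.
- exact: measurable_fLR.
- exact: integrable_normr_fLR.
Qed.

Lemma const_al_le_half tau : 0 < tau -> const_al fL fR tau <= au / 2.
Proof.
move=> tau0; rewrite -fLR_mass; apply: (const_al_le tau0) => [p| |].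
- exact: damped_le.
- exact: measurable_fLR.
- exact: integrable_normr_fLR.
Qed.

Lemma const_cl_le_half tau : 0 < tau -> const_cl fL fR tau <= const_cu fL fR / 2.
Proof.
move=> tau0; rewrite -fLR_energy; apply: (const_cl_le tau0) => [p| |].
- exact: damped_le.
- exact: measurable_fLR.
- exact: integrable_normr_fLR.
Qed.

Lemma const_al_ge0 tau : 0 <= const_al fL fR tau.
Proof. by rewrite const_alE; apply: Rintegral_ge0 => p _; rewrite mulr1 damped_ge0. Qed.

Lemma const_cl_ge0 tau : 0 <= const_cl fL fR tau.
Proof.
by rewrite const_clE; apply: Rintegral_ge0 => p _; exact: mulr_ge0 (damped_ge0 _ _) (sqnorm_ge0 p).
Qed.

(** The gap bound applied to the damped data themselves gives k <= c_l a_l. So k > 0 forces both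
    factors to be positive, and a_l <= a_u/2, c_l <= c_u/2 do the rest. *)
Lemma constants_gt0 tau : 0 < tau -> 0 < const_k fL fR tau ->
  [/\ 0 < const_al fL fR tau, 0 < au & 0 < const_cu fL fR].
Proof.
move=> tau0 k0.
have kle : const_k fL fR tau <= const_cl fL fR tau * const_al fL fR tau.
  rewrite const_clE const_alE; apply: le_trans (const_k_le tau0 (fun p => lexx (damped tau p))
    (measurable_damped tau) (integrable_damped tau0)) _.
  by rewrite /state_gap lerBlDr lerDl sqnorm_ge0.
have P := lt_le_trans k0 kle.
have cl : 0 < const_cl fL fR tau.
  by rewrite lt_def const_cl_ge0 andbT; apply: contraTneq P => ->; rewrite mul0r ltxx.
have al : 0 < const_al fL fR tau.
  by rewrite lt_def const_al_ge0 andbT; apply: contraTneq P => ->; rewrite mulr0 ltxx.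
have := const_al_le_half tau0; have := const_cl_le_half tau0 => *.
by split => //; lra.
Qed.

End boundary_data.

(** * The mild formula in terms of moments *)

Section mild_formula.
Context {R : realType} (K : statistics).
Local Notation mu := (@lebesgue_measure R).
Local Notation mu3 := (lebesgue3 R).
Local Notation RT := (measurableTypeR R).
Variables (tau : R) (fL fR : R3 R -> R).
Implicit Types (s m : R -> moment -> R) (p : R3 R).

(** The shape follows [mild_solution] literally, so that at s = [state_of f] each branch is its
    right-hand side by unfolding. *)
Definition mild_rhs s x p : R :=
  if 0 < p.1 then
    expR (- (tau * `|p.1|)^-1 * \int[mu]_(z in `[0, x]) s z Mass) * fL p
    + (tau * `|p.1|)^-1 * \int[mu]_(y in `[0, x])
        (expR (- (tau * `|p.1|)^-1 * \int[mu]_(z in `[y, x]) s z Mass)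
         * s y Mass * state_eq K (s y) p)
  else
    expR (- (tau * `|p.1|)^-1 * \int[mu]_(z in `[x, 1]) s z Mass) * fR p
    + (tau * `|p.1|)^-1 * \int[mu]_(y in `[x, 1])
        (expR (- (tau * `|p.1|)^-1 * \int[mu]_(z in `[x, y]) s z Mass)
         * s y Mass * state_eq K (s y) p).

(** A given solution is controlled only on [0, 1]; this allows its moments to be exchanged for their
    clamped extension. *)
Lemma mild_rhs_ext s s' x p : 0 <= x <= 1 ->
  (forall y, 0 <= y <= 1 -> s y = s' y) -> mild_rhs s x p = mild_rhs s' x p.
Proof.
move=> /andP[x0 x1] ss'.
have E u v : 0 <= u -> v <= 1 ->
    \int[mu]_(z in `[u, v]) s z Mass = \int[mu]_(z in `[u, v]) s' z Mass.
  move=> u0 v1; apply: eq_Rintegral => z; rewrite inE/= in_itv/= => /andP[uz zv].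
  by rewrite ss'// (le_trans u0)//= (le_trans zv).
pose g (s : R -> moment -> R) (h : R) y := expR (- (tau * `|p.1|)^-1 * h) * s y Mass * state_eq K (s y) p.
have G1 : \int[mu]_(y in `[0, x]) g s (\int[mu]_(z in `[y, x]) s z Mass) y =
    \int[mu]_(y in `[0, x]) g s' (\int[mu]_(z in `[y, x]) s' z Mass) y.
  apply: eq_Rintegral => y; rewrite inE/= in_itv/= => /andP[y0 yx].
  have ye : s y = s' y by apply: ss'; rewrite y0 (le_trans yx x1).
  by rewrite /g (E y x y0 x1) ye.
have G2 : \int[mu]_(y in `[x, 1]) g s (\int[mu]_(z in `[x, y]) s z Mass) y =
    \int[mu]_(y in `[x, 1]) g s' (\int[mu]_(z in `[x, y]) s' z Mass) y.
  apply: eq_Rintegral => y; rewrite inE/= in_itv/= => /andP[xy y1].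
  have ye : s y = s' y by apply: ss'; rewrite y1 (le_trans x0 xy).
  by rewrite /g (E x y x0 y1) ye.
rewrite /g in G1 G2.
rewrite /mild_rhs; case: (0 < p.1).
  exact: (f_equal2 (fun I J => expR (- (tau * `|p.1|)^-1 * I) * fL p +
    (tau * `|p.1|)^-1 * J) (E 0 x (lexx 0) x1) G1).
exact: (f_equal2 (fun I J => expR (- (tau * `|p.1|)^-1 * I) * fR p +
  (tau * `|p.1|)^-1 * J) (E x 1 x0 (lexx 1)) G2).
Qed.

Variables n0 n1 e1 k : R.
Hypothesis n0_gt0 : 0 < n0.
Local Notation admissible := (admissible n0 n1 e1 k).

Lemma transport_mild m x p : admissible m -> 0 <= x <= 1 -> p.1 != 0 ->
  transport K tau (fLR fL fR) m x p = mild_rhs m x p.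
Proof.
move=> adm x01 p0; have /andP[x0 x1] := x01.
have HB u v := @optical_depthB R (m^~ Mass) n0 n1 (adm.1 Mass) (admissible_mass adm) n0_gt0 u v.
have Hge u v : 0 <= u -> u <= v ->
    0 <= optical_depth (m^~ Mass) v - optical_depth (m^~ Mass) u.
  move=> u0 uv; rewrite -HB//; apply: Rintegral_ge0 => z _.
  by have /andP[h _] := admissible_mass adm z; exact: le_trans (ltW n0_gt0) h.
rewrite /transport clamp_id// /loss /gain /mild_rhs /entry_depth -/(absorption tau p).
have [pp|pn|p00] := ltgtP 0 p.1; last by move: p0; rewrite -p00 eqxx.
- rewrite fLR_right//.
  have G : \int[mu]_(y in `[0, 1]) gain_integrand K tau m x p y =
      \int[mu]_(y in `[0, x]) (expR (- absorption tau p * \int[mu]_(z in `[y, x]) m z Mass)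
         * m y Mass * state_eq K (m y) p).
    rewrite Rintegral_mkcond [RHS]Rintegral_mkcond; apply: eq_Rintegral => y _.
    rewrite !patchE !mem_setE !in_itv/= /gain_integrand /upstream pp.
    have [yx|xy] := leP y x; last by rewrite andbF; case: ifP.
    rewrite andbT (le_trans yx x1) andbT; case: ifPn => // y0.
    by rewrite ger0_norm ?Hge// -HB// mulNr.
  by rewrite G mulNr.
- rewrite fLR_left//.
  have G : \int[mu]_(y in `[0, 1]) gain_integrand K tau m x p y =
      \int[mu]_(y in `[x, 1]) (expR (- absorption tau p * \int[mu]_(z in `[x, y]) m z Mass)
         * m y Mass * state_eq K (m y) p).
    rewrite Rintegral_mkcond [RHS]Rintegral_mkcond; apply: eq_Rintegral => y _.
    rewrite !patchE !mem_setE !in_itv/= /gain_integrand /upstream (lt_gtF pn).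
    have [xy|yx] := leP x y; last by case: ifP.
    rewrite (le_trans x0 xy)/=; case: ifPn => // y1.
    by rewrite distrC ger0_norm ?Hge// -HB// mulNr.
  by rewrite G -(HB x 1 x0 x1) mulNr.
Qed.

End mild_formula.

Section transport_bounds.
Context {R : realType} (K : statistics) (fL fR : R3 R -> R).
Local Notation mu3 := (lebesgue3 R).
Local Notation phi := (fLR fL fR).
Local Notation au := (const_au fL fR).
Local Notation cu := (const_cu fL fR).
Implicit Types (m : R -> moment -> R) (p : R3 R).
Hypothesis mfL : measurable_fun [set p : R3 R | 0 < p.1] fL.
Hypothesis mfR : measurable_fun [set p : R3 R | p.1 < 0] fR.
Hypothesis phi_ge0 : forall p, 0 <= phi p.
Hypothesis phi_int : mu3.-integrable setT (EFin \o (fun p => phi p * (1 + sqnorm p))).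

Variables (tau n0 k C b : R).
Hypothesis tau_gt0 : 0 < tau.
Hypothesis n0_gt0 : 0 < n0.
Hypothesis au_gt0 : 0 < au.
Hypothesis cu_gt0 : 0 < cu.
Hypothesis k_gt0 : 0 < k.
Hypothesis ratio : au `^ (8 / 5) / k `^ (3 / 5) < beta K (beta_min K).
Local Notation ok := (state_ok n0 au cu k).
Local Notation admissible := (admissible n0 au cu k).
Hypothesis C_gt0 : 0 < C.
Hypothesis b_gt0 : 0 < b.
Hypothesis state_eq_bound : forall s, ok s -> forall p,
  0 <= state_eq K s p <= C * expR (- (b * sqnorm p)).
Local Notation omega := (weight_integral tau n0 C b).
Hypothesis omega_mass : au * omega <= au / 2.
Hypothesis omega_energy : au * omega <= cu / 2.

Let mphi : measurable_fun setT phi. Proof. exact: measurable_fLR. Qed.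

(** The factors 2 in a_u and c_u pay for the gain: the boundary data contribute at most one half of
    each upper bound, and the smallness of [omega] keeps the gain within the other half. All lower
    bounds hold because the transported distribution lies above the damped data. *)
Lemma moment_op_state_bounds m x : admissible m ->
  [/\ const_al fL fR tau <= moment_op K tau phi m x Mass <= au,
      const_cl fL fR tau <= moment_op K tau phi m x Energy <= cu &
      const_k fL fR tau <= state_gap (moment_op K tau phi m x)].
Proof.
move=> adm.
pose F := transport K tau phi m x.
have mF : measurable_fun setT F.
  exact: (measurable_transport_at tau mphi n0_gt0 au_gt0 cu_gt0 k_gt0 ratio).
have bF p : expR (- (absorption tau p * au)) * phi p <= F p <=
    phi p + au * (envelope C b p * weight tau n0 p).
  exact: (transport_bounds tau_gt0 phi_ge0 n0_gt0 au_gt0 cu_gt0 k_gt0 ratio C_gt0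
    state_eq_bound).
have dF p : damped fL fR tau p <= F p.
  by have /andP[h _] := bF p; rewrite /damped dampingE.
have iF : mu3.-integrable setT (EFin \o (fun p => `|F p| * (1 + sqnorm p))).
  exact: (integrable_transport tau_gt0 phi_ge0 mphi phi_int n0_gt0 au_gt0 cu_gt0 k_gt0
    ratio C_gt0 b_gt0 state_eq_bound).
have iphi : mu3.-integrable setT (EFin \o (fun p => `|phi p| * (1 + sqnorm p))).
  by apply: eq_integrable phi_int => // p _ /=; rewrite ger0_norm.
have iw := integrable_env_weight tau_gt0 n0_gt0 C_gt0 b_gt0.
have upper (u : R3 R -> R) : measurable_fun setT u -> (forall p, 0 <= u p <= 1 + sqnorm p) ->
    \int[mu3]_p (F p * u p) <= \int[mu3]_p (phi p * u p) + au * omega.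
  move=> mu_ hu; have un p : `|u p| <= 1 + sqnorm p.
    by have /andP[h1 h2] := hu p; rewrite ger0_norm.
  have i1 := integrable_weighted mF iF mu_ un.
  have i2 := integrable_weighted mphi iphi mu_ un.
  rewrite -(RintegralZl au measurableT iw).
  rewrite -(RintegralD measurableT i2 (integrable_scaler au iw)).
  apply: (le_Rintegral measurableT i1 (integrable_addr i2 (integrable_scaler au iw))) => p _.
  have /andP[u0 u1] := hu p; have /andP[_ h] := bF p.
  apply: le_trans (ler_wpM2r u0 h) _; rewrite mulrDl lerD2l -mulrA.
  rewrite ler_pM2l// mulrC ler_wpM2r//.
  by rewrite mulr_ge0 ?envelope_ge0 ?weight_ge0.
split.
- apply/andP; split.
    exact: (const_al_le mfL mfR phi_ge0 phi_int tau_gt0 dF mF iF).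
  apply: le_trans (upper (fun=> 1) _ _) _; first exact: measurable_cst.
    by move=> p; apply/andP; split; [exact: ler01|exact: sqnorm1_ge1].
  have -> : \int[mu3]_p (phi p * 1) = au / 2.
    rewrite /const_au mulrAC divff// mul1r.
    by apply: eq_Rintegral => p _; rewrite mulr1.
  by move: omega_mass; lra.
- apply/andP; split.
    exact: (const_cl_le mfL mfR phi_ge0 phi_int tau_gt0 dF mF iF).
  apply: le_trans (upper (@sqnorm R) _ _) _; first exact: measurable_sqnorm.
    by move=> p; apply/andP; split; [exact: sqnorm_ge0|rewrite lerDr].
  have -> : \int[mu3]_p (phi p * sqnorm p) = cu / 2.
    by rewrite /const_cu mulrAC divff// mul1r.
  by move: omega_energy; lra.
- exact: (const_k_le mfL mfR phi_ge0 phi_int tau_gt0 dF mF iF).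
Qed.

End transport_bounds.

(** * The fixed-point equation *)

Section in_L12.
Context {R : realType}.
Local Notation mu3 := (lebesgue3 R).
Local Notation RT := (measurableTypeR R).
Variable g : R -> R3 R -> R.
Hypothesis gL : in_L12 g.

Lemma in_L12_measurable :
  measurable_fun setT (fun z : RT * R3 R => g (clamp 0 1 z.1) z.2).
Proof.
have [mg _] := gL.
pose D : set (RT * R3 R) := (`[0, 1]%classic : set RT) `*` setT.
have mD : measurable D by apply: measurableX => //; exact: measurable_itv.
have mr := (measurable_restrictT (fun z : RT * R3 R => g z.1 z.2) mD).1 mg.
have mc : measurable_fun setT (fun z : RT * R3 R => (clamp 0 1 z.1, z.2) : RT * R3 R).
  apply/measurable_fun_prod; last exact: measurable_snd.
  apply: measurableT_comp; last exact: measurable_fst.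
  by apply: continuous_measurable_fun; exact: clamp_continuous.
have := measurableT_comp mr mc; apply: eq_measurable_fun => z _ /=.
by rewrite patchE mem_set//; split => //=; rewrite in_itv/=; exact: clamp01.
Qed.

Lemma in_L12_measurable_at x : 0 <= x <= 1 -> measurable_fun setT (g x).
Proof.
move=> x01.
have mp : measurable_fun setT (fun p : R3 R => (x, p) : RT * R3 R).
  by apply/measurable_fun_prod.
have := measurableT_comp in_L12_measurable mp.
by apply: eq_measurable_fun => p _ /=; rewrite clamp_id.
Qed.

End in_L12.

Section fixed_point_equation.
Context {R : realType} (K : statistics) (fL fR : R3 R -> R).
Local Notation mu3 := (lebesgue3 R).
Local Notation RT := (measurableTypeR R).
Local Notation phi := (fLR fL fR).
Local Notation au := (const_au fL fR).
Local Notation cu := (const_cu fL fR).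
Implicit Types (m : R -> moment -> R) (p : R3 R).
Hypothesis mfL : measurable_fun [set p : R3 R | 0 < p.1] fL.
Hypothesis mfR : measurable_fun [set p : R3 R | p.1 < 0] fR.
Hypothesis phi_ge0 : forall p, 0 <= phi p.
Hypothesis phi_int : mu3.-integrable setT (EFin \o (fun p => phi p * (1 + sqnorm p))).
Hypothesis phi_int_inv :
  mu3.-integrable setT (EFin \o (fun p => `|p.1|^-1 * phi p * (1 + sqnorm p))).

Variables (tau n0 k C b : R).
Hypothesis tau_gt0 : 0 < tau.
Hypothesis n0_gt0 : 0 < n0.
Hypothesis au_gt0 : 0 < au.
Hypothesis cu_gt0 : 0 < cu.
Hypothesis k_gt0 : 0 < k.
Hypothesis ratio : au `^ (8 / 5) / k `^ (3 / 5) < beta K (beta_min K).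
Local Notation ok := (state_ok n0 au cu k).
Local Notation admissible := (admissible n0 au cu k).
Hypothesis C_gt0 : 0 < C.
Hypothesis b_gt0 : 0 < b.
Hypothesis state_eq_bound : forall s, ok s -> forall p,
  0 <= state_eq K s p <= C * expR (- (b * sqnorm p)).
Hypothesis state_eq_lip : forall s s' (D : R), ok s -> ok s' ->
  state_dist_le D s s' -> forall p,
  `|state_eq K s p - state_eq K s' p| <= C * D * expR (- (b * sqnorm p)).
Local Notation omega := (weight_integral tau n0 C b).
Hypothesis omega_mass : au * omega <= au / 2.
Hypothesis omega_energy : au * omega <= cu / 2.
Hypothesis omega_lip : gain_const n0 au * omega <= 4^-1.
Hypothesis loss_small : tau^-1 * inverse_integral phi <= 4^-1.
Hypothesis n0_le : n0 <= const_al fL fR tau.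
Hypothesis k_le : k <= const_k fL fR tau.

Let mphi : measurable_fun setT phi. Proof. exact: measurable_fLR. Qed.

Local Notation T := (moment_op K tau phi).
Local Notation F := (transport K tau phi).

(** [n0] and [k] lie below a_l and k at the present tau, so [ok] is weaker than what is asked of a
    solution, and every solution has admissible moments. *)
Lemma state_ok_of_bounds (s : moment -> R) :
  const_al fL fR tau <= s Mass <= au -> const_cl fL fR tau <= s Energy <= cu ->
  const_k fL fR tau <= state_gap s -> ok s.
Proof.
move=> /andP[h1 h2] /andP[h3 h4] h5; split.
- by rewrite (le_trans n0_le h1).
- by rewrite (le_trans (const_cl_ge0 phi_ge0 tau) h3).
- exact: le_trans k_le h5.
Qed.

Lemma moment_op_bounds m x : admissible m ->
  [/\ const_al fL fR tau <= T m x Mass <= au,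
      const_cl fL fR tau <= T m x Energy <= cu &
      const_k fL fR tau <= state_gap (T m x)].
Proof.
exact: (moment_op_state_bounds mfL mfR phi_ge0 phi_int tau_gt0 n0_gt0 au_gt0 cu_gt0
  k_gt0 ratio C_gt0 b_gt0 state_eq_bound omega_mass omega_energy).
Qed.

Lemma moment_op_admissible m : admissible m -> admissible (T m).
Proof.
move=> adm; split=> [i|y].
  exact: (measurable_moment_op tau mphi n0_gt0 au_gt0 cu_gt0 k_gt0 ratio).
by have [h1 h2 h3] := moment_op_bounds y adm; exact: state_ok_of_bounds.
Qed.

(** Loss and gain contribute at most D/4 each. *)
Lemma moment_op_contraction m m' D : admissible m -> admissible m' ->
  moments_dist_le D m m' -> moments_dist_le (D / 2) (T m) (T m').
Proof.
move=> adm adm' mm' x i.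
have h := moment_op_lip tau_gt0 phi_ge0 mphi phi_int phi_int_inv n0_gt0 au_gt0 cu_gt0
  k_gt0 ratio C_gt0 b_gt0 state_eq_bound state_eq_lip x i adm adm' mm'.
apply: le_trans h _; have D0 : 0 <= D by exact: le_trans (mm' 0 Mass).
apply: (ler_wpM2l D0).
rewrite (_ : 2^-1 = 4^-1 + 4^-1) ?(lerD loss_small omega_lip)//.
by rewrite -mulr2n -mulr_natr; field.
Qed.

(** The moments of the undamped boundary data, constant in x, qualify: the data lie above the damped
    ones, and mass and energy are half of a_u and c_u. *)
Lemma admissible_exists : exists m, admissible m.
Proof.
exists (fun _ i => \int[mu3]_p (phi p * moment_weight i p)); split=> [i|_].
  exact: measurable_cst.
apply: state_ok_of_bounds; last exact: const_k_le_fLR.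
- have := const_al_le_half mfL mfR phi_ge0 phi_int tau_gt0.
  by rewrite fLR_mass => -> /=; rewrite ler_pdivrMr// ler_pMr// ler1n.
- have := const_cl_le_half mfL mfR phi_ge0 phi_int tau_gt0.
  by rewrite fLR_energy => -> /=; rewrite ler_pdivrMr// ler_pMr// ler1n.
Qed.

Definition state_radius : R := au + cu + (1 + cu * au).

Lemma state_ok_bounded s i : ok s -> `|s i| <= state_radius.
Proof.
move=> oks; have [h1 h2 h3] := state_momentum_bound n0_gt0 k_gt0 oks.
have [/andP[m0 m1] /andP[e0 e1] _] := oks.
have a0 := ltW au_gt0; have c0 := ltW cu_gt0; have ca := mulr_ge0 c0 a0.
rewrite /state_radius; case: i.
- by rewrite ger0_norm ?(le_trans (ltW n0_gt0) m0)//; lra.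
- by apply: (le_trans h1); lra.
- by apply: (le_trans h2); lra.
- by apply: (le_trans h3); lra.
- by rewrite ger0_norm//; lra.
Qed.

(** Measurability and weak inequalities survive pointwise limits, and the gap is a polynomial in the
    moments. *)
Lemma admissible_closed (u : nat -> R -> moment -> R) m : (forall n, admissible (u n)) ->
  (forall y i, u n y i @[n --> \oo] --> m y i) -> admissible m.
Proof.
move=> adm um; split=> [i|y].
  apply: (@measurable_fun_cvg _ _ _ _ (fun n y => u n y i)) => [n|y _].
    exact: (adm n).1.
  exact: um.
have ok_ n := (adm n).2 y.
split.
- apply/andP; split.
  + by apply: cvgr_to_ge (um y Mass) _; apply: nearW => n; have [/andP[]] := ok_ n.
  + by apply: cvgr_to_le (um y Mass) _; apply: nearW => n; have [/andP[]] := ok_ n.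
- apply/andP; split.
  + by apply: cvgr_to_ge (um y Energy) _; apply: nearW => n; have [_ /andP[]] := ok_ n.
  + by apply: cvgr_to_le (um y Energy) _; apply: nearW => n; have [_ /andP[]] := ok_ n.
- have sq i : u n y i ^+ 2 @[n --> \oo] --> m y i ^+ 2.
    by rewrite expr2; under eq_fun do rewrite expr2; exact: cvgM.
  have : state_gap (u n y) @[n --> \oo] --> state_gap (m y).
    rewrite /state_gap /sqnorm/=; apply: cvgB; first exact: cvgM.
    by apply: cvgD => //; apply: cvgD.
  move=> gap; apply: cvgr_to_ge gap _; apply: nearW => n; by have [] := ok_ n.
Qed.

Lemma moment_fixed_point : exists m, [/\ admissible m, T m = m &
  forall m', admissible m' -> T m' = m' -> m' = m].
Proof.
(* Moment functions are read as real functions of the pair (y, i), the form in which the contraction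
   principle is stated. *)
pose unflat (h : R * moment -> R) := fun y i => h (y, i).
pose flat m (j : R * moment) : R := m j.1 j.2.
pose Tf h := flat (T (unflat h)).
have admT h : admissible (unflat h) -> admissible (unflat (Tf h)).
  exact: moment_op_admissible.
have bdd h h' : admissible (unflat h) -> admissible (unflat h') ->
    forall j, `|h j - h' j| <= 2 * state_radius.
  move=> adm adm' [y i].
  have h1 := state_ok_bounded i (adm.2 y); have h2 := state_ok_bounded i (adm'.2 y).
  by apply: le_trans (ler_normB _ _) _; move: h1 h2; rewrite /unflat; lra.
have contr h h' D : admissible (unflat h) -> admissible (unflat h') ->
    (forall j, `|h j - h' j| <= D) -> forall j, `|Tf h j - Tf h' j| <= D / 2.
  move=> adm adm' hh' [y i].
  by apply: moment_op_contraction => // z l; exact: hh'.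
have closed (u : nat -> R * moment -> R) h : (forall n, admissible (unflat (u n))) ->
    (forall j, u n j @[n --> \oo] --> h j) -> admissible (unflat h).
  by move=> adm uh; apply: (admissible_closed adm) => y i; exact: uh.
have [m0 adm0] := admissible_exists.
have [h admh Th] := contraction_fixed_point admT bdd closed contr (m0 := flat m0) adm0.
exists (unflat h); split => // [|m' adm' Tm'].
  by rewrite -[in RHS]Th.
have e := contraction_unique admT bdd contr (m := flat m') (m' := h) adm' admh.
by rewrite -e// /Tf /unflat/= Tm'.
Qed.

Lemma transport_in_L12 m : admissible m -> in_L12 (F m).
Proof.
move=> adm; split.
  apply: measurable_funTS.
  exact: (measurable_transport tau mphi n0_gt0 au_gt0 cu_gt0 k_gt0 ratio adm).
have iw := integrable_scaler au (integrable_env_weight tau_gt0 n0_gt0 C_gt0 b_gt0).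
have ib := integrable_addr phi_int iw.
pose B : R := \int[mu3]_p (phi p * (1 + sqnorm p) +
  au * ((1 + sqnorm p) * (envelope C b p * weight tau n0 p))).
apply: (@le_lt_trans _ _ B%:E); last exact: ltry.
apply: ge_ereal_sup => _ [x _ <-].
have iF : mu3.-integrable setT (EFin \o (fun p => `|F m x p| * (1 + sqnorm p))).
  exact: (integrable_transport tau_gt0 phi_ge0 mphi phi_int n0_gt0 au_gt0 cu_gt0 k_gt0
    ratio C_gt0 b_gt0 state_eq_bound).
rewrite -(EFin_Rintegral iF) lee_fin.
apply: (le_Rintegral measurableT iF ib) => p _.
have /andP[_ h] := transport_bounds tau_gt0 phi_ge0 n0_gt0 au_gt0 cu_gt0 k_gt0
  ratio C_gt0 state_eq_bound x p adm.
have F0 := transport_ge0 tau_gt0 phi_ge0 n0_gt0 au_gt0 cu_gt0 k_gt0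
  ratio C_gt0 state_eq_bound x p adm.
rewrite (ger0_norm F0).
rewrite (_ : _ + au * _ = (phi p + au * (envelope C b p * weight tau n0 p)) * (1 + sqnorm p)).
  exact: (ler_wpM2r (sqnorm1_ge0 p)).
by ring.
Qed.

(** The equation T m = m says that m is the family of moments of F m. So the mild formula with
    inserted moments m is the mild formula of F m, and the bounds on T m become bounds on its
    moments. *)
Lemma fixed_point_solves m : admissible m -> T m = m ->
  nonneg_mild_solution_with_bounds K tau fL fR (F m).
Proof.
move=> adm Tm.
have sm : state_of (F m) = m.
  apply/funext => x; apply/funext => i.
  by rewrite state_ofE -[RHS](congr1 (fun h => h x i) Tm).
have hb x := moment_op_bounds x adm.
rewrite Tm in hb.
have okm x := adm.2 x.
split; [split|..].
- exact: transport_in_L12.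
- move=> x _; have /andP[i0 _] := state_internal_bounds n0_gt0 au_gt0 k_gt0 (okm x).
  have [/andP[M0 _] _ _] := okm x.
  have [a0 [a1 [c0 [c1 [_ _ hp]]]]] :=
    state_params n0_gt0 au_gt0 cu_gt0 k_gt0 ratio.
  have [barg _ _ _ _] := hp _ (okm x).
  rewrite -sm in M0 i0 barg.
  split; [exact: lt_le_trans n0_gt0 M0| |exact: barg].
  by apply: lt_le_trans i0; exact: divr_gt0.
- move=> x x01; apply: filterS (ae_p1_neq0 (R := R)) => p p0.
  have e : F m x p = mild_rhs K tau fL fR (state_of (F m)) x p.
    by rewrite sm; exact: (transport_mild K tau fL fR n0_gt0 adm x01 p0).
  rewrite e /mild_rhs; split => hp; first by rewrite hp.
  by rewrite (lt_gtF hp).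
- move=> x _; apply: nearW => p.
  exact: (transport_ge0 tau_gt0 phi_ge0 n0_gt0 au_gt0 cu_gt0 k_gt0
    ratio C_gt0 state_eq_bound).
- move=> x _; have [h1 h2 h3] := hb x; rewrite -sm in h1 h2 h3; split.
  + exact: h1.
  + exact: h2.
  + exact: h3.
Qed.

(** Off p_1 = 0 the mild formula of g is the transport of its own moments, and moments ignore null
    sets. Hence these moments are a fixed point, and g is recovered from them almost everywhere. *)
Lemma solution_transport g : nonneg_mild_solution_with_bounds K tau fL fR g ->
  let m := fun y => state_of g (clamp 0 1 y) in
  [/\ admissible m, T m = m &
      forall x, 0 <= x <= 1 -> \forall p \ae mu3, g x p = F m x p].
Proof.
move=> [[gL _ gE] _ gB] m.
have adm : admissible m.
  split=> [i|y]; last first.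
    by have [h1 h2 h3] := gB _ (clamp01 y); exact: state_ok_of_bounds.
  have mg := in_L12_measurable gL.
  apply: (eq_measurable_fun (fun y : RT =>
      \int[mu3]_p (g (clamp 0 1 y) p * moment_weight i p))).
    by move=> y _; rewrite /m state_ofE.
  apply: (measurable_fun_Rintegral mu3
    (f := fun z : RT * R3 R => g (clamp 0 1 z.1) z.2 * moment_weight i z.2)).
  apply: measurable_funM => //.
  by apply: measurableT_comp; [exact: measurable_moment_weight|exact: measurable_snd].
have gF x : 0 <= x <= 1 -> \forall p \ae mu3, g x p = F m x p.
  move=> x01; have ae := ae_p1_neq0 (R := R).
  apply: (@filterS2 _ _ (ae_filter_ringOfSetsType mu3)) ae (gE x x01).
  move=> p p0 [gr gl].
  have -> : F m x p = mild_rhs K tau fL fR (state_of g) x p.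
    rewrite (@mild_rhs_ext _ _ _ _ _ (state_of g) m)//; last first.
      by move=> y y01; rewrite /m clamp_id.
    exact: (transport_mild K tau fL fR n0_gt0 adm x01 p0).
  rewrite /mild_rhs; have [pp|pn|p00] := ltgtP 0 p.1; last by move: p0; rewrite -p00 eqxx.
  - exact: gr.
  - exact: gl.
split => //; apply/funext => x; apply/funext => i.
rewrite /m state_ofE.
have -> : T m x i = \int[mu3]_p (F m (clamp 0 1 x) p * moment_weight i p).
  (* [transport] clamps its argument once more, which changes nothing. *)
  have cc : clamp 0 1 (clamp 0 1 x) = clamp 0 1 x by exact: clamp_id (clamp01 x).
  by apply: eq_Rintegral => p _; rewrite /transport cc.
have mF : measurable_fun setT (fun p => F m (clamp 0 1 x) p * moment_weight i p).
  apply: measurable_funM; last exact: measurable_moment_weight.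
  exact: (measurable_transport_at tau mphi n0_gt0 au_gt0 cu_gt0 k_gt0 ratio).
have mg : measurable_fun setT (fun p => g (clamp 0 1 x) p * moment_weight i p).
  apply: measurable_funM; last exact: measurable_moment_weight.
  exact: (in_L12_measurable_at gL (clamp01 x)).
apply/esym/(ae_eq_Rintegral mg mF).
by apply: filterS (gF _ (clamp01 x)) => p gp; rewrite gp.
Qed.

Lemma unique_solution : exists f, nonneg_mild_solution_with_bounds K tau fL fR f /\
  forall g, nonneg_mild_solution_with_bounds K tau fL fR g -> eq_L12 g f.
Proof.
have [m [adm Tm m_uniq]] := moment_fixed_point.
exists (F m); split; first exact: fixed_point_solves.
move=> g gS x x01; have [admg Tg gF] := solution_transport gS.
by rewrite -(m_uniq _ admg Tg); exact: gF.
Qed.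

End fixed_point_equation.

Theorem theorem2p2 (R : realType) (K : statistics) (fL fR : R3 R -> R)
  (mfL : measurable_fun [set p : R3 R | 0 < p.1] fL)
  (mfR : measurable_fun [set p : R3 R | p.1 < 0] fR)
  (fLR_ge0 : forall p, 0 <= fLR fL fR p)
  (fLR_int : (\int[lebesgue3 R]_p (fLR fL fR p * (1 + sqnorm p))%:E < +oo)%E)
  (fLR_int_inv :
    (\int[lebesgue3 R]_p (`|p.1|^-1 * fLR fL fR p * (1 + sqnorm p))%:E
       < +oo)%E)
  (fL_moments : \forall p1 \ae @lebesgue_measure R, 0 < p1 ->
    \int[lebesgue2 R]_q (fL (p1, q) * q.1) = 0 /\
    \int[lebesgue2 R]_q (fL (p1, q) * q.2) = 0)
  (fR_moments : \forall p1 \ae @lebesgue_measure R, p1 < 0 ->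
    \int[lebesgue2 R]_q (fR (p1, q) * q.1) = 0 /\
    \int[lebesgue2 R]_q (fR (p1, q) * q.2) = 0) :
  exists tau0 : R, 0 < tau0 /\
    forall tau : R, tau0 < tau ->
      0 < const_k fL fR tau ->
      const_au fL fR `^ (8 / 5) / const_k fL fR tau `^ (3 / 5)
        < beta K (beta_min K) ->
      exists f : R -> R3 R -> R,
        nonneg_mild_solution_with_bounds K tau fL fR f /\
        forall g : R -> R3 R -> R,
          nonneg_mild_solution_with_bounds K tau fL fR g -> eq_L12 g f.

Proof.
have mphi := measurable_fLR mfL mfR.
have ms : measurable_fun setT (fun p : R3 R => 1 + sqnorm p).
  by apply: measurable_funD => //; exact: measurable_sqnorm.
have phi_int : (lebesgue3 R).-integrable setT
    (EFin \o (fun p => fLR fL fR p * (1 + sqnorm p))).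
  apply: integrable_ge0 fLR_int; first exact: measurable_funM mphi ms.
  by move=> p; exact: mulr_ge0 (fLR_ge0 p) (sqnorm1_ge0 p).
have phi_int_inv : (lebesgue3 R).-integrable setT
    (EFin \o (fun p => `|p.1|^-1 * fLR fL fR p * (1 + sqnorm p))).
  apply: integrable_ge0 fLR_int_inv.
    apply: measurable_funM ms; apply: measurable_funM mphi.
    apply: measurableT_comp; first exact: measurable_invr.
    by apply: measurableT_comp => //; exact: measurable_fst.
  move=> p; apply: mulr_ge0 (sqnorm1_ge0 p); apply: mulr_ge0 (fLR_ge0 p).
  by rewrite invr_ge0.
have [[tau1 [tau1_gt0 k_gt0 ratio]]|none] := pselect (exists tau1 : R,
    [/\ 0 < tau1, 0 < const_k fL fR tau1 &
        const_au fL fR `^ (8 / 5) / const_k fL fR tau1 `^ (3 / 5)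
          < beta K (beta_min K)]); last first.
  exists 1; split => // tau tau1 k0 r; exfalso; apply: none; exists tau.
  by split => //; exact: lt_trans tau1.
have [n0_gt0 au_gt0 cu_gt0] := constants_gt0 mfL mfR fLR_ge0 phi_int tau1_gt0 k_gt0.
have [C [b [C_gt0 b_gt0 seb sel]]] := state_eq_lipschitz n0_gt0 au_gt0 cu_gt0 k_gt0 ratio.
pose g := gain_const (const_al fL fR tau1) (const_au fL fR).
have g0 : 0 <= g by exact: gain_const_ge0.
(* The three bounds give [omega_mass], [omega_energy] and [omega_lip], in this order. In the last
   one g + 1 stands for g, which is only known to be nonnegative. *)
pose eps := Num.min 2^-1
  (Num.min (const_cu fL fR / (2 * const_au fL fR)) (4 * (g + 1))^-1).
have eps_gt0 : 0 < eps.
  have g1 : 0 < 4 * (g + 1) by rewrite mulr_gt0// ltr_wpDl.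
  have a2 : 0 < 2 * const_au fL fR by exact: mulr_gt0.
  rewrite !lt_min; apply/and3P; split; first by rewrite invr_gt0.
    exact: divr_gt0.
  by rewrite invr_gt0.
have [tau2 tau2_gt0 small] := weight_integral_small n0_gt0 C_gt0 b_gt0 eps_gt0.
pose I := inverse_integral (fLR fL fR).
exists (Num.max tau1 (Num.max tau2 (4 * I))); split; first by rewrite lt_max tau1_gt0.
move=> tau; rewrite !gt_max => /and3P[t1 t2 t3] _ _.
have tau_gt0 := lt_trans tau1_gt0 t1.
have := small _ (ltW t2); rewrite !le_min => /and3P[w1 w2 w3].
have dle p := damping_mono fLR_ge0 p tau1_gt0 (ltW t1).
have md := measurable_damped mfL mfR tau.
have idp := integrable_damped mfL mfR fLR_ge0 phi_int tau_gt0.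
have al_le := const_al_le mfL mfR fLR_ge0 phi_int tau1_gt0 dle md idp.
apply: (unique_solution mfL mfR fLR_ge0 phi_int phi_int_inv tau_gt0 n0_gt0 au_gt0 cu_gt0
  k_gt0 ratio C_gt0 b_gt0 seb sel).
- by rewrite ler_pM2l.
- rewrite (_ : _ / 2 = const_au fL fR * (const_cu fL fR / (2 * const_au fL fR))).
    by rewrite ler_pM2l.
  by field; rewrite gt_eqF.
- apply: (@le_trans _ _ (g * (4 * (g + 1))^-1)); first exact: (ler_wpM2l g0).
  by rewrite invfM mulrCA ler_piMr// ler_pdivrMr ?mul1r ?lerDl//; lra.
- by rewrite mulrC ler_pdivrMr//; rewrite -/I; lra.
- by rewrite (const_alE _ _ tau).
- rewrite (const_kE _ _ tau).
  exact: (const_k_le_flux mfL mfR fLR_ge0 phi_int tau1_gt0 dle md idp).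
Qed.
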